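(* Let $m\ge2$ and let $A\in\mathrm L_{\mathbb P}(m)$ be a locally constant linear cocycle satisfying $$\int\big(\max\{\|A(\omega)\|,\|A(\omega)^{-1}\|\}\big)^\beta\,d\mathbb P<\infty\quad\text{for some }\beta>0$$ and $\lambda_1(A)>\lambda_2(A)$. If either $A$ or $A^T$ is quasi-irreducible, then there is a neighborhood $\mathcal B$ of $A$ in $(\mathrm L_{\mathbb P}(m),\mathrm d)$ such that the map $B\in\mathcal B\mapsto\lambda_1(B)$ is Hölder continuous. More specifically, there exist $C>0$ and $\gamma\in(0,1]$ such that $$|\lambda_1(B)-\lambda_1(B')|\le C\,\mathrm d^+(B,B')^\gamma\qquad\text{for every }B,B'\in\mathcal B.$$
   Context: $(\Omega,\mathscr F,\mathbb P)=(T^{\mathbb N},\mathscr A^{\mathbb N},p^{\mathbb N})$ is a fixed Bernoulli product space. A locally constant linear cocycle is a measurable $A:\Omega\to\mathrm{GL}(m)$ with $A(\omega)=A(\omega_0)$ for $\mathbb P$-a.e. $\omega$; $A^n(\omega)=A(\omega_{n-1})\cdots A(\omega_0)$. $\mathrm L_{\mathbb P}(m)$ is the set of such cocycles, up to $\mathbb P$-a.e. equality, with $\log^+\|A^{\pm1}\|$ $\mathbb P$-integrable. The metrics are $$\mathrm d^+(A,B)=\int\|A(\omega)-B(\omega)\|\,d\mathbb P,\qquad \mathrm d(A,B)=\int\|A(\omega)-B(\omega)\|+\|A(\omega)^{-1}-B(\omega)^{-1}\|\,d\mathbb P.$$ Lyapunov exponents are defined by $\sum_{i=1}^p\lambda_i(A)=\lim_n\frac1n\int\log\|\bigwedge^pA^n(\omega)\|\,d\mathbb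 P$. $A^T(\omega)=A(\omega)^T$ is the transposed cocycle. A subspace $L$ is $A$-invariant if $A(\omega)L=L$ a.s., $\lambda_1(A|_L)=\lim_n\frac1n\int\log\|A^n(\omega)|_L\|\,d\mathbb P$, and $A$ is quasi-irreducible if there is no proper (non-zero) $A$-invariant subspace $L$ with $\lambda_1(A|_L)<\lambda_1(A)$. *)

(* Defs.v *)
From HB Require Import structures.
From mathcomp Require Import all_boot all_order all_algebra.
From mathcomp Require Import all_classical all_reals all_analysis.
Import Order.TTheory GRing.Theory Num.Theory.
Import numFieldNormedType.Exports.

Set Implicit Arguments.
Unset Strict Implicit.
Unset Printing Implicit Defensive.

Local Open Scope classical_set_scope.
Local Open Scope ring_scope.

(** * The Bernoulli space [(T^N, A^N, p^N)] *)

Definition coordinate_sets d (T : measurableType d) : set (set (nat -> T)) :=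
  \bigcup_i preimage_set_system setT (fun w : nat -> T => w i) measurable.

Notation seqspace T := (g_sigma_algebraType (@coordinate_sets _ T)).

(* The library has no countable product of measures. The equations below
   determine [P] uniquely, since boxes form a generating pi-system. *)
Definition is_bernoulli d (T : measurableType d) (R : realType)
    (p : probability T R) (P : probability (seqspace T) R) : Prop :=
  forall (n : nat) (E : nat -> set T), (forall i, measurable (E i)) ->
    P [set w | forall i, (i < n)%N -> E i (w i)] = (\prod_(i < n) p (E i))%E.

Definition seq_shift (T : Type) (k : nat) (w : nat -> T) : nat -> T :=
  fun i => w (i + k)%N.

(** * Norms *)

Definition enorm (R : realType) n (x : 'cV[R]_n) : R :=
  Num.sqrt (\sum_i x i ord0 ^+ 2).

Definition opnorm_on (R : realType) m n (L : {vspace 'cV[R]_n})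
    (M : 'M[R]_(m, n)) : R :=
  sup [set enorm (M *m x) | x in [set x | x \in L /\ enorm x <= 1]].

Definition opnorm (R : realType) m n (M : 'M[R]_(m, n)) : R :=
  opnorm_on fullv M.

Definition incr_tuple k m :=
  {f : {ffun 'I_k -> 'I_m} |
     [forall i : 'I_k, forall j : 'I_k, (i < j)%N ==> (f i < f j)%N]}.

(* The matrix of the k-th exterior power of [M] in the basis
   [e_I = e_(I 0) /\ ... /\ e_(I (k-1))], [I] increasing, which is orthonormal
   for the inner product induced on the exterior power: its entries are the
   [k x k] minors of [M]. *)
Definition exterior_power (R : comNzRingType) m k (M : 'M[R]_m) :
    'M[R]_(#|{: incr_tuple k m}|) :=
  \matrix_(i < #|{: incr_tuple k m}|, j < #|{: incr_tuple k m}|)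
    \det (mxsub (val (enum_val i)) (val (enum_val j)) M).

(** * Locally constant linear cocycles *)

Section cocycles.
Context d (T : measurableType d) (R : realType) (m : nat).
Implicit Types (P : probability (seqspace T) R) (A B : seqspace T -> 'M[R]_m).

Definition GL_measurable d' (X : measurableType d') (A : X -> 'M[R]_m) : Prop :=
  (forall w, A w \in unitmx) /\
  (forall i j, measurable_fun setT (fun w => A w i j)).

Definition locally_constant P A : Prop :=
  exists2 a : T -> 'M[R]_m, GL_measurable a & {ae P, forall w, A w = a (w 0%N)}.

Definition log_plus (x : R) : R := Num.max (ln x) 0.

(* Cocycles are represented by functions; a.e. equality is equality for [cocycle_dist],
   and all the notions below are invariant under it. *)
Definition LP P : set (seqspace T -> 'M[R]_m) :=
  [set A | [/\ GL_measurable A,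
               locally_constant P A,
               P.-integrable setT (EFin \o (fun w => log_plus (opnorm (A w)))) &
               P.-integrable setT
                 (EFin \o (fun w => log_plus (opnorm (invmx (A w)))))]].

(* [A (seq_shift k w)] is what is usually written [A(w_k)] for a locally constant
   [A]; see [cocycle_iter_ae] below. *)
Fixpoint cocycle_iter A (n : nat) (w : seqspace T) : 'M[R]_m :=
  if n is k.+1 then A (seq_shift k w) *m cocycle_iter A k w else 1%:M.

Definition transpose_cocycle A : seqspace T -> 'M[R]_m := fun w => (A w)^T.

Definition lyapunov_sum P A (k : nat) : R :=
  limn (fun n => n%:R^-1 *
    \int[P]_w ln (opnorm (exterior_power k (cocycle_iter A n w)))).

(* The exponents are indexed from 1. *)
Definition lyapunov P A (i : nat) : R :=
  lyapunov_sum P A i - lyapunov_sum P A i.-1.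

Definition lyapunov_on P A (L : {vspace 'cV[R]_m}) : R :=
  limn (fun n => n%:R^-1 * \int[P]_w ln (opnorm_on L (cocycle_iter A n w))).

Definition invariant_subspace P A (L : {vspace 'cV[R]_m}) : Prop :=
  {ae P, forall w, (linfun (mulmx (A w)) @: L)%VS = L}.

Definition quasi_irreducible P A : Prop :=
  ~ exists L : {vspace 'cV[R]_m},
      [/\ L != 0%VS, L != fullv, invariant_subspace P A L &
          lyapunov_on P A L < lyapunov P A 1].

Definition cocycle_dist_plus P A B : \bar R :=
  (\int[P]_w (opnorm (A w - B w))%:E)%E.

(* May be [+oo] on [LP P]. *)
Definition cocycle_dist P A B : \bar R :=
  (\int[P]_w (opnorm (A w - B w) + opnorm (invmx (A w) - invmx (B w)))%:E)%E.

Definition LP_nbhs P A : set (set (seqspace T -> 'M[R]_m)) :=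
  [set N | N `<=` LP P /\
     exists2 r : R, 0 < r & [set B | LP P B /\ (cocycle_dist P A B < r%:E)%E] `<=` N].

End cocycles.

(** * The iterates and the exponents in their usual form *)

Lemma preimage_shift T k n (E : nat -> set T) :
  seq_shift k @^-1` [set w | forall i, (i < n)%N -> E i (w i)] =
  [set w | forall i, (i < n + k)%N ->
     (if (i < k)%N then setT else E (i - k)%N) (w i)].
Proof.
apply/seteqP; split => w /= H i ilt.
  case: ltnP => // ki; have := H (i - k)%N.
  by rewrite /seq_shift subnK//; apply; rewrite ltn_subLR// addnC.
have := H (i + k)%N; rewrite ltn_add2r => /(_ ilt).
by rewrite ltnNge leq_addl/= addnK.
Qed.

Section lemmas.
Context d (T : measurableType d) (R : realType).
Variables (p : probability T R) (P : probability (seqspace T) R).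

Lemma measurable_coord i : measurable_fun setT (fun w : seqspace T => w i).
Proof.
move=> _ E mE; apply: sub_sigma_algebra.
by exists i => //; exists E.
Qed.

Lemma measurable_box n (E : nat -> set T) : (forall i, measurable (E i)) ->
  measurable ([set w | forall i, (i < n)%N -> E i (w i)] : set (seqspace T)).
Proof.
move=> mE.
rewrite [X in measurable X](_ : _ =
    \bigcap_(i in [set i | (i < n)%N]) ((fun w : seqspace T => w i) @^-1` E i)); last first.
  by apply/seteqP; split => w /= H i; exact: H.
apply: bigcap_measurableType => i _.
by rewrite -[X in measurable X]setTI; exact: measurable_coord.
Qed.

Lemma measurable_seq_shift k :
  measurable_fun setT (seq_shift k : seqspace T -> seqspace T).
Proof.
apply: (@measurability _ _ (seqspace T) (seqspace T) setT (seq_shift k)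
  (@coordinate_sets _ T) erefl).
move=> _ [_ [i _ [E mE <-]] <-].
apply: sub_sigma_algebra; exists (i + k)%N => //; exists E => //.
by rewrite !setTI.
Qed.

Lemma bernoulli_shift k (X : set (seqspace T)) : is_bernoulli p P ->
  measurable X -> P (seq_shift k @^-1` X) = P X.
Proof.
move=> hP mX.
pose G : set (set (seqspace T)) := [set X | exists n, exists2 E : nat -> set T,
  (forall i, measurable (E i)) & X = [set w | forall i, (i < n)%N -> E i (w i)]].
have GE : @measurable _ (seqspace T) = <<s G >>.
  apply/seteqP; split.
    apply: smallest_sub; first exact: smallest_sigma_algebra.
    move=> _ [i _ [E mE <-]]; apply: sub_sigma_algebra.
    exists i.+1, (fun j => if j == i then E else setT).
      by move=> j; case: ifP.
    apply/seteqP; split => w /=; last by move/(_ i (leqnn _)); rewrite eqxx.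
    by move=> [_ Ei] j _; case: eqP => [->|].
  apply: smallest_sub; first exact: sigma_algebra_measurable.
  by move=> _ [n [E mE ->]]; exact: measurable_box.
pose PS : {measure set (seqspace T) -> \bar R} :=
  measure_function_pushforward__canonical__measure_function_Measure P
    (measurable_seq_shift k).
apply: (@measure_unique _ _ _ G (fun=> setT) GE _ _ _ PS P) => //.
- move=> _ _ [n1 [E1 mE1 ->]] [n2 [E2 mE2 ->]].
  exists (maxn n1 n2), (fun i => (if (i < n1)%N then E1 i else setT) `&`
                                 (if (i < n2)%N then E2 i else setT)).
    by move=> i; apply: measurableI; case: ifP.
  apply/seteqP; split => w /=.
    by move=> [H1 H2] i _; split; case: ifP => //; [exact: H1|exact: H2].
  move=> H; split => i ilt; have [] := H i.
  - by rewrite leq_max ilt.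
  - by rewrite ilt.
  - by rewrite leq_max ilt orbT.
  - by rewrite ilt.
- by move=> _; exists 0%N, (fun=> setT) => //; apply/seteqP; split.
- by apply/seteqP; split => // w _; exists 0%N.
- move=> _ [n [E mE ->]]; rewrite /PS /= /pushforward preimage_shift.
  rewrite (hP _ E)// (hP _ (fun i => if (i < k)%N then setT else E (i - k)%N));
    last by move=> i; case: ifP.
  rewrite addnC big_split_ord /= big1 ?mul1e => [|i _].
    by apply: eq_bigr => i _; rewrite ltnNge leq_addr/= addKn.
  by rewrite ltn_ord probability_setT.
- by move=> _; rewrite /PS /= /pushforward preimage_setT probability_setT ltry.
Qed.

Lemma ae_shift k (Q : seqspace T -> Prop) : is_bernoulli p P ->
  {ae P, forall w, Q w} -> {ae P, forall w, Q (seq_shift k w)}.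
Proof.
move=> hP [B [mB PB sub]]; exists (seq_shift k @^-1` B); split.
- by rewrite -[X in measurable X]setTI; exact: measurable_seq_shift.
- by rewrite bernoulli_shift.
- by move=> w /= nQ; apply: sub.
Qed.

Lemma cocycle_iter_ae m (A : seqspace T -> 'M[R]_m) (a : T -> 'M[R]_m) :
  is_bernoulli p P -> {ae P, forall w, A w = a (w 0%N)} ->
  {ae P, forall w, forall n,
    cocycle_iter A n w = \big[mulmx/1%:M]_(i <- rev (iota 0 n)) a (w i)}.
Proof.
move=> hP Aa.
have H : {ae P, forall w, forall k, A (seq_shift k w) = a (w k)}.
  apply/ae_foralln => k.
  have FP := ae_filter_ringOfSetsType P.
  have := ae_shift k hP Aa.
  apply: (@filterS _ (almost_everywhere P) FP) => w ->.
  by rewrite /seq_shift add0n.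
have FP := ae_filter_ringOfSetsType P.
move: H; apply: (@filterS _ (almost_everywhere P) FP) => w H; elim=> [|n IHn]; first by rewrite big_nil.
by rewrite -(addn1 n) iotaD rev_cat big_cons -IHn addn1 /= H.
Qed.

End lemmas.

Lemma enorm_scalar (R : realType) (x : 'cV[R]_1) : enorm x = `|x ord0 ord0|.
Proof. by rewrite /enorm big_ord1 sqrtr_sqr. Qed.

Lemma exterior_power0 (R : comNzRingType) m (M : 'M[R]_m) :
  exterior_power 0 M = 1%:M.
Proof.
apply/matrixP => i j; rewrite !mxE det_mx00.
have -> : i = j.
  by apply: enum_val_inj; apply/val_inj/ffunP; case.
by rewrite eqxx.
Qed.

Lemma card_incr_tuple0 m : #|{: incr_tuple 0 m}| = 1%N.
Proof.
pose f0 : {ffun 'I_0 -> 'I_m} := ffun0 (card_ord 0).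
have f0P : [forall i : 'I_0, forall j : 'I_0, (i < j)%N ==> (f0 i < f0 j)%N].
  by apply/forallP; case.
apply/eqP/fintype1P; exists (exist _ f0 f0P : incr_tuple 0 m) => f.
by apply/val_inj/ffunP; case.
Qed.

Lemma lyapunov_sum0 d (T : measurableType d) (R : realType) m
    (P : probability (seqspace T) R) (A : seqspace T -> 'M[R]_m) :
  lyapunov_sum P A 0 = 0.
Proof.
have ln0 n w : ln (opnorm (exterior_power 0 (cocycle_iter A n w))) = 0.
  rewrite exterior_power0 (card_incr_tuple0 m) /opnorm /opnorm_on.
  rewrite (_ : [set _ | _ in _] = [set r : R | 0 <= r <= 1]); last first.
    apply/seteqP; split => [_ [x [_ x1] <-]|r /andP[r0 r1]] /=.
      by rewrite mul1mx sqrtr_ge0.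
    have rE : enorm (const_mx r : 'cV[R]_1) = r.
      by rewrite enorm_scalar mxE ger0_norm.
    by exists (const_mx r); rewrite ?mul1mx// rE memvf.
  rewrite (_ : sup _ = 1) ?ln1//; apply/eqP; rewrite eq_le; apply/andP; split.
    by apply: ge_sup => [|r /andP[]//]; exists 0; rewrite /= lexx ler01.
  apply: ub_le_sup; last by rewrite /= ler01 lexx.
  by exists 1 => r /andP[].
rewrite /lyapunov_sum (_ : (fun n => _) = cst 0) ?lim_cst//.
apply/funext => n; under eq_Rintegral do rewrite ln0.
by rewrite Rintegral_cst//= mul0r mulr0.
Qed.

Lemma sum_lyapunov d (T : measurableType d) (R : realType) m
    (P : probability (seqspace T) R) (A : seqspace T -> 'M[R]_m) k :
  \sum_(1 <= i < k.+1) lyapunov P A i = lyapunov_sum P A k.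
Proof.
rewrite big_add1 /= telescope_sumr// lyapunov_sum0 subr0//.
Qed.

(* Main.v *)
(* Write [E] for the expectation, [B^n] for the iterates of a cocycle [B], [b] for its
   step (a matrix valued function of one coordinate), and
   [pcontr N x = |Lambda^2 N| |x|^2 / |N x|^2], which bounds the square of the local
   Lipschitz constant of the projective action of [N] at [x].

   Stationary measures are avoided. Fix [c < lambda_1(A)]. The vectors [x] such that
   [|A^n x| = O(e^(nc))] form a random subspace; a zero-one argument on the subspaces
   of maximal dimension contained in it with positive probability yields an invariant
   subspace on which the exponent is at most [c], so by quasi-irreducibility
   [|A^n x|/e^(nc)] is almost surely unbounded for each fixed [x <> 0]. By compactness
   the time needed to exceed [e^(nc) |x|] is uniform in [x], and summing along an orbit
   the maximal functions [max_(n <= N) (ln (|A^n x|/|x|) - n c)] gives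
   [E ln (|A^n x|/|x|) >= n (c - eps) - C] uniformly in [x]. Together with the gap
   [2 lambda_1 > lambda_1 + lambda_2] this gives [E ln (pcontr A^N x) <= -1] for some [N],
   hence [E (pcontr A^N x)^alpha <= theta < 1] for some small [alpha > 0], uniformly in [x].

   The last property is stable under small perturbations in [d^+], as all cocycles in
   the ball have a common moment. For [B], [B'] close to [A] it makes
   [x |-> E ln (|B^(jN) x|/|x|)] alpha-Hoelder on the projective space uniformly in [j],
   so replacing [B] by [B'] in one block of length [N] costs [O(d^+(B,B')^alpha)];
   telescoping over [j] blocks and dividing by [jN] gives the estimate. The case where
   the transpose is quasi-irreducible reduces to this one, reversing the order of the
   first [n] coordinates of [P]. *)
Require Import Defs.
From HB Require Import structures.
From mathcomp Require Import all_boot all_order all_algebra.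
From mathcomp Require Import all_classical all_reals all_analysis.
From mathcomp Require Import measurable_realfun.
From mathcomp Require Import ring lra zify.
Import Order.TTheory GRing.Theory Num.Theory.
Import numFieldNormedType.Exports.

Set Implicit Arguments.
Unset Strict Implicit.
Unset Printing Implicit Defensive.

Local Open Scope classical_set_scope.
Local Open Scope ring_scope.

(** * Euclidean and operator norms *)

Section euclidean.
Context {R : realType}.

(** Independence carries the argument. A bound valid for every fixed direction [x], with a constant
    that does not depend on [x], also holds along a random orbit: the direction reached after [k]
    steps is a function of the first [k] coordinates, and the later steps are independent of these.
    Hence the estimates are suprema over [x] of expectations, not expectations of suprema, and
    [splice] reduces independence to Fubini's theorem.

    Integrability is the other constraint. Only a small moment of [gl_size] is available, while
    [d^+] controls the first power of a difference. Lipschitz bounds are therefore weakened to small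
    powers [alpha], and products of a size and a difference are separated by the weighted inequality
    between arithmetic and geometric means, with weight [e^alpha] when [e] bounds [d^+(B,B')].
    Perturbing [pcontr] costs a seventh power of the size, and the squaring in that inequality is
    the origin of the condition [14 * alpha <= s]. The metric [d] gives the common moment on a ball,
    since it also controls the inverses. *)

Definition dotp n (x y : 'cV[R]_n) : R := \sum_i x i ord0 * y i ord0.

Lemma enorm_sqr n (x : 'cV[R]_n) : enorm x ^+ 2 = dotp x x.
Proof.
rewrite /enorm sqr_sqrtr; last by apply: sumr_ge0 => i _; exact: sqr_ge0.
by apply: eq_bigr => i _; rewrite expr2.
Qed.

Lemma enorm_ge0 n (x : 'cV[R]_n) : 0 <= enorm x.
Proof. exact: sqrtr_ge0. Qed.

Lemma dotpC n (x y : 'cV[R]_n) : dotp x y = dotp y x.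
Proof. by apply: eq_bigr => i _; rewrite mulrC. Qed.

Lemma dotpDl n (x y z : 'cV[R]_n) : dotp (x + y) z = dotp x z + dotp y z.
Proof. by rewrite /dotp -big_split; apply: eq_bigr => i _; rewrite mxE mulrDl. Qed.

Lemma dotpZl n a (x z : 'cV[R]_n) : dotp (a *: x) z = a * dotp x z.
Proof. by rewrite /dotp mulr_sumr; apply: eq_bigr => i _; rewrite mxE mulrA. Qed.

Lemma dotpDr n (x y z : 'cV[R]_n) : dotp z (x + y) = dotp z x + dotp z y.
Proof. by rewrite dotpC dotpDl !(dotpC z). Qed.

Lemma dotpZr n a (x z : 'cV[R]_n) : dotp z (a *: x) = a * dotp z x.
Proof. by rewrite dotpC dotpZl dotpC. Qed.

Lemma enorm_eq0 n (x : 'cV[R]_n) : (enorm x == 0) = (x == 0).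
Proof.
apply/idP/eqP => [x0|->]; last first.
  by rewrite -sqrf_eq0 enorm_sqr /dotp big1// => i _; rewrite mxE mul0r.
apply/matrixP => i j; rewrite (ord1 j) mxE.
move: x0; rewrite -sqrf_eq0 enorm_sqr psumr_eq0; last first.
  by move=> k _; rewrite -expr2 sqr_ge0.
by move=> /allP/(_ i); rewrite mem_index_enum => /(_ isT); rewrite /= mulf_eq0 orbb => /eqP.
Qed.

Lemma enorm0 n : enorm (0 : 'cV[R]_n) = 0.
Proof. by apply/eqP; rewrite enorm_eq0. Qed.

Lemma enorm_gt0 n (x : 'cV[R]_n) : (0 < enorm x) = (x != 0).
Proof. by rewrite lt_neqAle enorm_ge0 andbT eq_sym enorm_eq0. Qed.

Lemma enormZ n a (x : 'cV[R]_n) : enorm (a *: x) = `|a| * enorm x.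
Proof.
apply/eqP; rewrite -(@eqrXn2 _ 2)// ?mulr_ge0 ?enorm_ge0//.
by rewrite exprMn !enorm_sqr dotpZl dotpZr mulrA -expr2 real_normK ?num_real.
Qed.

Lemma enormN n (x : 'cV[R]_n) : enorm (- x) = enorm x.
Proof. by rewrite -scaleN1r enormZ normrN normr1 mul1r. Qed.

(** Lagrange's identity. It gives Cauchy-Schwarz, and its exact form computes the norm of
    [wedge x y], which makes [pdist] a sine. *)
Lemma sum_minor2_sqr n (x y : 'cV[R]_n) :
  \sum_i \sum_j (x i ord0 * y j ord0 - x j ord0 * y i ord0) ^+ 2 =
  2 * (dotp x x * dotp y y - dotp x y ^+ 2).
Proof.
have E a b c e : dotp (n:=n) a b * dotp c e = \sum_i \sum_j (a i ord0 * b i ord0 * (c j ord0 * e j ord0)).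
  by rewrite /dotp mulr_suml; apply: eq_bigr => i _; rewrite mulr_sumr.
have -> : 2 * (dotp x x * dotp y y - dotp x y ^+ 2) =
   dotp x x * dotp y y + dotp y y * dotp x x - 2 * (dotp x y * dotp x y) by ring.
rewrite !E mulr_sumr -big_split -sumrB; apply: eq_bigr => i _ /=.
rewrite mulr_sumr -big_split -sumrB; apply: eq_bigr => j _ /=.
ring.
Qed.

Lemma CauchySchwarz_sqr n (x y : 'cV[R]_n) : dotp x y ^+ 2 <= dotp x x * dotp y y.
Proof.
rewrite -subr_ge0 -(@pmulr_rge0 _ 2)// -sum_minor2_sqr.
by apply: sumr_ge0 => i _; apply: sumr_ge0 => j _; exact: sqr_ge0.
Qed.

Lemma CauchySchwarz n (x y : 'cV[R]_n) : `|dotp x y| <= enorm x * enorm y.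
Proof.
rewrite -(@ler_pXn2r _ 2) ?nnegrE ?mulr_ge0 ?enorm_ge0//.
by rewrite real_normK ?num_real// exprMn !enorm_sqr CauchySchwarz_sqr.
Qed.

Lemma enormD n (x y : 'cV[R]_n) : enorm (x + y) <= enorm x + enorm y.
Proof.
rewrite -(@ler_pXn2r _ 2) ?nnegrE ?addr_ge0 ?enorm_ge0//.
rewrite enorm_sqr sqrrD !enorm_sqr dotpDl !dotpDr (dotpC y x) mulr2n.
have := le_trans (ler_norm _) (CauchySchwarz x y); lra.
Qed.

Lemma enormB n (x y : 'cV[R]_n) : enorm x - enorm y <= enorm (x - y).
Proof. by rewrite lerBlDr (le_trans _ (enormD _ _))// subrK. Qed.

Lemma enorm_distC n (x y : 'cV[R]_n) : enorm (x - y) = enorm (y - x).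
Proof. by rewrite -enormN opprB. Qed.

Lemma enorm_sum n (I : Type) (s : seq I) (P : pred I) (F : I -> 'cV[R]_n) :
  enorm (\sum_(i <- s | P i) F i) <= \sum_(i <- s | P i) enorm (F i).
Proof.
elim/big_rec2 : _ => [|i y z _ H]; first by rewrite enorm0.
by rewrite (le_trans (enormD _ _))// lerD2l.
Qed.

Lemma ler_enorm_entry n (x : 'cV[R]_n) i : `|x i ord0| <= enorm x.
Proof.
rewrite -(@ler_pXn2r _ 2) ?nnegrE ?enorm_ge0// enorm_sqr real_normK ?num_real//.
rewrite /dotp (bigD1 i)//= -expr2 lerDl.
by apply: sumr_ge0 => k _; rewrite -expr2 sqr_ge0.
Qed.

Lemma enorm_delta n (i : 'I_n) : enorm (delta_mx i ord0 : 'cV[R]_n) = 1.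
Proof.
apply/eqP; rewrite -(@eqrXn2 _ 2)// ?enorm_ge0// expr1n enorm_sqr /dotp (bigD1 i)//=.
rewrite !mxE !eqxx mulr1 big1 ?addr0// => j ji.
by rewrite !mxE (negbTE ji) mul0r.
Qed.

Lemma col_sum_delta n (x : 'cV[R]_n) : x = \sum_i x i ord0 *: delta_mx i ord0.
Proof.
rewrite {1}(matrix_sum_delta x); apply: eq_bigr => i _.
by rewrite big_ord1.
Qed.

Lemma enorm_le_sum n (x : 'cV[R]_n) : enorm x <= \sum_i `|x i ord0|.
Proof.
rewrite {1}(col_sum_delta x) (le_trans (enorm_sum _ _ _))// ler_sum// => i _.
by rewrite enormZ enorm_delta mulr1.
Qed.

(** Crude, but it bounds the set whose supremum defines [opnorm_on]; the supremum of an unbounded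
    set would default to 0. *)
Lemma enorm_mulmx_sum m n (M : 'M[R]_(m, n)) (x : 'cV[R]_n) :
  enorm (M *m x) <= (\sum_i \sum_j `|M i j|) * enorm x.
Proof.
rewrite (le_trans (enorm_le_sum _))// mulr_suml ler_sum// => i _.
rewrite mxE (le_trans (ler_norm_sum _ _ _))// mulr_suml ler_sum// => j _.
by rewrite normrM ler_wpM2l// ler_enorm_entry.
Qed.

Lemma dotp_mulmx m n (M : 'M[R]_(m, n)) (x : 'cV[R]_n) (y : 'cV[R]_m) :
  dotp (M *m x) y = dotp x (M^T *m y).
Proof.
rewrite /dotp; under eq_bigr do rewrite mxE mulr_suml.
rewrite exchange_big /=; apply: eq_bigr => j _.
rewrite mxE mulr_sumr; apply: eq_bigr => i _.
by rewrite !mxE; ring.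
Qed.

End euclidean.

Section operator_norm.
Context {R : realType}.

Lemma opnorm_on_has_sup m n (L : {vspace 'cV[R]_n}) (M : 'M[R]_(m, n)) :
  has_sup [set enorm (M *m x) | x in [set x | x \in L /\ enorm x <= 1]].
Proof.
split.
  exists (enorm (M *m 0)), 0 => //.
  by rewrite /= mem0v enorm0; split.
exists (\sum_i \sum_j `|M i j|) => _ [x [_ x1] <-].
rewrite (le_trans (enorm_mulmx_sum _ _))// ler_piMr//.
by apply: sumr_ge0 => i _; apply: sumr_ge0.
Qed.

Lemma opnorm_on_ge0 m n (L : {vspace 'cV[R]_n}) (M : 'M[R]_(m, n)) :
  0 <= opnorm_on L M.
Proof.
have [_ ub] := opnorm_on_has_sup L M.
apply: (ub_le_sup ub); exists 0; last by rewrite mulmx0 enorm0.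
by rewrite /= mem0v enorm0; split.
Qed.

Lemma ler_opnorm_on m n (L : {vspace 'cV[R]_n}) (M : 'M[R]_(m, n)) x :
  x \in L -> enorm (M *m x) <= opnorm_on L M * enorm x.
Proof.
move=> xL; have [->|x0] := eqVneq x 0; first by rewrite mulmx0 !enorm0 mulr0.
have nx : 0 < enorm x by rewrite enorm_gt0.
rewrite -ler_pdivrMr// mulrC -[(enorm x)^-1]ger0_norm ?invr_ge0 ?enorm_ge0//.
rewrite -enormZ scalemxAr.
have [_ ub] := opnorm_on_has_sup L M; apply: (ub_le_sup ub).
exists ((enorm x)^-1 *: x) => //; split; first exact: memvZ.
by rewrite enormZ ger0_norm ?invr_ge0 ?enorm_ge0// mulVf// gt_eqF.
Qed.

Lemma opnorm_on_le m n (L : {vspace 'cV[R]_n}) (M : 'M[R]_(m, n)) C :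
  0 <= C -> (forall x, x \in L -> enorm (M *m x) <= C * enorm x) ->
  opnorm_on L M <= C.
Proof.
move=> C0 H; have [ne _] := opnorm_on_has_sup L M.
apply: ge_sup => // _ [x [xL x1] <-].
by rewrite (le_trans (H _ xL))// ler_piMr.
Qed.

Lemma ler_opnorm m n (M : 'M[R]_(m, n)) x : enorm (M *m x) <= opnorm M * enorm x.
Proof. by apply: ler_opnorm_on; rewrite memvf. Qed.

Lemma opnorm_le m n (M : 'M[R]_(m, n)) C :
  0 <= C -> (forall x, enorm (M *m x) <= C * enorm x) -> opnorm M <= C.
Proof. by move=> C0 H; apply: opnorm_on_le. Qed.

Lemma opnorm_ge0 m n (M : 'M[R]_(m, n)) : 0 <= opnorm M.
Proof. exact: opnorm_on_ge0. Qed.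

Lemma opnorm_on_le_opnorm m n (L : {vspace 'cV[R]_n}) (M : 'M[R]_(m, n)) :
  opnorm_on L M <= opnorm M.
Proof. by apply: opnorm_on_le => [|x _]; [exact: opnorm_ge0|exact: ler_opnorm]. Qed.

Lemma opnormM m n p (M : 'M[R]_(m, n)) (N : 'M[R]_(n, p)) :
  opnorm (M *m N) <= opnorm M * opnorm N.
Proof.
apply: opnorm_le => [|x]; first by rewrite mulr_ge0 ?opnorm_ge0.
rewrite -mulmxA (le_trans (ler_opnorm _ _))// -mulrA ler_wpM2l ?opnorm_ge0//.
exact: ler_opnorm.
Qed.

Lemma opnormD m n (M N : 'M[R]_(m, n)) : opnorm (M + N) <= opnorm M + opnorm N.
Proof.
apply: opnorm_le => [|x]; first by rewrite addr_ge0 ?opnorm_ge0.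
by rewrite mulmxDl (le_trans (enormD _ _))// mulrDl lerD// ler_opnorm.
Qed.

Lemma opnormN m n (M : 'M[R]_(m, n)) : opnorm (- M) = opnorm M.
Proof.
suff H (N : 'M[R]_(m, n)) : opnorm (- N) <= opnorm N.
  by apply/eqP; rewrite eq_le H -{1}(opprK M) H.
by apply: opnorm_le => [|x]; rewrite ?opnorm_ge0// mulNmx enormN ler_opnorm.
Qed.

Lemma opnorm_distC m n (M N : 'M[R]_(m, n)) : opnorm (M - N) = opnorm (N - M).
Proof. by rewrite -opnormN opprB. Qed.

Lemma opnorm_entry m n (M : 'M[R]_(m, n)) i j : `|M i j| <= opnorm M.
Proof.
have -> : M i j = (M *m (delta_mx j ord0 : 'cV_n)) i ord0.
  by have /matrixP/(_ i ord0) := colE j M; rewrite mxE.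
rewrite (le_trans (ler_enorm_entry _ _))// (le_trans (ler_opnorm _ _))//.
by rewrite enorm_delta mulr1.
Qed.

Lemma opnorm_le_sum m n (M : 'M[R]_(m, n)) : opnorm M <= \sum_i \sum_j `|M i j|.
Proof.
apply: opnorm_le => [|x]; last exact: enorm_mulmx_sum.
by apply: sumr_ge0 => i _; apply: sumr_ge0.
Qed.

Lemma opnorm1 m : (0 < m)%N -> opnorm (1%:M : 'M[R]_m) = 1.
Proof.
case: m => // m _; apply/eqP; rewrite eq_le; apply/andP; split.
  by apply: opnorm_le => // x; rewrite mul1mx mul1r.
have := ler_opnorm (1%:M : 'M[R]_m.+1) (delta_mx ord0 ord0).
by rewrite mul1mx enorm_delta mulr1.
Qed.

Lemma opnorm_eq0 m n (M : 'M[R]_(m, n)) : opnorm M = 0 -> M = 0.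
Proof.
move=> M0; apply/matrixP => i j; rewrite mxE; apply/eqP.
by rewrite -normr_le0 -M0 opnorm_entry.
Qed.

(** The square of [|N^T x|] is the pairing of [N N^T x] with [x]; Cauchy-Schwarz bounds it and one
    factor [|N^T x|] cancels. *)
Lemma opnorm_tr m n (M : 'M[R]_(m, n)) : opnorm M^T = opnorm M.
Proof.
suff H p q (N : 'M[R]_(p, q)) : opnorm N^T <= opnorm N.
  by apply/eqP; rewrite eq_le H -{1}(trmxK M) H.
apply: opnorm_le => [|x]; first exact: opnorm_ge0.
have [->|nz] := eqVneq (enorm (N^T *m x)) 0; first by rewrite mulr_ge0 ?opnorm_ge0 ?enorm_ge0.
have pos : 0 < enorm (N^T *m x) by rewrite lt_neqAle eq_sym nz enorm_ge0.
rewrite -(ler_pM2l pos) -expr2 enorm_sqr -dotp_mulmx.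
rewrite (le_trans (ler_norm _))// (le_trans (CauchySchwarz _ _))//.
by rewrite mulrCA mulrA ler_wpM2r ?enorm_ge0// ler_opnorm.
Qed.

Lemma opnorm_gt0 m (M : 'M[R]_m) : (0 < m)%N -> M \in unitmx -> 0 < opnorm M.
Proof.
move=> m0 Mu; rewrite lt_neqAle opnorm_ge0 andbT eq_sym; apply/eqP => /opnorm_eq0 M0.
have := opnorm1 m0; rewrite -(mulVmx Mu) M0 mulmx0 => /eqP; rewrite lt_eqF//.
rewrite (le_lt_trans _ ltr01)//; apply: opnorm_le => // x.
by rewrite mul0mx enorm0 mul0r.
Qed.

Lemma mulmx_unit_eq0 m (M : 'M[R]_m) (x : 'cV[R]_m) : M \in unitmx ->
  (M *m x == 0) = (x == 0).
Proof.
move=> Mu; apply/eqP/eqP => [H|->]; last by rewrite mulmx0.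
by rewrite -[x]mul1mx -(mulVmx Mu) -mulmxA H mulmx0.
Qed.

Lemma opnorm_inv_ler m (M : 'M[R]_m) (x : 'cV[R]_m) : M \in unitmx ->
  enorm x <= opnorm (invmx M) * enorm (M *m x).
Proof. by move=> Mu; rewrite -{1}[x]mul1mx -(mulVmx Mu) -mulmxA ler_opnorm. Qed.

(** On invertible matrices this is submultiplicative and at least 1, so its powers increase with the
    exponent. It is the single weight in which the errors below are measured. *)
Definition gl_size m (M : 'M[R]_m) : R := Num.max (opnorm M) (opnorm (invmx M)).

Lemma opnorm_le_size m (M : 'M[R]_m) : opnorm M <= gl_size M.
Proof. by rewrite le_max lexx. Qed.

Lemma opnormV_le_size m (M : 'M[R]_m) : opnorm (invmx M) <= gl_size M.
Proof. by rewrite le_max lexx orbT. Qed.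

Lemma gl_size_ge0 m (M : 'M[R]_m) : 0 <= gl_size M.
Proof. by rewrite (le_trans (opnorm_ge0 M))// opnorm_le_size. Qed.

Lemma gl_size_ge1 m (M : 'M[R]_m) : (0 < m)%N -> M \in unitmx -> 1 <= gl_size M.
Proof.
move=> m0 Mu; rewrite leNgt; apply/negP => lt1.
have := opnormM (invmx M) M; rewrite mulVmx// opnorm1// leNgt => /negP; apply.
rewrite (le_lt_trans _ lt1)// (le_trans _ (opnormV_le_size M))//.
by rewrite ler_piMr ?opnorm_ge0// (le_trans (opnorm_le_size M))// ltW.
Qed.

Lemma gl_size1 m : (0 < m)%N -> gl_size (1%:M : 'M[R]_m) = 1.
Proof. by move=> m0; rewrite /gl_size invmx1 opnorm1// maxxx. Qed.

Lemma invmxM m (M N : 'M[R]_m) : M \in unitmx -> N \in unitmx ->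
  invmx (M *m N) = invmx N *m invmx M.
Proof.
move=> Mu Nu; have MNu : M *m N \in unitmx by rewrite unitmx_mul Mu Nu.
rewrite -[RHS]mul1mx -(mulVmx MNu) -!mulmxA (mulmxA N) mulmxV// mul1mx.
by rewrite mulmxV// mulmx1.
Qed.

Lemma gl_sizeM m (M N : 'M[R]_m) : M \in unitmx -> N \in unitmx ->
  gl_size (M *m N) <= gl_size M * gl_size N.
Proof.
move=> Mu Nu; rewrite {1}/gl_size ge_max; apply/andP; split.
  by rewrite (le_trans (opnormM _ _))// ler_pM ?opnorm_ge0 ?opnorm_le_size.
rewrite invmxM// (le_trans (opnormM _ _))// mulrC.
by rewrite ler_pM ?opnorm_ge0 ?opnormV_le_size.
Qed.

Lemma enorm_mulmx_gt0 m (M : 'M[R]_m) (x : 'cV[R]_m) : M \in unitmx -> x != 0 ->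
  0 < enorm (M *m x).
Proof. by move=> Mu x0; rewrite enorm_gt0 mulmx_unit_eq0. Qed.

Lemma gl_sizeE m (M : 'M[R]_m) : gl_size M = Num.max (opnorm M) (opnorm (invmx M)).
Proof. by []. Qed.

Lemma gl_size_tr m (M : 'M[R]_m) : gl_size M^T = gl_size M.
Proof. by rewrite /gl_size opnorm_tr -trmx_inv opnorm_tr. Qed.

(** The added term is the integrand of [cocycle_dist], so all cocycles in a ball for that metric
    share a moment bound. *)
Lemma gl_size_le_dist m (M N : 'M[R]_m) :
  gl_size N <= gl_size M + (opnorm (M - N) + opnorm (invmx M - invmx N)).
Proof.
have H (X Y : 'M[R]_m) : opnorm Y <= opnorm X + opnorm (X - Y).
  by rewrite opnorm_distC -[X in opnorm X <= _](subrKC X) opnormD.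
have h1 := H M N; have h2 := H (invmx M) (invmx N).
have h3 := opnorm_le_size M; have h4 := opnormV_le_size M.
have o1 := opnorm_ge0 (M - N); have o2 := opnorm_ge0 (invmx M - invmx N).
rewrite {1}/gl_size ge_max; apply/andP; split; lra.
Qed.

End operator_norm.

(** * The exterior square *)

Section exterior_square.
Context {R : realType}.

Definition tup0 m (I : incr_tuple 2 m) : 'I_m := val I ord0.
Definition tup1 m (I : incr_tuple 2 m) : 'I_m := val I ord_max.

Lemma incr_tuple2P m (I : incr_tuple 2 m) : (tup0 I < tup1 I)%N.
Proof.
case: I => f H; rewrite /tup0 /tup1 /=.
by have /implyP := forallP (forallP H ord0) ord_max; apply.
Qed.

Definition mk_tup2 m (q : 'I_m * 'I_m) : {ffun 'I_2 -> 'I_m} :=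
  [ffun k => if k == ord0 then q.1 else q.2].

Lemma mk_tup2P m (q : 'I_m * 'I_m) : (q.1 < q.2)%N ->
  [forall k : 'I_2, forall l : 'I_2, (k < l)%N ==> (mk_tup2 q k < mk_tup2 q l)%N].
Proof.
move=> ij; apply/forallP => k; apply/forallP => l; apply/implyP => kl.
have -> : k = ord0 by apply/val_inj; move: k l kl => [[|[|k]] ?] [[|[|l]] ?].
have -> : l = ord_max by apply/val_inj; move: k l kl => [[|[|k]] ?] [[|[|l]] ?].
by rewrite !ffunE.
Qed.

Lemma sum_incr_tuple2 m (G : 'I_m -> 'I_m -> R) :
  \sum_(I : incr_tuple 2 m) G (tup0 I) (tup1 I) =
  \sum_(i < m) \sum_(j < m | (i < j)%N) G i j.
Proof.
rewrite pair_big_dep /=.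
rewrite (reindex_omap (fun I : incr_tuple 2 m => (tup0 I, tup1 I))
   (fun q => insub (mk_tup2 q))) /=; last first.
  move=> [i j] /= ij; pose u : incr_tuple 2 m := exist _ (mk_tup2 (i, j)) (mk_tup2P (q := (i, j)) ij).
  rewrite (valK u : insub (mk_tup2 (i, j)) = Some u) /=.
  by rewrite /tup0 /tup1 /= !ffunE.
apply: eq_bigl => I; rewrite incr_tuple2P /=.
have -> : mk_tup2 (tup0 I, tup1 I) = val I; last by rewrite valK eqxx.
apply/ffunP => k; rewrite ffunE; case: ifPn => [/eqP ->//|k0].
rewrite /= /tup1; congr (val I _); apply/val_inj.
by move: k k0 => [[|[|k]] ?].
Qed.

(** Replaces sums over increasing pairs by sums over all pairs, where algebraic identities can be
    checked term by term without ordering the indices. *)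
Lemma sum_incr_tuple2_sym m (G : 'I_m -> 'I_m -> R) :
  (forall i j, G i j = G j i) -> (forall i, G i i = 0) ->
  \sum_i \sum_j G i j = 2 * \sum_(I : incr_tuple 2 m) G (tup0 I) (tup1 I).
Proof.
move=> Gs G0; rewrite sum_incr_tuple2.
have -> : \sum_i \sum_j G i j =
    \sum_(i < m) \sum_(j < m | (i < j)%N) G i j +
    \sum_(i < m) \sum_(j < m | (j < i)%N) G i j.
  rewrite -big_split; apply: eq_bigr => i _ /=.
  rewrite (bigID (fun j : 'I_m => (i < j)%N)) /=; congr (_ + _).
  rewrite (bigID (fun j : 'I_m => (j < i)%N)) /= [X in _ + X]big1 ?addr0.
    by apply: eq_bigl => j; case: ltngtP.
  by move=> j; case: ltngtP => // /val_inj -> _; exact: G0.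
rewrite mulr2n mulrDl mul1r; congr (_ + _).
rewrite (exchange_big_dep xpredT) //=; apply: eq_bigr => i _.
by apply: eq_bigr => j _.
Qed.

Lemma det_mx22 (M : 'M[R]_2) :
  \det M = M ord0 ord0 * M ord_max ord_max - M ord0 ord_max * M ord_max ord0.
Proof.
have E0 : lift ord0 ord0 = ord_max :> 'I_2 by apply/val_inj.
have E1 : lift ord_max ord0 = ord0 :> 'I_2 by apply/val_inj.
rewrite (expand_det_row _ ord0) big_ord_recl big_ord1 /cofactor !det_mx11 !mxE.
rewrite !E0 !E1 /= (_ : (-1) ^+ (0 + 0) = 1)// (_ : (-1) ^+ _ = -1 :> R)//.
by rewrite mul1r mulN1r mulrN.
Qed.

(** The Cauchy-Binet formula for two by two minors; it yields both the multiplicativity of the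
    exterior square and its action on [wedge x y]. *)
Lemma sum_minor2 m (u v x y : 'I_m -> R) :
  (\sum_i u i * x i) * (\sum_i v i * y i) - (\sum_i u i * y i) * (\sum_i v i * x i) =
  \sum_(I : incr_tuple 2 m) (u (tup0 I) * v (tup1 I) - u (tup1 I) * v (tup0 I)) *
     (x (tup0 I) * y (tup1 I) - x (tup1 I) * y (tup0 I)).
Proof.
pose G i j := (u i * v j - u j * v i) * (x i * y j - x j * y i).
apply: (@mulfI _ 2) => //; rewrite -(sum_incr_tuple2_sym (G := G)); last 2 first.
- by move=> i j; rewrite /G; ring.
- by move=> i; rewrite /G; ring.
have E (a b c e : 'I_m -> R) : (\sum_i a i * b i) * (\sum_i c i * e i) =
    \sum_i \sum_j (a i * b i * (c j * e j)).
  by rewrite mulr_suml; apply: eq_bigr => i _; rewrite mulr_sumr.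
have -> : 2 * ((\sum_i u i * x i) * (\sum_i v i * y i) -
      (\sum_i u i * y i) * (\sum_i v i * x i)) =
  ((\sum_i u i * x i) * (\sum_i v i * y i) + (\sum_i v i * y i) * (\sum_i u i * x i)) -
  ((\sum_i u i * y i) * (\sum_i v i * x i) + (\sum_i v i * x i) * (\sum_i u i * y i)) by ring.
rewrite !E -!big_split -sumrB; apply: eq_bigr => i _ /=.
rewrite -!big_split -sumrB; apply: eq_bigr => j _ /=.
by rewrite /G; ring.
Qed.

Lemma exterior_power2E m (M : 'M[R]_m) i j :
  let I := enum_val i in let J := enum_val j in
  exterior_power 2 M i j =
  M (tup0 I) (tup0 J) * M (tup1 I) (tup1 J) - M (tup0 I) (tup1 J) * M (tup1 I) (tup0 J).
Proof. by rewrite /= mxE det_mx22 !mxE. Qed.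

(** The Pluecker coordinates of the plane spanned by [x] and [y], in the basis used by
    [exterior_power 2]. *)
Definition wedge m (x y : 'cV[R]_m) : 'cV[R]_(#|{: incr_tuple 2 m}|) :=
  \col_i (x (tup0 (enum_val i)) ord0 * y (tup1 (enum_val i)) ord0 -
          x (tup1 (enum_val i)) ord0 * y (tup0 (enum_val i)) ord0).

Lemma exterior_power2_wedge m (M : 'M[R]_m) (x y : 'cV[R]_m) :
  exterior_power 2 M *m wedge x y = wedge (M *m x) (M *m y).
Proof.
apply/matrixP => i k; rewrite (ord1 k) !mxE {k}.
set I := enum_val i.
rewrite [X in _ = _ - X]mulrC.
have := sum_minor2 (fun j => M (tup0 I) j) (fun j => M (tup1 I) j)
  (fun j => x j ord0) (fun j => y j ord0).
rewrite /= => ->.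
rewrite (reindex (@enum_val _ {: incr_tuple 2 m})) /=; last first.
  by apply: onW_bij; exact: enum_val_bij.
by apply: eq_bigr => j _; rewrite exterior_power2E mxE; rewrite -/I; ring.
Qed.

Lemma exterior_power2M m (M N : 'M[R]_m) :
  exterior_power 2 (M *m N) = exterior_power 2 M *m exterior_power 2 N.
Proof.
apply/matrixP => i k; rewrite exterior_power2E !mxE /=.
set I := enum_val i; set J := enum_val k.
have := sum_minor2 (fun j => M (tup0 I) j) (fun j => M (tup1 I) j)
  (fun j => N j (tup0 J)) (fun j => N j (tup1 J)) => ->.
rewrite (reindex (@enum_val _ {: incr_tuple 2 m})) /=; last first.
  by apply: onW_bij; exact: enum_val_bij.
by apply: eq_bigr => j _; rewrite !exterior_power2E -/I -/J; ring.
Qed.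

Lemma exterior_power21 m : exterior_power 2 (1%:M : 'M[R]_m) = 1%:M.
Proof.
apply/matrixP => i j; rewrite exterior_power2E /= [RHS]mxE !mxE.
have [->|ij] := eqVneq i j.
  rewrite !eqxx mulr1 (_ : (tup0 _ == _) = false) ?mul0r ?subr0//.
  by apply/negbTE; rewrite neq_ltn incr_tuple2P.
have IJ : enum_val i != enum_val j by rewrite (inj_eq enum_val_inj).
set I := enum_val i in IJ *; set J := enum_val j in IJ *.
have I01 := incr_tuple2P I; have J01 := incr_tuple2P J.
have : ~~ ((tup0 I == tup0 J) && (tup1 I == tup1 J)).
  apply: contra IJ => /andP[/eqP e0 /eqP e1]; apply/eqP/val_inj/ffunP => k.
  have : k = ord0 \/ k = ord_max.
    by case: k => [[|[|k]] ?] //; [left|right]; apply/val_inj.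
  by case=> ->.
have : ~~ ((tup0 I == tup1 J) && (tup1 I == tup0 J)).
  apply/negP => /andP[/eqP e0 /eqP e1]; move: I01; rewrite e0 e1 => /ltnW.
  by rewrite leqNgt J01.
by do 4 case: (_ == _) => //=; rewrite ?mulr0 ?mul0r ?subr0.
Qed.

Lemma exterior_power_tr k m (M : 'M[R]_m) : exterior_power k M^T = (exterior_power k M)^T.
Proof. by apply/matrixP => i j; rewrite !mxE -[RHS]det_tr; congr (\det _); apply/matrixP => a b; rewrite !mxE. Qed.

Lemma enorm_wedge_sqr m (x y : 'cV[R]_m) :
  enorm (wedge x y) ^+ 2 = dotp x x * dotp y y - dotp x y ^+ 2.
Proof.
apply: (@mulfI _ 2) => //; rewrite -sum_minor2_sqr.
rewrite sum_incr_tuple2_sym; last 2 first.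
- by move=> i j; ring.
- by move=> i; ring.
congr (2 * _); rewrite enorm_sqr /dotp.
rewrite [RHS](reindex (@enum_val _ {: incr_tuple 2 m})) /=; last first.
  by apply: onW_bij; exact: enum_val_bij.
by apply: eq_bigr => i _; rewrite !mxE expr2.
Qed.

Lemma enorm_wedge_le m (x y : 'cV[R]_m) : enorm (wedge x y) <= enorm x * enorm y.
Proof.
rewrite -(@ler_pXn2r _ 2) ?nnegrE ?mulr_ge0 ?enorm_ge0// enorm_wedge_sqr.
by rewrite exprMn !enorm_sqr lerBlDr lerDl sqr_ge0.
Qed.

Lemma wedgeDl m (x y z : 'cV[R]_m) : wedge (x + y) z = wedge x z + wedge y z.
Proof. by apply/matrixP => i j; rewrite !mxE; ring. Qed.

Lemma wedgexx m (x : 'cV[R]_m) : wedge x x = 0.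
Proof. by apply/matrixP => i j; rewrite !mxE; ring. Qed.

Lemma wedgeC m (x y : 'cV[R]_m) : wedge x y = - wedge y x.
Proof. by apply/matrixP => i j; rewrite !mxE; ring. Qed.

Lemma wedgeZl m a (x y : 'cV[R]_m) : wedge (a *: x) y = a *: wedge x y.
Proof. by apply/matrixP => i j; rewrite !mxE; ring. Qed.

Lemma card_incr_tuple2_gt0 m : (2 <= m)%N -> (0 < #|{: incr_tuple 2 m}|)%N.
Proof.
case: m => [|[|m]]// _; apply/card_gt0P.
have H : ((ord0 : 'I_m.+2) < (ord_max : 'I_m.+2))%N by [].
by exists (exist _ (mk_tup2 (ord0, ord_max)) (mk_tup2P (q := (ord0, ord_max)) H)).
Qed.

(** The two matrices differ by the relabelling [f] of the basis that comes from enumerating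
    one-element tuples, and relabelling coordinates preserves the Euclidean norm. *)
Lemma opnorm_exterior_power1 m (M : 'M[R]_m) : opnorm (exterior_power 1 M) = opnorm M.
Proof.
have mkP (i : 'I_m) : [forall k : 'I_1, forall l : 'I_1,
    (k < l)%N ==> ([ffun _ : 'I_1 => i] k < [ffun _ : 'I_1 => i] l)%N].
  by apply/forallP => k; apply/forallP => l; rewrite !ord1.
pose mk i : incr_tuple 1 m := exist _ [ffun _ : 'I_1 => i] (mkP i).
pose f (i : 'I_#|{: incr_tuple 1 m}|) : 'I_m := val (enum_val i) ord0.
pose g (i : 'I_m) : 'I_#|{: incr_tuple 1 m}| := enum_rank (mk i).
have fK : cancel f g.
  move=> i; apply: enum_val_inj; rewrite enum_rankK; apply/val_inj/ffunP => k.
  by rewrite ffunE (ord1 k).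
have gK : cancel g f by move=> i; rewrite /f enum_rankK /= ffunE.
have fb : bijective f by exists g.
have gb : bijective g by exists f.
have E i j : exterior_power 1 M i j = M (f i) (f j).
  by rewrite mxE det_mx11 mxE.
have nE n1 n2 (h : 'I_n1 -> 'I_n2) (x : 'cV[R]_n2) : bijective h ->
    enorm (\col_i x (h i) ord0) = enorm x.
  move=> hb; apply/eqP; rewrite -(@eqrXn2 _ 2)// ?enorm_ge0// !enorm_sqr.
  rewrite /dotp [eqbRHS](reindex h) /=; last exact: onW_bij.
  by apply/eqP/eq_bigr => i _; rewrite mxE.
apply/eqP; rewrite eq_le; apply/andP; split; apply: opnorm_le => [|x];
    rewrite ?opnorm_ge0//.
- rewrite -(nE _ _ g x gb).
  have -> : exterior_power 1 M *m x = \col_i (M *m (\col_j x (g j) ord0)) (f i) ord0.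
    apply/matrixP => i k; rewrite (ord1 k) !mxE [RHS](reindex f) /=; last exact: onW_bij.
    by apply: eq_bigr => j _; rewrite mxE E fK.
  by rewrite (nE _ _ f)// ler_opnorm.
- rewrite -(nE _ _ f x fb).
  have -> : M *m x = \col_i (exterior_power 1 M *m (\col_j x (f j) ord0)) (g i) ord0.
    apply/matrixP => i k; rewrite (ord1 k) !mxE (reindex f) /=; last exact: onW_bij.
    by apply: eq_bigr => j _; rewrite E mxE gK.
  by rewrite (nE _ _ g)// ler_opnorm.
Qed.

(** The number of entries of the exterior square, times 4: an entry is a difference of two products,
    and each product has two factors to be varied. *)
Definition ext2_const (R : realType) m : R :=
  (4 * #|{: incr_tuple 2 m}| * #|{: incr_tuple 2 m}|)%:R.

Lemma opnorm_exterior_power2B m (M N : 'M[R]_m) K :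
  opnorm M <= K -> opnorm N <= K ->
  opnorm (exterior_power 2 M - exterior_power 2 N) <=
    ext2_const R m * (K * opnorm (M - N)).
Proof.
move=> MK NK; rewrite (le_trans (opnorm_le_sum _))//.
pose c := 4 * (K * opnorm (M - N)).
have H i j : `|(exterior_power 2 M - exterior_power 2 N) i j| <= c.
  rewrite mxE [X in _ + X]mxE !exterior_power2E /=.
  set I := enum_val i; set J := enum_val j.
  have Q (i1 j1 i2 j2 : 'I_m) : `|M i1 j1 * M i2 j2 - N i1 j1 * N i2 j2| <= 2 * (K * opnorm (M - N)).
    have -> : M i1 j1 * M i2 j2 - N i1 j1 * N i2 j2 =
        M i1 j1 * (M i2 j2 - N i2 j2) + (M i1 j1 - N i1 j1) * N i2 j2 by ring.
    rewrite (le_trans (ler_normD _ _))// !normrM mulr2n mulrDl mul1r lerD//.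
      rewrite ler_pM// ?(le_trans (opnorm_entry _ _ _))//.
      by have := opnorm_entry (M - N) i2 j2; rewrite !mxE.
    rewrite mulrC ler_pM// ?(le_trans (opnorm_entry _ _ _))//.
    by have := opnorm_entry (M - N) i1 j1; rewrite !mxE.
  have Q1 := Q (tup0 I) (tup0 J) (tup1 I) (tup1 J).
  have Q2 := Q (tup0 I) (tup1 J) (tup1 I) (tup0 J).
  rewrite (_ : _ - _ - _ =
    (M (tup0 I) (tup0 J) * M (tup1 I) (tup1 J) - N (tup0 I) (tup0 J) * N (tup1 I) (tup1 J)) -
    (M (tup0 I) (tup1 J) * M (tup1 I) (tup0 J) - N (tup0 I) (tup1 J) * N (tup1 I) (tup0 J)));
    last by ring.
  rewrite (le_trans (ler_normB _ _))// (le_trans (lerD Q1 Q2))// /c; lra.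
rewrite (le_trans (ler_sum _ (fun i _ => ler_sum _ (fun j _ => H i j))))//.
rewrite !sumr_const !card_ord -!mulrnA -mulr_natl /ext2_const /c.
by rewrite !natrM mulrA; lra.
Qed.

Lemma opnorm_exterior_power2_le m (M : 'M[R]_m) :
  opnorm (exterior_power 2 M) <= ext2_const R m * opnorm M ^+ 2.
Proof.
have e0 : exterior_power 2 (0 : 'M[R]_m) = 0.
  by apply/matrixP => i j; rewrite exterior_power2E !mxE /= !mul0r subr0.
have := @opnorm_exterior_power2B _ M 0 (opnorm M) (lexx _).
rewrite e0 !subr0 expr2; apply.
apply: opnorm_le => [|x]; first exact: opnorm_ge0.
by rewrite mul0mx enorm0 mulr_ge0 ?opnorm_ge0 ?enorm_ge0.
Qed.

Lemma opnorm_exterior_power2_gt0 m (M : 'M[R]_m) : (2 <= m)%N -> M \in unitmx ->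
  0 < opnorm (exterior_power 2 M).
Proof.
move=> m2 Mu; rewrite lt_neqAle opnorm_ge0 andbT eq_sym; apply/eqP => e0.
have := opnormM (exterior_power 2 M) (exterior_power 2 (invmx M)).
rewrite -exterior_power2M mulmxV// exterior_power21 opnorm1 ?card_incr_tuple2_gt0// e0 mul0r.
by rewrite ler10.
Qed.

Lemma opnorm_exterior_power2_ge m (M : 'M[R]_m) : (2 <= m)%N -> M \in unitmx ->
  1 <= opnorm (exterior_power 2 M) * (ext2_const R m * opnorm (invmx M) ^+ 2).
Proof.
move=> m2 Mu.
have := opnormM (exterior_power 2 M) (exterior_power 2 (invmx M)).
rewrite -exterior_power2M mulmxV// exterior_power21 opnorm1 ?card_incr_tuple2_gt0//.
move=> /le_trans; apply; rewrite ler_wpM2l ?opnorm_ge0//.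
exact: opnorm_exterior_power2_le.
Qed.

End exterior_square.

(** * Elementary inequalities for powers, logarithms and exponentials *)

Section real_inequalities.
Context {R : realType}.
Implicit Types (a b s t x : R).

Lemma powR_le s a b : 0 <= s -> 0 <= a -> a <= b -> a `^ s <= b `^ s.
Proof. by move=> s0 a0 ab; apply: ge0_ler_powR => //; rewrite nnegrE// (le_trans a0). Qed.

(** Each of the ratios [a / (a + b)] and [b / (a + b)] is at most 1, hence at most its own [s]-th
    power, and the two ratios add up to 1. *)
Lemma powR_subadd s a b : 0 < s -> s <= 1 -> 0 <= a -> 0 <= b ->
  (a + b) `^ s <= a `^ s + b `^ s.
Proof.
move=> s0 s1 a0 b0; have [ab0|ab0] := eqVneq (a + b) 0.
  by rewrite ab0 powR0 ?gt_eqF// addr_ge0 ?powR_ge0.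
have p : 0 < a + b by rewrite lt_neqAle eq_sym ab0 addr_ge0.
have H c : 0 <= c -> c <= a + b -> c / (a + b) * (a + b) `^ s <= c `^ s.
  move=> c0 cab; have [->|cn0] := eqVneq c 0; first by rewrite !mul0r powR_ge0.
  have cp : 0 < c by rewrite lt_neqAle eq_sym cn0.
  have -> : c `^ s = (c / (a + b)) `^ s * (a + b) `^ s.
    by rewrite -powRM ?divr_ge0// ?ltW// divfK.
  rewrite ler_wpM2r ?powR_ge0// ger1_powR// divr_gt0//=.
  by rewrite ler_pdivrMr// mul1r.
rewrite (le_trans _ (lerD (H a a0 _) (H b b0 _))) ?lerDl ?lerDr//.
by rewrite -mulrDl -mulrDl divff// mul1r.
Qed.

Lemma powR_sqr s a : 0 <= a -> (a ^+ 2) `^ s = (a `^ s) ^+ 2.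
Proof. by move=> a0; rewrite !expr2 powRM. Qed.

(** Trades the linear bound [t] for a small power of [t]. This is how logarithmic errors become
    integrable when only small moments are finite. *)
Lemma ln1D_powR s t : 0 < s -> s <= 1 -> 0 <= t -> ln (1 + t) <= s^-1 * t `^ s.
Proof.
move=> s0 s1 t0; rewrite ler_pdivlMl// -ln_powR.
apply: (@le_trans _ _ (ln (1 + t `^ s))).
  rewrite ler_ln ?posrE ?powR_gt0 ?ltr_pwDl ?powR_ge0//.
  by rewrite (le_trans (powR_subadd s0 s1 ler01 t0))// powR1.
by rewrite le_ln1Dx// (lt_le_trans _ (powR_ge0 _ _))// ltrN10.
Qed.

Lemma lnB_powR s t a b : 0 < s -> s <= 1 -> 0 <= t -> 0 < a -> 0 < b ->
  a <= b * (1 + t) -> ln a - ln b <= s^-1 * t `^ s.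
Proof.
move=> s0 s1 t0 a0 b0 ab; rewrite -ln_div ?posrE//.
rewrite (le_trans _ (ln1D_powR s0 s1 t0))// ler_ln ?posrE ?divr_gt0 ?ltr_pwDl//.
by rewrite ler_pdivrMr// mulrC.
Qed.

(** Bounds a small moment by a first moment in place of Jensen's inequality: if [tau] bounds the
    mean of [t], integration gives at most [2 * tau^s]. *)
Lemma powR_interp s t tau : 0 <= t -> 0 < tau -> 0 < s -> s <= 1 ->
  t `^ s <= tau `^ s * (1 + t / tau).
Proof.
move=> t0 tau0 s0 s1; have [tt|tt] := leP t tau.
  rewrite (le_trans (powR_le (ltW s0) t0 tt))// ler_peMr ?powR_ge0//.
  by rewrite lerDl divr_ge0// ltW.
have -> : t = tau * (t / tau) by rewrite mulrC divfK// gt_eqF.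
have q1 : 1 <= t / tau by rewrite ler_pdivlMr// mul1r ltW.
rewrite powRM ?(ltW tau0) ?(le_trans ler01)// ler_wpM2l ?powR_ge0//.
rewrite (le_trans (ler1_powR q1 s1))// (mulrC tau) mulfK ?gt_eqF// lerDr//.
Qed.

(** Plays the part of Cauchy-Schwarz for integrals: it is applied pointwise, and [eta] is chosen to
    balance the two resulting expectations. *)
Lemma AMGM_weighted eta a b : 0 < eta -> a * b <= (eta * a ^+ 2 + b ^+ 2 / eta) / 2.
Proof.
move=> eta0; rewrite -subr_ge0.
have -> : (eta * a ^+ 2 + b ^+ 2 / eta) / 2 - a * b = (eta * a - b) ^+ 2 / (2 * eta).
  by field; rewrite gt_eqF.
by rewrite divr_ge0 ?sqr_ge0// mulr_ge0// ltW.
Qed.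

Lemma expR_le_quadratic x : expR x <= 1 + x + x ^+ 2 * expR `|x|.
Proof.
have h1 : expR x - 1 <= x * expR x.
  have := expR_ge1Dx (- x); rewrite expRN -(ler_pM2r (expR_gt0 x)) mulVf ?gt_eqF ?expR_gt0//.
  lra.
have [x0|x0] := leP 0 x.
  rewrite ger0_norm//; have := ler_wpM2l x0 h1; rewrite expr2; nra.
have h2 := expR_ge1Dx x.
have h3 : x * (expR x - 1) <= x ^+ 2 by rewrite expr2; nra.
have h4 : x ^+ 2 <= x ^+ 2 * expR `|x|.
  by rewrite ler_peMr ?sqr_ge0// (le_trans _ (expR_ge1Dx _))// lerDl.
lra.
Qed.

Lemma ler_expR_div c x : 0 < c -> x <= c^-1 * expR (c * x).
Proof. by move=> c0; rewrite ler_pdivlMl// (le_trans _ (expR_ge1Dx _))// lerDr. Qed.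

End real_inequalities.

(** * The projective action *)

Section projective_geometry.
Context {R : realType} (m : nat).
Implicit Types (x y : 'cV[R]_m) (M N : 'M[R]_m).

(* The sine of the angle between two lines. *)
Definition pdist x y : R := enorm (wedge x y) / (enorm x * enorm y).

Definition growth M x : R := ln (enorm (M *m x) / enorm x).

(* A bound for the square of the local Lipschitz constant of the projective action
   of [M] at [x]. *)
Definition pcontr M x : R :=
  opnorm (exterior_power 2 M) * (enorm x / enorm (M *m x)) ^+ 2.

Lemma pdist_ge0 x y : 0 <= pdist x y.
Proof. by rewrite divr_ge0 ?mulr_ge0 ?enorm_ge0. Qed.

Lemma pdistC x y : pdist x y = pdist y x.
Proof. by rewrite /pdist wedgeC enormN (mulrC (enorm x)). Qed.

Lemma pdist_le1 x y : pdist x y <= 1.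
Proof.
have [xy0|xy0] := eqVneq (enorm x * enorm y) 0; first by rewrite /pdist xy0 invr0 mulr0.
rewrite ler_pdivrMr ?mul1r ?enorm_wedge_le//.
by rewrite lt_neqAle eq_sym xy0 mulr_ge0 ?enorm_ge0.
Qed.

Lemma pcontr_ge0 M x : 0 <= pcontr M x.
Proof. by rewrite mulr_ge0 ?opnorm_ge0 ?sqr_ge0. Qed.

(** The contraction factor is bounded by the geometric mean of [pcontr M x] and [pcontr M y].
    Passing to the arithmetic mean of the powers leaves terms that each involve one direction, so
    bounds at a fixed direction apply. *)
Lemma pdist_mulmx M x y s : M \in unitmx -> x != 0 -> y != 0 -> 0 < s ->
  pdist (M *m x) (M *m y) `^ s <=
  (pcontr M x `^ s + pcontr M y `^ s) / 2 * pdist x y `^ s.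
Proof.
move=> Mu x0 y0 s0.
have nx := x0; rewrite -enorm_gt0 in nx; have ny := y0; rewrite -enorm_gt0 in ny.
have nMx := enorm_mulmx_gt0 Mu x0; have nMy := enorm_mulmx_gt0 Mu y0.
set w := opnorm (exterior_power 2 M).
have w0 : 0 <= w by exact: opnorm_ge0.
set a := enorm x / enorm (M *m x); set b := enorm y / enorm (M *m y).
have a0 : 0 <= a by rewrite divr_ge0 ?enorm_ge0.
have b0 : 0 <= b by rewrite divr_ge0 ?enorm_ge0.
have H1 : pdist (M *m x) (M *m y) <= w * a * b * pdist x y.
  rewrite /pdist ler_pdivrMr ?mulr_gt0// -exterior_power2_wedge.
  rewrite (le_trans (ler_opnorm _ _))// -/w /a /b.
  rewrite le_eqVlt; apply/orP; left; apply/eqP; field.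
  by rewrite !gt_eqF.
rewrite (le_trans (powR_le (ltW s0) (pdist_ge0 _ _) H1))//.
rewrite (powRM s (mulr_ge0 (mulr_ge0 w0 a0) b0) (pdist_ge0 x y)) ler_wpM2r ?powR_ge0//.
rewrite /pcontr -/w -/a -/b (powRM s w0 (sqr_ge0 a)) (powRM s w0 (sqr_ge0 b)).
rewrite (powRM s (mulr_ge0 w0 a0) b0) (powRM s w0 a0).
rewrite (powR_sqr s a0).
rewrite (powR_sqr s b0).
rewrite -mulrA -mulrDr -[leRHS]mulrA ler_wpM2l ?powR_ge0//.
by have := @AMGM_weighted R 1 (a `^ s) (b `^ s) ltr01; rewrite mul1r divr1.
Qed.

Lemma pdistZ x y a b : a != 0 -> b != 0 -> pdist (a *: x) (b *: y) = pdist x y.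
Proof.
move=> a0 b0; rewrite /pdist.
have -> : wedge (a *: x) (b *: y) = (a * b) *: wedge x y.
  by apply/matrixP => i j; rewrite !mxE; ring.
rewrite !enormZ (_ : _ * _ * (_ * _) = `|a * b| * (enorm x * enorm y)); last first.
  by rewrite normrM; ring.
by rewrite -mulf_div divff ?mul1r// normr_eq0 mulf_neq0.
Qed.

Lemma growthZ M x a : a != 0 -> growth M (a *: x) = growth M x.
Proof.
move=> a0; rewrite /growth -scalemxAr !enormZ -mulf_div divff ?mul1r//.
by rewrite normr_eq0.
Qed.

Lemma growth_unit M x : enorm x = 1 -> growth M x = ln (enorm (M *m x)).
Proof. by move=> x1; rewrite /growth x1 divr1. Qed.

Lemma growthE M x : M \in unitmx -> x != 0 ->
  growth M x = ln (enorm (M *m x)) - ln (enorm x).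
Proof. by move=> Mu x0; rewrite /growth ln_div ?posrE ?enorm_gt0// mulmx_unit_eq0. Qed.

Lemma growthM M N x : M \in unitmx -> N \in unitmx -> x != 0 ->
  growth (M *m N) x = growth M (N *m x) + growth N x.
Proof.
move=> Mu Nu x0; rewrite !growthE ?unitmx_mul ?Mu ?Nu ?mulmx_unit_eq0// mulmxA.
by rewrite addrA subrK.
Qed.

Lemma growth1 x : growth 1%:M x = 0.
Proof.
rewrite /growth mul1mx; have [->|nz] := eqVneq (enorm x) 0; first by rewrite mul0r ln0.
by rewrite divff// ln1.
Qed.

Lemma growth_le M x : M \in unitmx -> x != 0 -> `|growth M x| <= ln (gl_size M).
Proof.
move=> Mu x0; have nx := x0; rewrite -enorm_gt0 in nx.
have nMx := enorm_mulmx_gt0 Mu x0.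
have K0 : 0 < gl_size M.
  rewrite -(pmulr_lgt0 _ nx) (lt_le_trans nMx)// (le_trans (ler_opnorm _ _))//.
  by rewrite ler_wpM2r ?enorm_ge0// opnorm_le_size.
rewrite ler_norml; apply/andP; split.
  rewrite -lnV ?posrE// /growth ler_ln ?posrE ?invr_gt0 ?divr_gt0//.
  rewrite ler_pdivlMr// ler_pdivrMl// (le_trans (opnorm_inv_ler x Mu))//.
  by rewrite ler_wpM2r ?enorm_ge0// opnormV_le_size.
rewrite /growth ler_ln ?posrE ?divr_gt0// ler_pdivrMr//.
by rewrite (le_trans (ler_opnorm _ _))// ler_wpM2r ?enorm_ge0// opnorm_le_size.
Qed.

(** With [c = dotp x y] this says [2 - 2 c <= 4 (1 - c^2)], which holds for [0 <= c <= 1]. The sign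
    condition selects the closer of the two unit vectors on a line. *)
Lemma enormB_le_pdist x y : enorm x = 1 -> enorm y = 1 -> 0 <= dotp x y ->
  enorm (x - y) <= 2 * pdist x y.
Proof.
move=> nx ny xy0.
have xy1 : dotp x y <= 1.
  by rewrite (le_trans (ler_norm _))// (le_trans (CauchySchwarz _ _))// nx ny mulr1.
rewrite /pdist nx ny mulr1 divr1 -(@ler_pXn2r _ 2) ?nnegrE ?mulr_ge0 ?enorm_ge0//.
rewrite exprMn enorm_wedge_sqr -!enorm_sqr nx ny.
have -> : enorm (x - y) ^+ 2 = 2 - 2 * dotp x y.
  rewrite enorm_sqr -(scaleN1r y) dotpDl !dotpDr !dotpZr !dotpZl (dotpC y x).
  rewrite -!enorm_sqr nx ny; ring.
nra.
Qed.

Lemma pdist_representatives x y : x != 0 -> y != 0 ->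
  exists a b, [/\ a != 0, b != 0, enorm (a *: x) = 1, enorm (b *: y) = 1 &
    enorm (a *: x - b *: y) <= 2 * pdist x y].
Proof.
move=> x0 y0; have nx := x0; rewrite -enorm_gt0 in nx.
have ny := y0; rewrite -enorm_gt0 in ny.
pose a := (enorm x)^-1.
pose b := (if 0 <= dotp x y then 1 else -1) * (enorm y)^-1.
have a0 : a != 0 by rewrite invr_eq0 gt_eqF.
have b0 : b != 0.
  apply: mulf_neq0; last by rewrite invr_eq0 gt_eqF.
  by case: ifP => _; rewrite ?oppr_eq0 oner_eq0.
have na : enorm (a *: x) = 1.
  by rewrite enormZ ger0_norm ?invr_ge0 ?enorm_ge0// mulVf ?gt_eqF.
have nb : enorm (b *: y) = 1.
  have -> : enorm (b *: y) = enorm ((enorm y)^-1 *: y).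
    by rewrite /b -scalerA; case: ifP => _; rewrite ?scale1r// scaleN1r enormN.
  by rewrite enormZ ger0_norm ?invr_ge0 ?enorm_ge0// mulVf ?gt_eqF.
exists a, b; split=> //.
rewrite -(pdistZ x y a0 b0).
apply: enormB_le_pdist => //.
rewrite dotpZl dotpZr mulr_ge0 ?invr_ge0 ?enorm_ge0//.
rewrite /b; case: (leP 0 (dotp x y)) => h.
  by rewrite mul1r mulr_ge0 ?invr_ge0 ?enorm_ge0.
by rewrite mulN1r mulNr oppr_ge0 mulr_ge0_le0 ?invr_ge0 ?enorm_ge0// ltW.
Qed.

(** On close unit representatives [u], [v], the difference of [|M u|] and [|M v|] is at most
    [2 K pdist], where [K] is the size of [M]. Since [|M v| >= 1/K], the relative error is at most
    [2 K^2 pdist]. *)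
Lemma growth_holder M x y s : M \in unitmx -> x != 0 -> y != 0 -> 0 < s -> s <= 1 ->
  `|growth M x - growth M y| <= s^-1 * (2 * gl_size M ^+ 2 * pdist x y) `^ s.
Proof.
move=> Mu x0 y0 s0 s1.
suff H u v : u != 0 -> v != 0 ->
    growth M u - growth M v <= s^-1 * (2 * gl_size M ^+ 2 * pdist u v) `^ s.
  rewrite ler_norml H// andbT lerNl opprB.
  by rewrite (pdistC x y) (H _ _ y0 x0).
move=> u0 v0; have [a [b [a0 b0 na nb H]]] := pdist_representatives u0 v0.
rewrite -(growthZ M u a0) -(growthZ M v b0) !growth_unit//.
have au0 : a *: u != 0 by rewrite scaler_eq0 negb_or a0.
have bv0 : b *: v != 0 by rewrite scaler_eq0 negb_or b0.
have K0 := gl_size_ge0 M.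
have p0 := pdist_ge0 u v.
have t0 : 0 <= 2 * gl_size M ^+ 2 * pdist u v.
  exact: mulr_ge0 (mulr_ge0 (ler0n _ 2) (sqr_ge0 _)) p0.
apply: lnB_powR => //; rewrite ?enorm_mulmx_gt0//.
set e := enorm (M *m (b *: v)).
have ek : 1 <= gl_size M * e.
  rewrite -nb (le_trans (opnorm_inv_ler _ Mu))//.
  by rewrite ler_wpM2r ?enorm_ge0// opnormV_le_size.
have : enorm (M *m (a *: u)) - e <= gl_size M * (2 * pdist u v).
  rewrite (le_trans (enormB _ _))// -mulmxBr (le_trans (ler_opnorm _ _))//.
  by rewrite ler_pM ?opnorm_ge0 ?enorm_ge0// opnorm_le_size.
have : 0 <= (gl_size M * e - 1) * (gl_size M * (2 * pdist u v)).
  by apply: mulr_ge0; [rewrite subr_ge0|exact: mulr_ge0 K0 (mulr_ge0 (ler0n _ 2) p0)].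
rewrite expr2; lra.
Qed.

Lemma growth_perturb M N x K s : M \in unitmx -> N \in unitmx -> x != 0 ->
  0 < s -> s <= 1 -> gl_size M <= K -> gl_size N <= K ->
  `|growth M x - growth N x| <= s^-1 * (K * opnorm (M - N)) `^ s.
Proof.
move=> Mu Nu x0 s0 s1.
suff H U V : U \in unitmx -> V \in unitmx -> gl_size U <= K -> gl_size V <= K ->
    growth U x - growth V x <= s^-1 * (K * opnorm (U - V)) `^ s.
  move=> MK NK; rewrite ler_norml H// andbT lerNl opprB.
  by rewrite (opnorm_distC M N) (H _ _ Nu Mu NK MK).
move=> Uu Vu UK VK; have K0 := le_trans (gl_size_ge0 _) UK.
rewrite !growthE// opprB addrA subrK.
apply: lnB_powR; rewrite ?enorm_mulmx_gt0 ?mulr_ge0 ?opnorm_ge0//.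
have h1 : enorm x <= K * enorm (V *m x).
  rewrite (le_trans (opnorm_inv_ler _ Vu))// ler_wpM2r ?enorm_ge0//.
  exact: le_trans (opnormV_le_size _) VK.
have : enorm (U *m x) - enorm (V *m x) <= opnorm (U - V) * enorm x.
  by rewrite (le_trans (enormB _ _))// -mulmxBl ler_opnorm.
have := ler_wpM2l (opnorm_ge0 (U - V)) h1; lra.
Qed.

Lemma pdist_perturb M N x K : M \in unitmx -> N \in unitmx -> x != 0 ->
  gl_size M <= K -> pdist (M *m x) (N *m x) <= K * opnorm (M - N).
Proof.
move=> Mu Nu x0 MK.
have nM := enorm_mulmx_gt0 Mu x0; have nN := enorm_mulmx_gt0 Nu x0.
rewrite /pdist ler_pdivrMr ?mulr_gt0//.
have -> : wedge (M *m x) (N *m x) = wedge ((M - N) *m x) (N *m x).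
  by rewrite mulmxBl wedgeDl -scaleN1r wedgeZl wedgexx scaler0 addr0.
rewrite (le_trans (enorm_wedge_le _ _))// mulrA ler_wpM2r ?enorm_ge0//.
rewrite (le_trans (ler_opnorm _ _))// mulrAC mulrC ler_wpM2r ?opnorm_ge0//.
rewrite (le_trans (opnorm_inv_ler _ Mu))// ler_wpM2r ?enorm_ge0//.
exact: le_trans (opnormV_le_size _) MK.
Qed.

(** One unit comes from varying the exterior square, two from varying the squared ratio of norms. *)
Definition pcontr_const : R := 3 * ext2_const R m.

(** The two variations produce [K^3] and [K^5]; [K^7] is a convenient common bound because
    [K >= 1]. *)
Lemma pcontr_perturb M N x K : M \in unitmx -> N \in unitmx -> x != 0 ->
  1 <= K -> gl_size M <= K -> gl_size N <= K ->
  pcontr N x <= pcontr M x + pcontr_const * (K ^+ 7 * opnorm (M - N)).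
Proof.
move=> Mu Nu x0 K1 MK NK.
have K0 : 0 <= K by exact: le_trans K1.
have c0 : 0 <= ext2_const R m by exact: ler0n.
have D0 := opnorm_ge0 (M - N).
set D := opnorm (M - N) in D0 *.
have nM := enorm_mulmx_gt0 Mu x0; have nN := enorm_mulmx_gt0 Nu x0.
have hq U : U \in unitmx -> gl_size U <= K -> enorm x / enorm (U *m x) <= K.
  move=> Uu UK; rewrite ler_pdivrMr ?enorm_mulmx_gt0//.
  rewrite (le_trans (opnorm_inv_ler _ Uu))// ler_wpM2r ?enorm_ge0//.
  exact: le_trans (opnormV_le_size _) UK.
have qM := hq _ Mu MK; have qN := hq _ Nu NK.
have oM : opnorm M <= K by exact: le_trans (opnorm_le_size _) MK.
have oN : opnorm N <= K by exact: le_trans (opnorm_le_size _) NK.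
rewrite /pcontr; set a := enorm x / enorm (M *m x) in qM *.
set b := enorm x / enorm (N *m x) in qN *.
have a0 : 0 <= a by rewrite divr_ge0 ?enorm_ge0.
have b0 : 0 <= b by rewrite divr_ge0 ?enorm_ge0.
have ba : b - a <= K ^+ 2 * D.
  have -> : b - a = (enorm (M *m x) - enorm (N *m x)) * (a * b / enorm x).
    by rewrite /a /b; field; rewrite !gt_eqF//= enorm_gt0.
  have h : enorm (M *m x) - enorm (N *m x) <= D * enorm x.
    by rewrite (le_trans (enormB _ _))// -mulmxBl ler_opnorm.
  have q0 : 0 <= a * b / enorm x := divr_ge0 (mulr_ge0 a0 b0) (enorm_ge0 _).
  rewrite (le_trans (ler_wpM2r q0 h))//.
  have -> : D * enorm x * (a * b / enorm x) = a * b * D.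
    by field; rewrite gt_eqF// enorm_gt0.
  by rewrite ler_wpM2r// expr2 ler_pM.
set wN := opnorm _; set wM := opnorm _.
have wM0 : 0 <= wM by exact: opnorm_ge0.
have wB : wN <= wM + ext2_const R m * (K * D).
  apply: (@le_trans _ _ (opnorm (exterior_power 2 M - exterior_power 2 N) + wM)).
    rewrite (opnorm_distC (exterior_power 2 M)) /wN.
    have := opnormD (exterior_power 2 N - exterior_power 2 M) (exterior_power 2 M).
    by rewrite subrK.
  by rewrite addrC lerD2l; exact: opnorm_exterior_power2B.
have wNK : wN <= ext2_const R m * K ^+ 2.
  rewrite (le_trans (opnorm_exterior_power2_le _))// ler_wpM2l//.
  by rewrite ler_pXn2r ?nnegrE// opnorm_ge0.
have wN0 : 0 <= wN by exact: opnorm_ge0.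
(* wN b^2 - wM a^2 = (wN - wM) a^2 + wN (b - a)(b + a) *)
have e1 : (wN - wM) * a ^+ 2 <= ext2_const R m * (K * D) * K ^+ 2.
  have := wB; rewrite -lerBlDl => wB'.
  rewrite (le_trans (ler_wpM2r (sqr_ge0 a) wB'))//.
  rewrite (ler_wpM2l (mulr_ge0 c0 (mulr_ge0 K0 D0)))//.
  by rewrite ler_pXn2r ?nnegrE.
have e2 : wN * ((b - a) * (b + a)) <= ext2_const R m * K ^+ 2 * (K ^+ 2 * D * (2 * K)).
  rewrite (@le_trans _ _ (wN * (K ^+ 2 * D * (2 * K))))//.
    rewrite ler_wpM2l// (@le_trans _ _ (K ^+ 2 * D * (b + a)))//.
      by rewrite ler_wpM2r// addr_ge0.
    rewrite (ler_wpM2l (mulr_ge0 (sqr_ge0 K) D0))//.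
    by rewrite mulr2n mulrDl mul1r lerD.
  rewrite ler_wpM2r//.
  exact: mulr_ge0 (mulr_ge0 (sqr_ge0 K) D0) (mulr_ge0 (ler0n _ 2) K0).
have -> : wN * b ^+ 2 = wM * a ^+ 2 + ((wN - wM) * a ^+ 2 + wN * ((b - a) * (b + a))) by ring.
rewrite lerD2l (le_trans (lerD e1 e2))//.
have k3 : K ^+ 3 <= K ^+ 7 by rewrite ler_weXn2l.
have k5 : K ^+ 5 <= K ^+ 7 by rewrite ler_weXn2l.
have cD : 0 <= ext2_const R m * D := mulr_ge0 c0 D0.
have := ler_wpM2r cD k3; have := ler_wpM2r cD k5.
rewrite /pcontr_const; lra.
Qed.

(** The first term grows at rate [lambda_1 + lambda_2] and the second at rate [2 lambda_1] for a
    vector of full growth, so a spectral gap makes the mean negative. *)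
Lemma ln_pcontr M x : (2 <= m)%N -> M \in unitmx -> x != 0 ->
  ln (pcontr M x) = ln (opnorm (exterior_power 2 M)) - 2 * growth M x.
Proof.
move=> m2 Mu x0; have nx := x0; rewrite -enorm_gt0 in nx.
have nMx := enorm_mulmx_gt0 Mu x0.
rewrite /pcontr lnM ?posrE ?opnorm_exterior_power2_gt0 ?exprn_gt0 ?divr_gt0//.
rewrite lnXn ?divr_gt0// growthE// ln_div ?posrE//.
by rewrite -mulr_natl; ring.
Qed.

Lemma pcontr_gt0 M x : (2 <= m)%N -> M \in unitmx -> x != 0 -> 0 < pcontr M x.
Proof.
move=> m2 Mu x0; rewrite mulr_gt0 ?opnorm_exterior_power2_gt0// exprn_gt0// divr_gt0 ?enorm_gt0//.
by rewrite mulmx_unit_eq0.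
Qed.

Lemma ln_opnorm_exterior_power2_le M : (2 <= m)%N -> M \in unitmx ->
  `|ln (opnorm (exterior_power 2 M))| <= ln (ext2_const R m) + 2 * ln (gl_size M).
Proof.
move=> m2 Mu; have w0 := opnorm_exterior_power2_gt0 m2 Mu.
have m0 : (0 < m)%N by exact: leq_trans m2.
have K1 := gl_size_ge1 m0 Mu.
have K0 : 0 < gl_size M by exact: lt_le_trans K1.
have c0 : 0 < ext2_const R m.
  by rewrite ltr0n !muln_gt0 card_incr_tuple2_gt0.
have -> : ln (ext2_const R m) + 2 * ln (gl_size M) = ln (ext2_const R m * gl_size M ^+ 2).
  by rewrite lnM ?posrE ?exprn_gt0// lnXn// mulr_natl.
have p0 : 0 < ext2_const R m * gl_size M ^+ 2 by rewrite mulr_gt0 ?exprn_gt0.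
rewrite ler_norml; apply/andP; split.
  rewrite -lnV ?posrE// ler_ln ?posrE ?invr_gt0//.
  rewrite -div1r ler_pdivrMr// (le_trans (opnorm_exterior_power2_ge m2 Mu))//.
  rewrite ler_wpM2l ?opnorm_ge0// ler_wpM2l ?(ltW c0)//.
  by rewrite ler_pXn2r ?nnegrE ?opnorm_ge0 ?(ltW K0)// opnormV_le_size.
rewrite ler_ln ?posrE// (le_trans (opnorm_exterior_power2_le _))//.
rewrite ler_wpM2l ?(ltW c0)//.
by rewrite ler_pXn2r ?nnegrE ?opnorm_ge0 ?(ltW K0)// opnorm_le_size.
Qed.

End projective_geometry.

(** * Splicing, shifting and reversing Bernoulli sequences *)

Section bernoulli.
Context d (T : measurableType d) (R : realType).

Definition box n (E : nat -> set T) : set (seqspace T) :=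
  [set w | forall i, (i < n)%N -> E i (w i)].

Lemma measurable_to_seqspace d' (X : measurableType d') (f : X -> seqspace T) :
  (forall i, measurable_fun setT (fun x => f x i)) -> measurable_fun setT f.
Proof.
move=> mf; apply: (@measurability _ _ X (seqspace T) setT f (@coordinate_sets _ T) erefl).
move=> _ [_ [i _ [E mE <-]] <-].
have := mf i measurableT E mE.
by rewrite !setTI.
Qed.

(** Uniqueness of measures on a generating pi-system: boxes of different lengths are intersected
    after padding with [setT], and the box of length 0 is the whole space. *)
Lemma measure_eq_on_boxes (Q1 Q2 : {measure set (seqspace T) -> \bar R}) :
  (Q1 setT < +oo)%E ->
  (forall n E, (forall i, measurable (E i)) -> Q1 (box n E) = Q2 (box n E)) ->
  forall X, measurable X -> Q1 X = Q2 X.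
Proof.
move=> Q1fin Q12 X mX.
pose G : set (set (seqspace T)) := [set X | exists n, exists2 E : nat -> set T,
  (forall i, measurable (E i)) & X = box n E].
have GE : @measurable _ (seqspace T) = <<s G >>.
  apply/seteqP; split.
    apply: smallest_sub; first exact: smallest_sigma_algebra.
    move=> _ [i _ [E mE <-]]; apply: sub_sigma_algebra.
    exists i.+1, (fun j => if j == i then E else setT).
      by move=> j; case: ifP.
    apply/seteqP; split => w /=; last by move/(_ i (leqnn _)); rewrite eqxx.
    by move=> [_ Ei] j _; case: eqP => [->|].
  apply: smallest_sub; first exact: sigma_algebra_measurable.
  by move=> _ [n [E mE ->]]; exact: measurable_box.
apply: (@measure_unique _ _ _ G (fun=> setT) GE _ _ _ Q1 Q2) => //.
- move=> _ _ [n1 [E1 mE1 ->]] [n2 [E2 mE2 ->]].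
  exists (maxn n1 n2), (fun i => (if (i < n1)%N then E1 i else setT) `&`
                                 (if (i < n2)%N then E2 i else setT)).
    by move=> i; apply: measurableI; case: ifP.
  apply/seteqP; split => w /=.
    by move=> [H1 H2] i _; split; case: ifP => //; [exact: H1|exact: H2].
  move=> H; split => i ilt; have [] := H i.
  - by rewrite leq_max ilt.
  - by rewrite ilt.
  - by rewrite leq_max ilt orbT.
  - by rewrite ilt.
- by move=> _; exists 0%N, (fun=> setT) => //; apply/seteqP; split.
- by apply/seteqP; split => // w _; exists 0%N.
- by move=> _ [n [E mE ->]]; exact: Q12.
Qed.

(** Prefixing [k] coordinates of one sequence to another sends [P \x P] to [P]. This expresses the
    independence of past and future without a separate space of finite words. *)
Definition splice k (uv : seqspace T * seqspace T) : seqspace T :=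
  fun i => if (i < k)%N then uv.1 i else uv.2 (i - k)%N.

Lemma measurable_splice k : measurable_fun setT (splice k).
Proof.
apply: measurable_to_seqspace => i; rewrite /splice; case: (i < k)%N.
  apply: (@measurableT_comp _ _ _ _ _ _ (fun w : seqspace T => w i) setT fst).
    exact: measurable_coord.
  exact: measurable_fst.
apply: (@measurableT_comp _ _ _ _ _ _ (fun w : seqspace T => w (i - k)%N) setT snd).
  exact: measurable_coord.
exact: measurable_snd.
Qed.

Lemma seq_shift_splice k u v : seq_shift k (splice k (u, v)) = v.
Proof.
by apply/funext => i; rewrite /seq_shift /splice /= ltnNge leq_addl /= addnK.
Qed.

Definition flip n (w : seqspace T) : seqspace T :=
  fun i => if (i < n)%N then w (n - i.+1)%N else w i.

Lemma measurable_flip n : measurable_fun setT (flip n).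
Proof.
by apply: measurable_to_seqspace => i; rewrite /flip; case: (i < n)%N; exact: measurable_coord.
Qed.

Context (p : probability T R) (P : probability (seqspace T) R) (hP : is_bernoulli p P).

Lemma splice_preimage_box k n E : splice k @^-1` box (k + n) E =
  box k E `*` box n (fun i => E (i + k)%N).
Proof.
apply/seteqP; split => -[u v] /=.
  move=> H; split => i ilt.
    by have := H i (ltn_addr _ ilt); rewrite /splice ilt.
  have := H (i + k)%N; rewrite addnC ltn_add2l => /(_ ilt).
  by rewrite /splice addnC ltnNge leq_addl /= addnK.
move=> [Hu Hv] i ilt; rewrite /splice; case: ltnP => ki; first exact: Hu.
by have := Hv (i - k)%N; rewrite subnK//; apply; rewrite ltn_subLR.
Qed.

Lemma splice_measure_preserving k X : measurable X ->
  (P \x P)%E (splice k @^-1` X) = P X.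
Proof.
move=> mX.
pose Q := measure_function_pushforward__canonical__measure_function_Measure
  (P \x P)%E (measurable_splice k).
have -> : (P \x P)%E (splice k @^-1` X) = Q X by [].
apply: measure_eq_on_boxes => //.
  rewrite /Q /= /pushforward preimage_setT -setXTT product_measure1E//.
  suff : (P setT * P setT < +oo)%E by [].
  by rewrite probability_setT mule1 ltry.
move=> n E mE.
(* Padding the box to length [k + n] lets it be cut at coordinate [k], whatever the order of [k] and
   [n]. *)
pose E' i : set T := if (i < n)%N then E i else setT.
have EE : box n E = box (k + n) E'.
  apply/seteqP; split => w /= H i ilt; first by rewrite /E'; case: ifP => // ?; exact: H.
  by have := H i (ltn_addl _ ilt); rewrite /E' ilt.
have mE' i : measurable (E' i) by rewrite /E'; case: ifP.
rewrite {}EE; move: E' mE' => {mE} {}E mE.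
rewrite /Q /= /pushforward splice_preimage_box product_measure1E; last 2 first.
- exact: measurable_box.
- by apply: measurable_box => i; exact: mE.
transitivity (P (box k E) * P (box n (fun i => E (i + k)%N)))%E; first by [].
rewrite /box (hP k mE) (hP n (fun i => mE (i + k)%N)) (hP (k + n) mE).
rewrite big_split_ord /=; congr (_ * _)%E.
by apply: eq_bigr => i _; rewrite addnC.
Qed.

Lemma integral_splice k (F : seqspace T -> \bar R) : measurable_fun [set: seqspace T] F ->
  (forall w, 0 <= F w)%E ->
  (\int[P]_w F w = \int[P]_u \int[P]_v F (splice k (u, v)))%E.
Proof.
move=> mF F0.
have mFs : measurable_fun setT (F \o splice k).
  apply: (@measurableT_comp _ _ _ _ _ _ F setT (splice k) mF).
  exact: measurable_splice.
have Fs0 uv : (0 <= (F \o splice k) uv)%E by exact: F0.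
have := @ge0_integral_pushforward _ _ _ _ R (splice k) (@measurable_splice k)
  (P \x P)%E setT F measurableT mF (fun y _ => F0 y).
rewrite preimage_setT fubini_tonelli1//.
move=> <-; apply: eq_measure_integral; first exact: measurable_splice.
by move=> mS A mA _; exact/esym/splice_measure_preserving.
Qed.

Lemma measurable_integral_splice k (F : seqspace T -> \bar R) : measurable_fun [set: seqspace T] F ->
  (forall w, 0 <= F w)%E ->
  measurable_fun setT (fun u => \int[P]_v F (splice k (u, v)))%E.
Proof.
move=> mF F0; apply: (@measurable_fun_fubini_tonelli_F _ _ _ _ _ P (fun uv => F (splice k uv))) => //.
apply: (@measurableT_comp _ _ _ _ _ _ F setT (splice k) mF).
exact: measurable_splice.
Qed.

Lemma integral_measure_preserving (phi : seqspace T -> seqspace T)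
    (F : seqspace T -> \bar R) : measurable_fun setT phi ->
  (forall X, measurable X -> P (phi @^-1` X) = P X) -> measurable_fun [set: seqspace T] F ->
  (\int[P]_w F (phi w) = \int[P]_w F w)%E.
Proof.
move=> mphi Pphi mF.
have H (G : seqspace T -> \bar R) : measurable_fun setT G -> (forall w, 0 <= G w)%E ->
    (\int[P]_w (G \o phi) w = \int[P]_w G w)%E.
  move=> mG G0; have := @ge0_integral_pushforward _ _ _ _ R _ mphi
    P setT G measurableT mG (fun y _ => G0 y).
  rewrite preimage_setT => <-; apply: eq_measure_integral.
  by move=> X mX _; exact: Pphi.
rewrite [LHS]integralE [RHS]integralE; congr (_ - _)%E.
  rewrite -(H F^\+%E); first by apply: eq_integral => w _; rewrite -funepos_comp.
  - exact: measurable_funepos.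
  - by move=> w; exact: funepos_ge0.
rewrite -(H F^\-%E); first by apply: eq_integral => w _; rewrite -funeneg_comp.
- exact: measurable_funeneg.
- by move=> w; exact: funeneg_ge0.
Qed.

Lemma integral_shift k (F : seqspace T -> \bar R) : measurable_fun [set: seqspace T] F ->
  (\int[P]_w F (seq_shift k w) = \int[P]_w F w)%E.
Proof.
move=> mF; apply: integral_measure_preserving => //; first exact: measurable_seq_shift.
by move=> X mX; exact: (bernoulli_shift k hP mX).
Qed.

Lemma flip_measure_preserving n X : measurable X -> P (flip n @^-1` X) = P X.
Proof.
move=> mX.
pose Q := measure_function_pushforward__canonical__measure_function_Measure P (measurable_flip n).
have -> : P (flip n @^-1` X) = Q X by [].
apply: measure_eq_on_boxes => //.
  by rewrite /Q /= /pushforward preimage_setT probability_setT ltry.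
move=> k E mE.
pose E' i : set T := if (i < k)%N then E i else setT.
have EE : box k E = box (n + k) E'.
  apply/seteqP; split => w /= H i ilt; first by rewrite /E'; case: ifP => // ?; exact: H.
  by have := H i (ltn_addl _ ilt); rewrite /E' ilt.
have mE' i : measurable (E' i) by rewrite /E'; case: ifP.
rewrite {}EE; move: E' mE' => {mE} {}E mE.
rewrite /Q /= /pushforward.
pose E2 i : set T := if (i < n)%N then E (n - i.+1)%N else E i.
have mE2 i : measurable (E2 i) by rewrite /E2; case: ifP => _; exact: mE.
have -> : flip n @^-1` box (n + k) E = box (n + k) E2.
  apply/seteqP; split => w /= H i ilt.
    rewrite /E2; case: ltnP => ni; last by have := H i ilt; rewrite /flip ltnNge ni.
    have h1 : (n - i.+1 < n)%N by lia.
    have := H (n - i.+1)%N (ltn_addr _ h1); rewrite /flip h1.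
    by rewrite (_ : (n - (n - i.+1).+1)%N = i) //; lia.
  rewrite /flip; case: ltnP => ni; last by have := H i ilt; rewrite /E2 ltnNge ni.
  have h1 : (n - i.+1 < n)%N by lia.
  have := H (n - i.+1)%N (ltn_addr _ h1); rewrite /E2 h1.
  by rewrite (_ : (n - (n - i.+1).+1)%N = i) //; lia.
rewrite /box (hP (n + k) mE2) (hP (n + k) mE).
rewrite !big_split_ord /=; congr (_ * _)%E; last first.
  by apply: eq_bigr => i _; rewrite /E2 ltnNge leq_addr.
rewrite [RHS](reindex_inj rev_ord_inj) /=.
by apply: eq_bigr => i _; rewrite /E2 /= ltn_ord.
Qed.

Lemma integral_flip n (F : seqspace T -> \bar R) : measurable_fun [set: seqspace T] F ->
  (\int[P]_w F (flip n w) = \int[P]_w F w)%E.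
Proof.
move=> mF; apply: integral_measure_preserving => //; first exact: measurable_flip.
by move=> X mX; exact: flip_measure_preserving.
Qed.

End bernoulli.

(** * Measurability of matrix-valued functions *)

Section matrix_measurability.
Context {R : realType} d (X : measurableType d).

Definition mx_measurable m n (F : X -> 'M[R]_(m, n)) : Prop :=
  forall i j, measurable_fun setT (fun w => F w i j).

Lemma mx_measurable_cst m n (M : 'M[R]_(m, n)) : mx_measurable (fun=> M).
Proof. by move=> i j; exact: measurable_cst. Qed.

Lemma mx_measurableM m n p (F : X -> 'M[R]_(m, n)) (G : X -> 'M[R]_(n, p)) :
  mx_measurable F -> mx_measurable G -> mx_measurable (fun w => F w *m G w).
Proof.
move=> mF mG i j; under eq_fun do rewrite mxE.
by apply: measurable_sum => k; apply: measurable_funM; [exact: mF|exact: mG].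
Qed.

Lemma mx_measurableB m n (F G : X -> 'M[R]_(m, n)) :
  mx_measurable F -> mx_measurable G -> mx_measurable (fun w => F w - G w).
Proof.
move=> mF mG i j; under eq_fun do rewrite !mxE.
by apply: measurable_funB; [exact: mF|exact: mG].
Qed.

Lemma mx_measurable_tr m n (F : X -> 'M[R]_(m, n)) :
  mx_measurable F -> mx_measurable (fun w => (F w)^T).
Proof. by move=> mF i j; under eq_fun do rewrite mxE; exact: mF. Qed.

(** The inverse is expressed through a real power of the square, whose base is nonnegative; where
    [f] vanishes both sides are 0. *)
Lemma measurable_invr (f : X -> R) : measurable_fun setT f ->
  measurable_fun setT (fun w => (f w)^-1).
Proof.
move=> mf; have -> : (fun w => (f w)^-1) = (fun w => f w * (f w * f w) `^ (-1)).
  apply/funext => w; rewrite powR_inv1 -?expr2 ?sqr_ge0//.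
  have [->|fw] := eqVneq (f w) 0; first by rewrite invr0 mul0r.
  by rewrite expr2 invfM mulrA divff// mul1r.
apply: measurable_funM => //; apply: (@measurableT_comp _ _ _ _ _ _ (@powR R ^~ (-1))).
  exact: measurable_powR.
exact: measurable_funM.
Qed.

Lemma measurable_det m (F : X -> 'M[R]_m) : mx_measurable F ->
  measurable_fun setT (fun w => \det (F w)).
Proof.
move=> mF; apply: measurable_sum => s; apply: measurable_funM; first exact: measurable_cst.
by apply: measurable_prod => i _; exact: mF.
Qed.

Lemma mx_measurable_exterior_power k m (F : X -> 'M[R]_m) : mx_measurable F ->
  mx_measurable (fun w => exterior_power k (F w)).
Proof.
move=> mF i j; under eq_fun do rewrite mxE.
by apply: measurable_det => a b; under eq_fun do rewrite mxE; exact: mF.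
Qed.

Lemma mx_measurableV m (F : X -> 'M[R]_m) : (forall w, F w \in unitmx) ->
  mx_measurable F -> mx_measurable (fun w => invmx (F w)).
Proof.
move=> uF mF i j.
have -> : (fun w => invmx (F w) i j) = (fun w => (\det (F w))^-1 * cofactor (F w) j i).
  by apply/funext => w; rewrite /invmx uF !mxE.
apply: measurable_funM; first exact/measurable_invr/measurable_det.
rewrite /cofactor; apply: measurable_funM; first exact: measurable_cst.
by apply: measurable_det => a b; under eq_fun do rewrite !mxE; exact: mF.
Qed.

Lemma measurable_enorm n (F : X -> 'cV[R]_n) : mx_measurable F ->
  measurable_fun setT (fun w => enorm (F w)).
Proof.
move=> mF.
have -> : (fun w => enorm (F w)) = (fun w => (\sum_i F w i ord0 * F w i ord0) `^ (2^-1)).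
  apply/funext => w; rewrite powR12_sqrt.
    by rewrite /enorm; congr Num.sqrt; apply: eq_bigr => i _; rewrite expr2.
  by apply: sumr_ge0 => i _; rewrite -expr2 sqr_ge0.
apply: (@measurableT_comp _ _ _ _ _ _ (@powR R ^~ (2^-1))); first exact: measurable_powR.
by apply: measurable_sum => i; apply: measurable_funM; exact: mF.
Qed.

Lemma enorm_mulmx_cst_measurable m n (F : X -> 'M[R]_(m, n)) (x : 'cV[R]_n) :
  mx_measurable F -> measurable_fun setT (fun w => enorm (F w *m x)).
Proof. by move=> mF; apply: measurable_enorm; apply: mx_measurableM => //; exact: mx_measurable_cst. Qed.

Lemma rat_col_approx k (c : 'cV[R]_k) e : 0 < e ->
  exists q : 'cV[rat]_k, enorm (c - map_mx ratr q) <= e.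
Proof.
move=> e0; pose e' := e / k.+1%:R.
have e'0 : 0 < e' by rewrite divr_gt0.
have H i : exists q : rat, ratr q \in `](c i ord0 - e'), (c i ord0 + e')[.
  by apply: rat_in_itvoo; rewrite ltrD2l gt0_cp.
pose q : 'cV[rat]_k := \col_i sval (cid (H i)).
exists q; rewrite (le_trans (enorm_le_sum _))//.
apply: (@le_trans _ _ (\sum_(i < k) e')).
  apply: ler_sum => i _; rewrite !mxE; case: cid => /= r.
  by rewrite in_itv /= => /andP[h1 h2]; rewrite ler_norml; apply/andP; split; lra.
rewrite sumr_const card_ord -mulr_natr /e' mulrAC -mulrA ler_piMr ?(ltW e0)//.
by rewrite ler_pdivrMr// mul1r ler_nat.
Qed.

(** The norm exceeds [r >= 0] exactly when some vector with rational coordinates in a basis of [L]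
    witnesses it. The superlevel set is thus a countable union of measurable sets. *)
Lemma measurable_opnorm_on m n (L : {vspace 'cV[R]_n}) (F : X -> 'M[R]_(m, n)) :
  mx_measurable F -> measurable_fun setT (fun w => opnorm_on L (F w)).
Proof.
move=> mF; pose k := \dim L.
pose E : 'M[R]_(n, k) := \matrix_(i, j) (vbasis L)`_j i ord0.
have EL c : E *m c \in L.
  have -> : E *m c = \sum_j c j ord0 *: (vbasis L)`_j.
    apply/matrixP => i l; rewrite (ord1 l) !mxE summxE; apply: eq_bigr => j _.
    by rewrite !mxE mulrC.
  apply: memv_suml => j _; apply: memvZ; apply: vbasis_mem.
  by apply: mem_nth; rewrite size_tuple.
have LE x : x \in L -> exists c, x = E *m c.
  move=> xL; exists (\col_j coord (vbasis L) j x); rewrite {1}(coord_vbasis xL).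
  apply/matrixP => i l; rewrite (ord1 l) !mxE summxE; apply: eq_bigr => j _.
  by rewrite !mxE mulrC.
move=> mT; apply: (measurability _ (RGenOInfty.measurableE R)) => //.
move=> _ [_ [r ->] <-]; apply: measurableI => //.
have [r0|r0] := ltP r 0.
  rewrite (_ : _ @^-1` _ = setT)//; apply/seteqP; split => // w _ /=.
  by rewrite in_itv /= andbT (lt_le_trans r0)// opnorm_on_ge0.
rewrite (_ : _ @^-1` _ = \bigcup_(c : 'cV[rat]_k)
   [set w | r * enorm (E *m map_mx ratr c) < enorm (F w *m (E *m map_mx ratr c))]).
  apply: countable_bigcupT_measurable; first exact: countableP.
  move=> c.
  have := measurable_fun_ltr (@measurable_cst _ _ X _ setT (r * enorm (E *m map_mx ratr c)))
    (enorm_mulmx_cst_measurable (E *m map_mx ratr c) mF).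
  by move=> /(_ measurableT [set true]); rewrite setTI; apply.
apply/seteqP; split => w /=.
  rewrite in_itv /= andbT => lt; apply: contrapT => no.
  move: lt; rewrite ltNge => /negP; apply; apply: opnorm_on_le => // x /LE[c ->].
  apply: contrapT => /negP; rewrite -ltNge => lt; apply: no.
  set M := F w in lt *.
  (* [g] is the slack in the strict inequality. Moving [c] to a rational vector changes the two
     sides together by at most [(opnorm M + r) * opnorm E] times the displacement, so a displacement
     [g / (2 * C)] preserves strictness; the [+ 1] keeps [C] positive. *)
  pose g := enorm (M *m (E *m c)) - r * enorm (E *m c).
  have g0 : 0 < g by rewrite subr_gt0.
  pose C := (opnorm M + r) * opnorm E + 1.
  have C0 : 0 < C by rewrite ltr_wpDl// mulr_ge0 ?opnorm_ge0// addr_ge0 ?opnorm_ge0.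
  have [q Hq] := @rat_col_approx k c (g / (2 * C)) (divr_gt0 g0 (mulr_gt0 (ltr0n _ 2) C0)).
  exists q => //; set c' := map_mx ratr q in Hq *.
  have h1 : enorm (M *m (E *m c)) - enorm (M *m (E *m c')) <= opnorm M * (opnorm E * enorm (c - c')).
    rewrite (le_trans (enormB _ _))// -!mulmxBr (le_trans (ler_opnorm _ _))//.
    by rewrite ler_wpM2l ?opnorm_ge0// ler_opnorm.
  have h2 : enorm (E *m c') - enorm (E *m c) <= opnorm E * enorm (c - c').
    by rewrite (le_trans (enormB _ _))// -mulmxBr enorm_distC (le_trans (ler_opnorm _ _))//.
  have h2' := ler_wpM2l r0 h2.
  have h3 : C * enorm (c - c') <= g / 2.
    rewrite (le_trans (ler_wpM2l (ltW C0) Hq))//.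
    by rewrite invfM mulrCA (mulrCA C) mulfV ?gt_eqF// mulr1.
  have h4 := enorm_ge0 (c - c').
  rewrite /C in h3; rewrite /= -subr_gt0 -/c'; rewrite /g in g0 h3; lra.
move=> [c _ /= lt]; rewrite in_itv /= andbT.
have n0 : 0 < enorm (E *m map_mx ratr c).
  rewrite enorm_gt0; apply/eqP => e0; move: lt.
  by rewrite e0 mulmx0 !enorm0 mulr0 ltxx.
rewrite -(ltr_pM2r n0) (lt_le_trans lt)//.
by apply: ler_opnorm_on; exact: EL.
Qed.

Lemma measurable_opnorm m n (F : X -> 'M[R]_(m, n)) : mx_measurable F ->
  measurable_fun setT (fun w => opnorm (F w)).
Proof. exact: measurable_opnorm_on. Qed.

Lemma measurable_gl_size m (F : X -> 'M[R]_m) : (forall w, F w \in unitmx) ->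
  mx_measurable F -> measurable_fun setT (fun w => gl_size (F w)).
Proof.
move=> uF mF; apply: measurable_maxr; apply: measurable_opnorm => //.
exact: mx_measurableV.
Qed.

Lemma measurable_growthv m (F : X -> 'M[R]_m) (G : X -> 'cV[R]_m) :
  mx_measurable F -> mx_measurable G -> measurable_fun setT (fun w => growth (F w) (G w)).
Proof.
move=> mF mG; apply: (@measurableT_comp _ _ _ _ _ _ (@ln R)); first exact: measurable_ln.
apply: measurable_funM; first by apply: measurable_enorm; exact: mx_measurableM.
by apply: measurable_invr; exact: measurable_enorm.
Qed.

Lemma mx_measurable_wedge m (F G : X -> 'cV[R]_m) :
  mx_measurable F -> mx_measurable G -> mx_measurable (fun w => wedge (F w) (G w)).
Proof.
move=> mF mG i j; under eq_fun do rewrite mxE.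
by apply: measurable_funB; apply: measurable_funM; (exact: mF || exact: mG).
Qed.

Lemma measurable_pdist m (F G : X -> 'cV[R]_m) :
  mx_measurable F -> mx_measurable G -> measurable_fun setT (fun w => pdist (F w) (G w)).
Proof.
move=> mF mG; apply: measurable_funM.
  by apply: measurable_enorm; exact: mx_measurable_wedge.
by apply: measurable_invr; apply: measurable_funM; exact: measurable_enorm.
Qed.

Lemma measurable_pcontr m (F : X -> 'M[R]_m) x :
  mx_measurable F -> measurable_fun setT (fun w => pcontr (F w) x).
Proof.
move=> mF; have mn : measurable_fun setT (fun w => enorm x / enorm (F w *m x)).
  apply: measurable_funM; first exact: measurable_cst.
  by apply: measurable_invr; exact: enorm_mulmx_cst_measurable.
apply: measurable_funM; first exact/measurable_opnorm/mx_measurable_exterior_power.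
exact: (measurable_funM mn mn).
Qed.

Lemma measurable_powRf (f : X -> R) s : measurable_fun setT f ->
  measurable_fun setT (fun w => f w `^ s).
Proof. by move=> mf; apply: (@measurableT_comp _ _ _ _ _ _ (@powR R ^~ s)) => //; exact: measurable_powR. Qed.

Lemma measurable_lnf (f : X -> R) : measurable_fun setT f ->
  measurable_fun setT (fun w => ln (f w)).
Proof. by move=> mf; apply: (@measurableT_comp _ _ _ _ _ _ (@ln R)) => //; exact: measurable_ln. Qed.

End matrix_measurability.

Lemma mx_measurable_comp {R : realType} d d' (X : measurableType d) (Y : measurableType d')
    m n (F : Y -> 'M[R]_(m, n)) (phi : X -> Y) :
  measurable_fun setT phi -> mx_measurable F -> mx_measurable (F \o phi).
Proof. by move=> mphi mF i j; exact: (@measurableT_comp _ _ _ _ _ _ (fun w => F w i j)). Qed.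

(** * Expectations and moments of products *)

Section expectation.
Context {R : realType} d (X : measurableType d) (P : probability X R).
Local Open Scope ereal_scope.

Import HBNNSimple.

(** The integral of a nonnegative function is the supremum over the simple functions below it, and
    those below [f] are below [g]. *)
Lemma ge0_le_integral_nomeas (f g : X -> \bar R) :
  (forall w, 0 <= f w) -> (forall w, f w <= g w) -> \int[P]_w f w <= \int[P]_w g w.
Proof.
move=> f0 fg; have g0 w : 0 <= g w by exact: le_trans (fg w).
rewrite !ge0_integralE//.
apply: ereal_sup_le => _ [h hf <-].
exists h => // w; apply: le_trans (hf w) _.
by rewrite !patch_setT.
Qed.

(** Valued in the extended reals, so that a real upper bound on a nonnegative function also asserts
    that its expectation is finite. *)
Definition EP (f : X -> R) : \bar R := \int[P]_w (f w)%:E.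

Lemma EPE (f : X -> R) : EP f = \int[P]_w (f w)%:E.
Proof. by []. Qed.

Lemma EP_indic (S : set X) : measurable S -> EP (\1_S) = P S.
Proof. by move=> mS; rewrite /EP integral_indic// setIT. Qed.

Lemma EP_eq (f g : X -> R) : (forall w, f w = g w) -> EP f = EP g.
Proof. by move=> fg; rewrite /EP; apply: eq_integral => w _; rewrite fg. Qed.

Lemma EP_ge0 (f : X -> R) : (forall w, 0 <= f w)%R -> 0 <= EP f.
Proof. by move=> f0; apply: integral_ge0 => w _; rewrite lee_fin. Qed.

Lemma EP_le (f g : X -> R) : (forall w, 0 <= f w)%R -> (forall w, f w <= g w)%R ->
  EP f <= EP g.
Proof. by move=> f0 fg; apply: ge0_le_integral_nomeas => w; rewrite lee_fin. Qed.

Lemma EPZl (c : R) (f : X -> R) : (0 <= c)%R -> measurable_fun setT f ->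
  (forall w, 0 <= f w)%R -> EP (fun w => c * f w)%R = c%:E * EP f.
Proof.
move=> c0 mf f0; rewrite /EP; under eq_integral do rewrite EFinM.
rewrite ge0_integralZl_EFin//; last exact/measurable_EFinP.
by move=> w _; rewrite lee_fin.
Qed.

Lemma EPD (f g : X -> R) : measurable_fun setT f -> measurable_fun setT g ->
  (forall w, 0 <= f w)%R -> (forall w, 0 <= g w)%R ->
  EP (fun w => f w + g w)%R = EP f + EP g.
Proof.
move=> mf mg f0 g0; rewrite /EP; under eq_integral do rewrite EFinD.
rewrite ge0_integralD//; try exact/measurable_EFinP.
- by move=> w _; rewrite lee_fin.
- by move=> w _; rewrite lee_fin.
Qed.

Lemma EP_cst (c : R) : EP (fun=> c) = c%:E.
Proof.
transitivity (c%:E * P setT); first exact: integral_cst.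
by rewrite probability_setT mule1.
Qed.

Lemma EPZ_le (c a : R) (f : X -> R) : (0 <= c)%R -> measurable_fun setT f ->
  (forall w, 0 <= f w)%R -> EP f <= a%:E -> EP (fun w => c * f w)%R <= (c * a)%:E.
Proof. by move=> c0 mf f0 fa; rewrite EPZl// EFinM lee_wpmul2l// lee_fin. Qed.

Lemma EPD_le (a b : R) (f g : X -> R) : measurable_fun setT f -> measurable_fun setT g ->
  (forall w, 0 <= f w)%R -> (forall w, 0 <= g w)%R ->
  EP f <= a%:E -> EP g <= b%:E -> EP (fun w => f w + g w)%R <= (a + b)%:E.
Proof. by move=> mf mg f0 g0 fa gb; rewrite EPD// EFinD leeD. Qed.

Lemma EP_integrable (f : X -> R) a : measurable_fun setT f ->
  EP (fun w => `|f w|)%R <= a%:E -> P.-integrable setT (EFin \o f).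
Proof.
move=> mf fa; apply/integrableP; split; first exact/measurable_EFinP.
by apply: le_lt_trans (ltry a); apply: le_trans fa.
Qed.

Lemma EP_Rintegral (f : X -> R) : P.-integrable setT (EFin \o f) ->
  EP f = (\int[P]_w f w)%:E.
Proof. by move=> fi; rewrite /EP /Rintegral fineK// integrable_fin_num. Qed.

End expectation.

Notation EPle P f a := (EP P f%R <= a%R%:E)%E (only parsing).

Section cocycles.
Context {R : realType} d (T : measurableType d).
Context (p : probability T R) (P : probability (seqspace T) R) (hP : is_bernoulli p P).
Context (m : nat).
Implicit Types (b : T -> 'M[R]_m).

(** The representative that is locally constant everywhere. Arbitrary cocycles in [LP] are replaced
    by such a one, up to a null set, at the end. *)
Definition coc b : seqspace T -> 'M[R]_m := fun w => b (w 0%N).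

Definition iter_prod b n w : 'M[R]_m := cocycle_iter (coc b) n w.

Lemma iter_prodD b n k w :
  iter_prod b (n + k) w = iter_prod b n (seq_shift k w) *m iter_prod b k w.
Proof.
rewrite /iter_prod; elim: n => [|n IHn]; first by rewrite mul1mx.
by rewrite addSn /= IHn mulmxA; congr (_ *m _ *m _).
Qed.

Lemma iter_prod_ext b n w w' : (forall i, (i < n)%N -> w i = w' i) ->
  iter_prod b n w = iter_prod b n w'.
Proof.
rewrite /iter_prod; elim: n => [//|n IHn] H /=.
rewrite IHn => [|i ilt]; last by apply: H; exact: ltn_trans ilt _.
by rewrite /coc /seq_shift !add0n H.
Qed.

Lemma iter_prod_splice b n u v : iter_prod b n (splice n (u, v)) = iter_prod b n u.
Proof. by apply: iter_prod_ext => i ilt; rewrite /splice ilt. Qed.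

Lemma iter_prodD_splice b n k u v :
  iter_prod b (n + k) (splice k (u, v)) = iter_prod b n v *m iter_prod b k u.
Proof. by rewrite iter_prodD seq_shift_splice iter_prod_splice. Qed.

Lemma iter_prod1 b w : iter_prod b 1 w = b (w 0%N).
Proof. by rewrite /iter_prod /= mulmx1 /coc /seq_shift. Qed.

Lemma iter_prod_unit b n w : (forall t, b t \in unitmx) -> iter_prod b n w \in unitmx.
Proof.
move=> ub; rewrite /iter_prod; elim: n => [|n IHn] /=; first exact: unitmx1.
by rewrite unitmx_mul IHn andbT ub.
Qed.

Lemma coc_measurable b : mx_measurable b -> mx_measurable (coc b).
Proof.
move=> mb i j; apply: (@measurableT_comp _ _ _ _ _ _ (fun t => b t i j)) => //.
exact: measurable_coord.
Qed.

Lemma iter_prod_measurable b n : mx_measurable b -> mx_measurable (iter_prod b n).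
Proof.
move=> mb; rewrite /iter_prod; elim: n => [|n IHn]; first exact: mx_measurable_cst.
apply: mx_measurableM => //.
apply: (mx_measurable_comp (@measurable_seq_shift _ T n)).
exact: coc_measurable.
Qed.

Lemma EP_splice k (f : seqspace T -> R) : measurable_fun setT f -> (forall w, 0 <= f w) ->
  EP P f = (\int[P]_u EP P (fun v => f (splice k (u, v))))%E.
Proof.
move=> mf f0; have F0 w : (0 <= (f w)%:E)%E by rewrite lee_fin.
have mF : measurable_fun setT (fun w => (f w)%:E) by exact/measurable_EFinP.
exact: (integral_splice hP k mF F0).
Qed.

(* The two factors depend on disjoint sets of coordinates. *)
Lemma EP_splice_le k (f g : seqspace T -> R) c a :
  measurable_fun setT f -> (forall w, 0 <= f w) ->
  measurable_fun setT g -> (forall w, 0 <= g w) -> 0 <= c ->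
  (forall u, EP P (fun v => f (splice k (u, v))) <= (c * g u)%:E)%E ->
  (EP P g <= a%:E -> EP P f <= (c * a)%:E)%E.
Proof.
move=> mf f0 mg g0 c0 H ga; rewrite (EP_splice k)//.
apply: le_trans (EPZ_le c0 mg g0 ga).
by apply: ge0_le_integral_nomeas => // u; apply: EP_ge0.
Qed.

Lemma EP_shift k (f : seqspace T -> R) : measurable_fun setT f ->
  EP P (fun w => f (seq_shift k w)) = EP P f.
Proof.
move=> mf; rewrite /EP (integral_shift hP k (F := fun w => (f w)%:E))//.
exact/measurable_EFinP.
Qed.

Lemma moment_iter_prod b n s M : (forall t, b t \in unitmx) -> mx_measurable b ->
  0 < s -> 1 <= M ->
  EPle P (fun w => gl_size (coc b w) `^ s) M ->
  (0 < m)%N ->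
  EPle P (fun w => gl_size (iter_prod b n w) `^ s) (M ^+ n).
Proof.
move=> ub mb s0 M1 bM m0; have M0 : 0 <= M by exact: le_trans M1.
have mK k : measurable_fun setT (fun w => gl_size (iter_prod b k w) `^ s).
  apply: measurable_powRf; apply: measurable_gl_size.
    by move=> w; exact: iter_prod_unit.
  exact: iter_prod_measurable.
elim: n => [|n IHn].
  rewrite expr0 -(EP_cst P 1); apply: EP_le => w; first exact: powR_ge0.
  by rewrite /iter_prod /= gl_size1// powR1.
rewrite -addn1 exprD expr1.
apply: (@EP_splice_le 1 _ (fun w => gl_size (coc b w) `^ s)) => //.
- by move=> w; exact: powR_ge0.
- apply: measurable_powRf; apply: measurable_gl_size; first by move=> w; exact: ub.
  exact: coc_measurable.
- by move=> w; exact: powR_ge0.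
- exact: exprn_ge0.
move=> u; rewrite mulrC; apply: le_trans (EPZ_le (powR_ge0 _ _) (mK n) _ IHn).
  apply: EP_le => v; first exact: powR_ge0.
  rewrite iter_prodD_splice iter_prod1 mulrC -powRM ?gl_size_ge0//.
  rewrite powR_le ?(ltW s0) ?gl_size_ge0// gl_sizeM//.
  exact: iter_prod_unit.
by move=> w; exact: powR_ge0.
Qed.

(** Telescoping over the position where [b] is exchanged for [b']: each of the [n] terms has one
    factor of moment [e], and by independence the others contribute at most [M^n]. The exponent
    [s <= 1] makes the power of the sum subadditive. *)
Lemma moment_iter_prodB b b' n s M e :
  (forall t, b t \in unitmx) -> mx_measurable b ->
  (forall t, b' t \in unitmx) -> mx_measurable b' ->
  0 < s -> s <= 1 -> 1 <= M -> (0 < m)%N -> 0 <= e ->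
  EPle P (fun w => gl_size (coc b w) `^ s) M ->
  EPle P (fun w => gl_size (coc b' w) `^ s) M ->
  EPle P (fun w => opnorm (coc b w - coc b' w) `^ s) e ->
  EPle P (fun w => opnorm (iter_prod b n w - iter_prod b' n w) `^ s) (n%:R * M ^+ n * e).
Proof.
move=> ub mb ub' mb' s0 s1 M1 m0 e0 bM b'M bb'.
have M0 : 0 <= M by exact: le_trans M1.
have mD k : measurable_fun setT (fun w => opnorm (iter_prod b k w - iter_prod b' k w) `^ s).
  apply: measurable_powRf; apply: measurable_opnorm.
  by apply: mx_measurableB; exact: iter_prod_measurable.
have mK k : measurable_fun setT (fun w => gl_size (iter_prod b k w) `^ s).
  apply: measurable_powRf; apply: measurable_gl_size.
    by move=> w; exact: iter_prod_unit.
  exact: iter_prod_measurable.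
have md : measurable_fun setT (fun w => opnorm (coc b w - coc b' w) `^ s).
  apply: measurable_powRf; apply: measurable_opnorm.
  by apply: mx_measurableB; exact: coc_measurable.
have mK' : measurable_fun setT (fun w => gl_size (coc b' w) `^ s).
  apply: measurable_powRf; apply: measurable_gl_size; first by move=> w; exact: ub'.
  exact: coc_measurable.
elim: n => [|n IHn].
  rewrite !mul0r -(EP_cst P 0); apply: EP_le => w; first exact: powR_ge0.
  by rewrite /iter_prod /= subrr (_ : opnorm _ = 0) ?powR0 ?gt_eqF//;
    apply/eqP; rewrite eq_le opnorm_ge0 andbT; apply: opnorm_le => // x;
    rewrite mul0mx enorm0 mul0r.
rewrite -[in leLHS]addn1.
pose g w := M ^+ n * opnorm (coc b w - coc b' w) `^ s +
  n%:R * M ^+ n * e * gl_size (coc b' w) `^ s.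
have c1 : 0 <= M ^+ n by exact: exprn_ge0.
have c2 : 0 <= n%:R * M ^+ n * e by rewrite !mulr_ge0.
have mg1 : measurable_fun setT (fun w => M ^+ n * opnorm (coc b w - coc b' w) `^ s).
  by apply: measurable_funM => //; exact: measurable_cst.
have mg2 : measurable_fun setT (fun w => n%:R * M ^+ n * e * gl_size (coc b' w) `^ s).
  by apply: measurable_funM => //; exact: measurable_cst.
have mg : measurable_fun setT g by apply: measurable_funD.
have gg0 w : 0 <= g w by rewrite addr_ge0// mulr_ge0// powR_ge0.
apply: (@le_trans _ _ (1 * (M ^+ n * e + n%:R * M ^+ n * e * M))%:E).
  apply: (EP_splice_le (k := 1) (mD (n + 1)%N) (fun w => powR_ge0 _ _) mg gg0 ler01).
  - move=> u; rewrite mul1r.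
    have H := moment_iter_prod n ub mb s0 M1 bM m0.
    have h1 := EPZ_le (powR_ge0 (opnorm (coc b u - coc b' u)) s) (mK n) (fun w => powR_ge0 _ _) H.
    have h2 := EPZ_le (powR_ge0 (gl_size (coc b' u)) s) (mD n) (fun w => powR_ge0 _ _) IHn.
    rewrite /g (mulrC (M ^+ n)) (mulrC (_ * e)).
    have q1 : measurable_fun setT
        (fun w => opnorm (coc b u - coc b' u) `^ s * gl_size (iter_prod b n w) `^ s).
      by apply: measurable_funM; [exact: measurable_cst|exact: mK].
    have q2 : measurable_fun setT
        (fun w => gl_size (coc b' u) `^ s * opnorm (iter_prod b n w - iter_prod b' n w) `^ s).
      by apply: measurable_funM; [exact: measurable_cst|exact: mD].
    have z1 w := mulr_ge0 (powR_ge0 (opnorm (coc b u - coc b' u)) s)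
      (powR_ge0 (gl_size (iter_prod b n w)) s).
    have z2 w := mulr_ge0 (powR_ge0 (gl_size (coc b' u)) s)
      (powR_ge0 (opnorm (iter_prod b n w - iter_prod b' n w)) s).
    apply: le_trans (EPD_le q1 q2 z1 z2 h1 h2).
    apply: EP_le => v; first exact: powR_ge0.
    rewrite !iter_prodD_splice !iter_prod1.
    rewrite -!powRM ?opnorm_ge0 ?gl_size_ge0//.
    rewrite (le_trans _ (powR_subadd s0 s1 _ _)) ?mulr_ge0 ?opnorm_ge0 ?gl_size_ge0//.
    rewrite powR_le ?(ltW s0) ?opnorm_ge0//.
    have -> : iter_prod b n v *m b (u 0%N) - iter_prod b' n v *m b' (u 0%N) =
      iter_prod b n v *m (b (u 0%N) - b' (u 0%N)) + (iter_prod b n v - iter_prod b' n v) *m b' (u 0%N).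
      by rewrite mulmxBr mulmxBl addrA subrK.
    rewrite (le_trans (opnormD _ _))// lerD//; rewrite (le_trans (opnormM _ _))//.
      by rewrite mulrC ler_wpM2l ?opnorm_ge0// opnorm_le_size.
    by rewrite mulrC ler_wpM2r ?opnorm_ge0// opnorm_le_size.
  - apply: (EPD_le mg1 mg2).
    + by move=> w; rewrite mulr_ge0 ?powR_ge0.
    + by move=> w; rewrite mulr_ge0 ?powR_ge0.
    + exact: (EPZ_le c1 md (fun w => powR_ge0 _ _) bb').
    + exact: (EPZ_le c2 mK' (fun w => powR_ge0 _ _) b'M).
rewrite lee_fin mul1r -natr1 exprSr.
have : M ^+ n * e * 1 <= M ^+ n * e * M by rewrite ler_wpM2l// mulr_ge0.
rewrite mulr1; lra.
Qed.

End cocycles.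

(* Keeps unification from unfolding suprema and integrals. *)
#[global] Opaque EP gl_size opnorm growth pcontr pdist enorm powR ln expR.

(** * Consequences of contraction on average *)

Section contraction.
Context {R : realType} d (T : measurableType d).
Context (p : probability T R) (P : probability (seqspace T) R) (hP : is_bernoulli p P).
Context (m : nat) (m0 : (0 < m)%N).
Implicit Types (b : T -> 'M[R]_m) (x y : 'cV[R]_m).

(** The pair [s], [M] is shared by all cocycles of a neighborhood, which makes the constants below
    uniform over it. *)
Definition GL_moment b s M : Prop :=
  [/\ forall t, b t \in unitmx, mx_measurable b & EPle P (fun w => gl_size (coc b w) `^ s) M].

Lemma measurable_normf d' (X : measurableType d') (f : X -> R) :
  measurable_fun setT f -> measurable_fun setT (fun w => `|f w|).
Proof.
by move=> mf; apply: (@measurableT_comp _ _ _ _ _ _ (@Num.norm _ R)).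
Qed.

Lemma measurable_exprf d' (X : measurableType d') (f : X -> R) n :
  measurable_fun setT f -> measurable_fun setT (fun w => f w ^+ n).
Proof.
move=> mf; elim: n => [|n IHn]; first exact: measurable_cst.
by under eq_fun do rewrite exprS; exact: measurable_funM.
Qed.

Lemma GL_moment_le b s s' M : s' <= s -> GL_moment b s M -> GL_moment b s' M.
Proof.
move=> ss [ub mb bM]; split; [exact: ub|exact: mb|]; apply: le_trans bM; apply: EP_le => w.
  exact: powR_ge0.
by apply: ler_powR ss; apply: gl_size_ge1 => //; exact: ub.
Qed.

Lemma GL_moment_iter_unit b s M n w : GL_moment b s M -> iter_prod b n w \in unitmx.
Proof. by move=> [ub _ _]; exact: iter_prod_unit. Qed.

Context (s M alpha : R) (N : nat).
Context (al0 : 0 < alpha) (als : 14 * alpha <= s) (s1 : s <= 1) (M1 : 1 <= M).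

(** After balancing in [perturb_moment], [M^N] is left by the moments of the sizes and [N * M^N] by
    the telescoped difference of the products. *)
Definition perturb_const : R := (1 + N%:R) * M ^+ N.

Lemma perturb_const_ge0 : 0 <= perturb_const.
Proof.
apply: mulr_ge0; first by rewrite addr_ge0.
by apply: exprn_ge0; exact: le_trans ler01 M1.
Qed.

Lemma iter_moment b n t : 0 < t -> t <= s -> GL_moment b s M ->
  EPle P (fun w => gl_size (iter_prod b n w) `^ t) (M ^+ n).
Proof. by move=> t0 ts /(GL_moment_le ts)[ub mb bM]; exact: (moment_iter_prod hP n ub mb t0 M1 bM m0). Qed.

Lemma measurable_iter_size b n t : GL_moment b s M ->
  measurable_fun setT (fun w => gl_size (iter_prod b n w) `^ t).
Proof.
move=> [ub mb _]; apply: measurable_powRf; apply: measurable_gl_size.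
  by move=> w; exact: iter_prod_unit.
exact: iter_prod_measurable.
Qed.

Lemma measurable_iter_dist b b' n t : GL_moment b s M -> GL_moment b' s M ->
  measurable_fun setT (fun w => opnorm (iter_prod b n w - iter_prod b' n w) `^ t).
Proof.
move=> [_ mb _] [_ mb' _]; apply: measurable_powRf; apply: measurable_opnorm.
by apply: mx_measurableB; exact: iter_prod_measurable.
Qed.

(** A common bound, up to constants, for the perturbations of [pcontr], [growth] and [pdist] over
    one block. The sum of the two sizes stands in for their maximum because its powers are
    subadditive. *)
Definition perturb_err b b' w : R :=
  ((gl_size (iter_prod b N w) + gl_size (iter_prod b' N w)) ^+ 7 *
    opnorm (iter_prod b N w - iter_prod b' N w)) `^ alpha.

Lemma perturb_err_ge0 b b' w : 0 <= perturb_err b b' w.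
Proof. exact: powR_ge0. Qed.

Lemma measurable_perturb_err b b' : GL_moment b s M -> GL_moment b' s M ->
  measurable_fun setT (perturb_err b b').
Proof.
move=> [ub mb _] [ub' mb' _]; apply: measurable_powRf; apply: measurable_funM.
  apply: measurable_exprf; apply: measurable_funD; apply: measurable_gl_size;
    by [move=> w; exact: iter_prod_unit | exact: iter_prod_measurable].
by apply: measurable_opnorm; apply: mx_measurableB; exact: iter_prod_measurable.
Qed.

(** The weighted inequality with [eta = e^alpha] leaves [eta] times [K^(14 alpha)], bounded through
    the [s]-th moments, and [1/eta] times [D^(2 alpha)], whose mean is of order [e^(2 alpha)] by
    [powR_interp]. Both contributions are of order [e^alpha]. *)
Lemma perturb_moment b b' e : GL_moment b s M -> GL_moment b' s M -> 0 < e ->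
  EPle P (fun w => opnorm (coc b w - coc b' w)) e ->
  EPle P (perturb_err b b') (perturb_const * e `^ alpha).
Proof.
move=> hb hb' e0 be; set eta := e `^ alpha.
have eta0 : 0 < eta by exact: powR_gt0.
have al1 : 2 * alpha <= 1 by move: al0 als s1; lra.
have al2 : 0 < 2 * alpha by rewrite mulr_gt0.
have M0 : 0 <= M by exact: le_trans ler01 M1.
have hD : EPle P (fun w => opnorm (iter_prod b N w - iter_prod b' N w) `^ (2 * alpha))
    (N%:R * M ^+ N * (2 * eta ^+ 2)).
  have als2 : 2 * alpha <= s by move: al0 als s1; lra.
  have [ub mb bM] := GL_moment_le als2 hb; have [ub' mb' bM'] := GL_moment_le als2 hb'.
  have md : measurable_fun setT (fun w => opnorm (coc b w - coc b' w)).
    by apply: measurable_opnorm; apply: mx_measurableB; exact: coc_measurable.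
  have eta2 : 0 <= 2 * eta ^+ 2 by rewrite mulr_ge0// exprn_ge0// ltW.
  apply: (moment_iter_prodB hP N ub mb ub' mb' al2 al1 M1 m0 eta2 bM bM').
  have -> : 2 * eta ^+ 2 = eta ^+ 2 * (1 + e^-1 * e) by rewrite mulVf ?gt_eqF//; ring.
  apply: (@le_trans _ _ (EP P (fun w => eta ^+ 2 * (1 + e^-1 * opnorm (coc b w - coc b' w))))).
    apply: EP_le => w; first exact: powR_ge0.
    rewrite /eta -powR_sqr ?(ltW e0)// -powR_mulrn ?(ltW e0)// -powRrM.
    by rewrite (mulrC _^-1); apply: powR_interp => //; exact: opnorm_ge0.
  have ei0 : 0 <= e^-1 by rewrite invr_ge0 ltW.
  have z w : 0 <= e^-1 * opnorm (coc b w - coc b' w) by rewrite mulr_ge0 ?opnorm_ge0.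
  have mz : measurable_fun setT (fun w => e^-1 * opnorm (coc b w - coc b' w)).
    by apply: measurable_funM => //; exact: measurable_cst.
  apply: EPZ_le.
  - exact: sqr_ge0.
  - by apply: measurable_funD => //; exact: measurable_cst.
  - by move=> w; rewrite addr_ge0.
  - apply: (EPD_le (measurable_cst _) mz (fun=> ler01) z); first by rewrite EP_cst.
    by apply: EPZ_le => // w; exact: opnorm_ge0.
have hK c : GL_moment c s M ->
    EPle P (fun w => gl_size (iter_prod c N w) `^ s) (M ^+ N).
  by move=> hc; apply: iter_moment => //; move: al0 als; lra.
have c2 : 0 <= eta / 2 by rewrite divr_ge0// ltW.
have c3 : 0 <= (2 * eta)^-1 by rewrite invr_ge0 mulr_ge0// ltW.
have zK (c : T -> 'M[R]_m) w : 0 <= gl_size (iter_prod c N w) `^ s by exact: powR_ge0.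
have zD w : 0 <= opnorm (iter_prod b N w - iter_prod b' N w) `^ (2 * alpha) by exact: powR_ge0.
have mK c : GL_moment c s M -> measurable_fun setT (fun w => gl_size (iter_prod c N w) `^ s).
  exact: measurable_iter_size.
have mD : measurable_fun setT
    (fun w => opnorm (iter_prod b N w - iter_prod b' N w) `^ (2 * alpha)).
  exact: measurable_iter_dist.
have H1 := EPD_le (mK _ hb) (mK _ hb') (zK b) (zK b') (hK _ hb) (hK _ hb').
have mKK : measurable_fun setT
    (fun w => gl_size (iter_prod b N w) `^ s + gl_size (iter_prod b' N w) `^ s).
  by apply: measurable_funD; exact: mK.
have zKK w : 0 <= gl_size (iter_prod b N w) `^ s + gl_size (iter_prod b' N w) `^ s.
  exact: addr_ge0.
have H2 := EPZ_le c2 mKK zKK H1.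
have H3 := EPZ_le c3 mD zD hD.
have mcK : measurable_fun setT (fun w => eta / 2 *
    (gl_size (iter_prod b N w) `^ s + gl_size (iter_prod b' N w) `^ s)).
  by apply: measurable_funM => //; exact: measurable_cst.
have mcD : measurable_fun setT (fun w => (2 * eta)^-1 *
    opnorm (iter_prod b N w - iter_prod b' N w) `^ (2 * alpha)).
  by apply: measurable_funM => //; exact: measurable_cst.
have H4 := EPD_le mcK mcD (fun w => mulr_ge0 c2 (zKK w)) (fun w => mulr_ge0 c3 (zD w)) H2 H3.
apply: le_trans (le_trans H4 _).
  apply: EP_le => w; first exact: powR_ge0.
  rewrite /perturb_err.
  set K := gl_size _ + gl_size _; set D := opnorm _.
  have K0 : 0 <= K by rewrite addr_ge0 ?gl_size_ge0.
  have K1 : 1 <= K.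
    by rewrite (le_trans (gl_size_ge1 m0 (GL_moment_iter_unit N w hb)))// lerDl gl_size_ge0.
  have D0 : 0 <= D by exact: opnorm_ge0.
  rewrite (powRM _ (exprn_ge0 7 K0) D0).
  rewrite (le_trans (AMGM_weighted _ _ eta0))//.
  have -> : (K ^+ 7) `^ alpha = K `^ (7 * alpha) by rewrite -powR_mulrn// -powRrM.
  rewrite -!powR_mulrn ?powR_ge0// -!powRrM.
  have k14 : K `^ (7 * alpha * 2) <= gl_size (iter_prod b N w) `^ s + gl_size (iter_prod b' N w) `^ s.
    rewrite (le_trans (_ : _ <= K `^ s))//; first by apply: ler_powR => //; move: al0 als; lra.
    apply: powR_subadd; rewrite ?gl_size_ge0//; move: al0 als s1; lra.
  rewrite (mulrC alpha).
  have -> : (eta * K `^ (7 * alpha * 2) + D `^ (2 * alpha) / eta) / 2 =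
    eta / 2 * K `^ (7 * alpha * 2) + (2 * eta)^-1 * D `^ (2 * alpha).
    by rewrite invfM; ring.
  by rewrite lerD2r ler_wpM2l.
rewrite lee_fin /perturb_const le_eqVlt; apply/orP; left; apply/eqP.
by field; rewrite gt_eqF.
Qed.

Lemma perturb_err_ge b b' w : GL_moment b s M -> GL_moment b' s M ->
  ((gl_size (iter_prod b N w) + gl_size (iter_prod b' N w)) *
    opnorm (iter_prod b N w - iter_prod b' N w)) `^ alpha <= perturb_err b b' w.
Proof.
move=> hb hb'; apply: powR_le; first exact: ltW.
  by rewrite mulr_ge0 ?addr_ge0 ?gl_size_ge0 ?opnorm_ge0.
rewrite ler_wpM2r ?opnorm_ge0// ler_eXnr//.
by rewrite (le_trans (gl_size_ge1 m0 (GL_moment_iter_unit N w hb)))// lerDl gl_size_ge0.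
Qed.

(** Uniformity in a deterministic [x] is enough for iteration, since the next block is independent
    of the direction that enters it. *)
Definition contracting b theta : Prop :=
  forall x, x != 0 -> EPle P (fun w => pcontr (iter_prod b N w) x `^ alpha) theta.

Lemma contracting_perturb b b' theta e : GL_moment b s M -> GL_moment b' s M -> 0 < e ->
  EPle P (fun w => opnorm (coc b w - coc b' w)) e ->
  contracting b theta ->
  contracting b' (theta + pcontr_const (R := R) m `^ alpha * (perturb_const * e `^ alpha)).
Proof.
move=> hb hb' e0 be hth x x0.
have Hp := perturb_moment hb hb' e0 be.
have mg : measurable_fun setT (fun w => pcontr (iter_prod b N w) x `^ alpha).
  have [ub mb _] := hb.
  by apply: measurable_powRf; apply: measurable_pcontr; exact: iter_prod_measurable.
have me := measurable_perturb_err hb hb'.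
have H1 := EPZ_le (powR_ge0 (pcontr_const (R := R) m) alpha) me (perturb_err_ge0 b b') Hp.
have me' : measurable_fun setT (fun w => pcontr_const (R := R) m `^ alpha * perturb_err b b' w).
  by apply: measurable_funM => //; exact: measurable_cst.
apply: le_trans (EPD_le mg me' (fun w => powR_ge0 _ _)
  (fun w => mulr_ge0 (powR_ge0 _ _) (perturb_err_ge0 b b' w)) (hth x x0) H1).
apply: EP_le => w; first exact: powR_ge0.
rewrite /perturb_err; set K := gl_size _ + gl_size _; set D := opnorm (_ - _).
have ua := GL_moment_iter_unit N w hb; have ub := GL_moment_iter_unit N w hb'.
have K1 : 1 <= K by rewrite (le_trans (gl_size_ge1 m0 ua))// lerDl gl_size_ge0.
have K0 : 0 <= K by exact: le_trans ler01 K1.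
have c0 : 0 <= pcontr_const (R := R) m.
  by rewrite /pcontr_const mulr_ge0 ?ler0n.
have KD : 0 <= K ^+ 7 * D by rewrite mulr_ge0 ?opnorm_ge0 ?exprn_ge0.
have Ka : gl_size (iter_prod b N w) <= K by rewrite lerDl gl_size_ge0.
have Kb : gl_size (iter_prod b' N w) <= K by rewrite lerDr gl_size_ge0.
have al1 : alpha <= 1 by move: al0 als s1; lra.
rewrite -(powRM _ c0 KD) (le_trans _ (powR_subadd al0 al1 (pcontr_ge0 _ _) (mulr_ge0 c0 KD)))//.
apply: powR_le; [exact: ltW|exact: pcontr_ge0|].
exact: pcontr_perturb.
Qed.

Context (theta : R) (th0 : 0 <= theta) (th1 : theta < 1).

Lemma contracting_pdist b x y : GL_moment b s M -> contracting b theta -> x != 0 -> y != 0 ->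
  EPle P (fun w => pdist (iter_prod b N w *m x) (iter_prod b N w *m y) `^ alpha)
     (theta * pdist x y `^ alpha).
Proof.
move=> hb hc x0 y0; have [ub mb _] := hb.
have mg z : measurable_fun setT (fun w => pcontr (iter_prod b N w) z `^ alpha).
  by apply: measurable_powRf; apply: measurable_pcontr; exact: iter_prod_measurable.
have z w (u : 'cV[R]_m) := powR_ge0 (pcontr (iter_prod b N w) u) alpha.
have H1 := EPD_le (mg x) (mg y) (fun w => z w x) (fun w => z w y) (hc x x0) (hc y y0).
have c0 : 0 <= pdist x y `^ alpha / 2 by rewrite divr_ge0 ?powR_ge0.
have mgg : measurable_fun setT (fun w => pcontr (iter_prod b N w) x `^ alpha +
    pcontr (iter_prod b N w) y `^ alpha) by exact: measurable_funD.
have H2 := EPZ_le c0 mgg (fun w => addr_ge0 (z w x) (z w y)) H1.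
apply: le_trans (le_trans H2 _).
  apply: EP_le => w; first exact: powR_ge0.
  apply: le_trans (pdist_mulmx (GL_moment_iter_unit N w hb) x0 y0 al0) _.
  have E (a c : R) : a / 2 * c = c / 2 * a by ring.
  by rewrite E.
by rewrite lee_fin le_eqVlt; apply/orP; left; apply/eqP; field.
Qed.

(** The sum of a geometric series: one block costs [alpha^-1 * 2 * M^N] and [pdist^alpha] shrinks on
    average by [theta]. Equivalently, it solves [G = cost + theta * G], which closes the induction
    over blocks. *)
Definition growth_const : R := alpha^-1 * 2 * M ^+ N / (1 - theta).

Lemma growth_const_ge0 : 0 <= growth_const.
Proof.
apply: divr_ge0; last by rewrite subr_ge0 ltW.
apply: mulr_ge0; first by rewrite mulr_ge0// invr_ge0 ltW.
by apply: exprn_ge0; exact: le_trans ler01 M1.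
Qed.

Lemma measurable_iter_growth b n (G : seqspace T -> 'cV[R]_m) : mx_measurable b ->
  mx_measurable G -> measurable_fun setT (fun w => growth (iter_prod b n w) (G w)).
Proof. by move=> mb mG; apply: measurable_growthv => //; exact: iter_prod_measurable. Qed.

Lemma growth_holder_block b x y : GL_moment b s M -> x != 0 -> y != 0 ->
  EPle P (fun w => `|growth (iter_prod b N w) x - growth (iter_prod b N w) y|)
     (alpha^-1 * 2 * M ^+ N * pdist x y `^ alpha).
Proof.
move=> hb x0 y0.
have al1 : alpha <= 1 by move: al0 als s1; lra.
have al2 : 0 < 2 * alpha by rewrite mulr_gt0.
have al2s : 2 * alpha <= s by move: al0 als s1; lra.
have c0 : 0 <= alpha^-1 * 2 * pdist x y `^ alpha.
  by rewrite mulr_ge0 ?powR_ge0// mulr_ge0// invr_ge0 ltW.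
have H := EPZ_le c0 (measurable_iter_size N (2 * alpha) hb) (fun w => powR_ge0 _ _)
  (iter_moment N al2 al2s hb).
rewrite mulrAC; apply: le_trans H; apply: EP_le => w //.
rewrite (le_trans (growth_holder (GL_moment_iter_unit N w hb) x0 y0 al0 al1))//.
have K0 := gl_size_ge0 (iter_prod b N w).
rewrite (powRM _ (mulr_ge0 (ler0n _ 2) (sqr_ge0 _)) (pdist_ge0 x y)).
rewrite (powRM _ (ler0n _ 2) (sqr_ge0 _)).
have -> : (gl_size (iter_prod b N w) ^+ 2) `^ alpha = gl_size (iter_prod b N w) `^ (2 * alpha).
  by rewrite -powR_mulrn// -powRrM.
have h2 : 2 `^ alpha <= 2 :> R by apply: ler1_powR => //; rewrite ler1n.
have -> : alpha^-1 * (2 `^ alpha * gl_size (iter_prod b N w) `^ (2 * alpha) * pdist x y `^ alpha) =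
  2 `^ alpha * (alpha^-1 * gl_size (iter_prod b N w) `^ (2 * alpha) * pdist x y `^ alpha) by ring.
rewrite (le_trans (ler_wpM2r _ h2))//.
  by rewrite mulr_ge0 ?powR_ge0// mulr_ge0 ?powR_ge0// invr_ge0 ltW.
by rewrite le_eqVlt; apply/orP; left; apply/eqP; ring.
Qed.

Lemma growth_holder_iter b : GL_moment b s M -> contracting b theta ->
  forall j x y, x != 0 -> y != 0 ->
  EPle P (fun w => `|growth (iter_prod b (j * N) w) x - growth (iter_prod b (j * N) w) y|)
     (growth_const * pdist x y `^ alpha).
Proof.
move=> hb hc; have [ub mb _] := hb.
have cg0 := growth_const_ge0.
elim=> [|j IHj] x y x0 y0.
  rewrite -(EP_cst P (growth_const * _)); apply: EP_le => w //.
  by rewrite /iter_prod /= !growth1 subrr normr0 mulr_ge0 ?powR_ge0.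
rewrite mulSn addnC.
pose f1 w := `|growth (iter_prod b N w) x - growth (iter_prod b N w) y|.
pose g w := pdist (iter_prod b N w *m x) (iter_prod b N w *m y) `^ alpha.
have mi z : mx_measurable (fun w => iter_prod b N w *m z).
  by apply: mx_measurableM; [exact: iter_prod_measurable|exact: mx_measurable_cst].
have mgr n z : measurable_fun setT (fun w => growth (iter_prod b n w) z).
  by apply: measurable_iter_growth => //; exact: mx_measurable_cst.
have mgrd n z z' : measurable_fun setT
    (fun w => `|growth (iter_prod b n w) z - growth (iter_prod b n w) z'|).
  by apply: measurable_normf; apply: measurable_funB; exact: mgr.
have mf1 : measurable_fun setT f1 by exact: mgrd.
have mg : measurable_fun setT g by apply: measurable_powRf; exact: measurable_pdist.
have H1 := growth_holder_block hb x0 y0.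
have H2 := EPZ_le cg0 mg (fun w => powR_ge0 _ _) (contracting_pdist hb hc x0 y0).
have mcg : measurable_fun setT (fun w => growth_const * g w).
  by apply: measurable_funM => //; exact: measurable_cst.
have zg w : 0 <= growth_const * g w by rewrite mulr_ge0 ?powR_ge0.
have zf w : 0 <= f1 w by exact: normr_ge0.
have H3 := EPD_le mf1 mcg zf zg H1 H2.
have mF : measurable_fun setT (fun w => f1 w + growth_const * g w) by exact: measurable_funD.
have H4 := EP_splice_le hP (k := N) (mgrd (j * N + N)%N x y) (fun w => normr_ge0 _) mF
  (fun w => addr_ge0 (zf w) (zg w)) ler01 _ H3.
apply: le_trans (H4 _) _; last first.
  rewrite lee_fin mul1r /growth_const le_eqVlt; apply/orP; left; apply/eqP.
  by field; rewrite subr_eq0 !gt_eqF.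
move=> u; rewrite mul1r.
have ux := GL_moment_iter_unit N u hb.
have x0' : iter_prod b N u *m x != 0 by rewrite mulmx_unit_eq0.
have y0' : iter_prod b N u *m y != 0 by rewrite mulmx_unit_eq0.
have IH := IHj _ _ x0' y0'.
apply: le_trans (EPD_le (measurable_cst _) (mgrd (j * N)%N _ _) (fun=> zf u)
  (fun w => normr_ge0 _) _ IH); last by rewrite EP_cst.
apply: EP_le => v //.
rewrite iter_prodD_splice !growthM ?(GL_moment_iter_unit _ _ hb)//.
have E (a c a' c' : R) : a + c - (a' + c') = (c - c') + (a - a') by ring.
by rewrite E; exact: ler_normD.
Qed.

Lemma growth_perturb_err b b' x w : GL_moment b s M -> GL_moment b' s M -> x != 0 ->
  `|growth (iter_prod b' N w) x - growth (iter_prod b N w) x| <= alpha^-1 * perturb_err b b' w.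
Proof.
move=> hb hb' x0; have al1 : alpha <= 1 by move: al0 als s1; lra.
have ub := GL_moment_iter_unit N w hb; have ub' := GL_moment_iter_unit N w hb'.
set K := gl_size (iter_prod b N w) + gl_size (iter_prod b' N w).
have Ka : gl_size (iter_prod b N w) <= K by rewrite lerDl gl_size_ge0.
have Kb : gl_size (iter_prod b' N w) <= K by rewrite lerDr gl_size_ge0.
apply: le_trans (growth_perturb ub' ub x0 al0 al1 Kb Ka) _.
have ai0 : 0 <= alpha^-1 by rewrite invr_ge0 ltW.
apply: (ler_wpM2l ai0); rewrite opnorm_distC.
exact: perturb_err_ge.
Qed.

Lemma pdist_perturb_err b b' x w : GL_moment b s M -> GL_moment b' s M -> x != 0 ->
  pdist (iter_prod b' N w *m x) (iter_prod b N w *m x) `^ alpha <= perturb_err b b' w.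
Proof.
move=> hb hb' x0.
have ub := GL_moment_iter_unit N w hb; have ub' := GL_moment_iter_unit N w hb'.
set K := gl_size (iter_prod b N w) + gl_size (iter_prod b' N w).
have Kb : gl_size (iter_prod b' N w) <= K by rewrite lerDr gl_size_ge0.
apply: le_trans (perturb_err_ge w hb hb').
apply: powR_le; [exact: ltW|exact: pdist_ge0|].
by apply: le_trans (pdist_perturb ub' ub x0 Kb) _; rewrite opnorm_distC.
Qed.

Definition growth_diff_const : R := (alpha^-1 + growth_const) * perturb_const.

(** Peel off the first block. It causes a direct error in [growth]; afterwards the induction
    hypothesis compares [b'] and [b] at the common direction [x1'], and the Hoelder estimate for [b]
    moves [x1'] to [x1]. The cost per block thus does not depend on the number of blocks. *)
Lemma growth_diff_iter b b' e : GL_moment b s M -> GL_moment b' s M -> 0 < e ->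
  EPle P (fun w => opnorm (coc b w - coc b' w)) e -> contracting b theta ->
  forall j x, x != 0 ->
  EPle P (fun w => `|growth (iter_prod b' (j * N) w) x - growth (iter_prod b (j * N) w) x|)
    (j%:R * growth_diff_const * e `^ alpha).
Proof.
move=> hb hb' e0 be hc; have [ub mb _] := hb; have [ub' mb' _] := hb'.
have cg0 := growth_const_ge0.
have ai0 : 0 <= alpha^-1 by rewrite invr_ge0 ltW.
have mgr (c : T -> 'M[R]_m) n z : mx_measurable c -> measurable_fun setT (fun w => growth (iter_prod c n w) z).
  by move=> mc; apply: measurable_iter_growth => //; exact: mx_measurable_cst.
have Hp := perturb_moment hb hb' e0 be.
have me := measurable_perturb_err hb hb'.
have c0 : 0 <= alpha^-1 + growth_const by exact: addr_ge0.
elim=> [|j IHj] x x0.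
  rewrite !mul0r -(EP_cst P 0); apply: EP_le => w //.
  by rewrite mul0n /iter_prod /= !growth1 subrr normr0.
rewrite mulSn addnC.
set c := j%:R * growth_diff_const * e `^ alpha in IHj.
have cc : 0 <= c.
  rewrite /c; apply: mulr_ge0; last exact: powR_ge0.
  by apply: mulr_ge0 => //; apply: mulr_ge0 => //; exact: perturb_const_ge0.
have H1 := EPZ_le c0 me (perturb_err_ge0 b b') Hp.
have mce : measurable_fun setT (fun w => (alpha^-1 + growth_const) * perturb_err b b' w).
  by apply: measurable_funM => //; exact: measurable_cst.
have zce w : 0 <= (alpha^-1 + growth_const) * perturb_err b b' w.
  by apply: mulr_ge0 => //; exact: perturb_err_ge0.
have hcc : EPle P (fun=> c) c by rewrite EP_cst.
have H2 := EPD_le (measurable_cst c) mce (fun=> cc) zce hcc H1.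
have mg : measurable_fun setT
    (fun w => c + (alpha^-1 + growth_const) * perturb_err b b' w).
  by apply: measurable_funD => //; exact: measurable_cst.
have mL : measurable_fun setT (fun w =>
    `|growth (iter_prod b' (j * N + N) w) x - growth (iter_prod b (j * N + N) w) x|).
  by apply: measurable_normf; apply: measurable_funB; exact: mgr.
have H3 := EP_splice_le hP (k := N) mL (fun w => normr_ge0 _) mg
  (fun w => addr_ge0 cc (zce w)) ler01 _ H2.
apply: le_trans (H3 _) _; last first.
  rewrite lee_fin mul1r /c /growth_diff_const -natr1.
  by rewrite le_eqVlt; apply/orP; left; apply/eqP; ring.
move=> u; rewrite mul1r.
have uu := GL_moment_iter_unit N u hb; have uu' := GL_moment_iter_unit N u hb'.
set x1 := iter_prod b N u *m x; set x1' := iter_prod b' N u *m x.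
have x10 : x1 != 0 by rewrite mulmx_unit_eq0.
have x10' : x1' != 0 by rewrite mulmx_unit_eq0.
have I1 := IHj _ x10'.
have I2 := growth_holder_iter hb hc j x10' x10.
have m1 : measurable_fun setT (fun w =>
    `|growth (iter_prod b' (j * N) w) x1' - growth (iter_prod b (j * N) w) x1'|).
  by apply: measurable_normf; apply: measurable_funB; exact: mgr.
have m2 : measurable_fun setT (fun w =>
    `|growth (iter_prod b (j * N) w) x1' - growth (iter_prod b (j * N) w) x1|).
  by apply: measurable_normf; apply: measurable_funB; exact: mgr.
have I3 := EPD_le m1 m2 (fun w => normr_ge0 _) (fun w => normr_ge0 _) I1 I2.
set q := `|growth (iter_prod b' N u) x - growth (iter_prod b N u) x|.
have q0 : 0 <= q by exact: normr_ge0.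
have hq : EPle P (fun=> q) q by rewrite EP_cst.
have I4 := EPD_le (measurable_cst q) (measurable_funD m1 m2) (fun=> q0)
  (fun w => addr_ge0 (normr_ge0 _) (normr_ge0 _)) hq I3.
apply: le_trans (le_trans I4 _).
  apply: EP_le => v //.
  rewrite !iter_prodD_splice !growthM ?(GL_moment_iter_unit _ _ hb)//
    ?(GL_moment_iter_unit _ _ hb')//.
  rewrite -/x1 -/x1' /q.
  have E (a1 a2 a3 a4 a5 : R) : a1 + a2 - (a3 + a4) = (a2 - a4) + ((a1 - a5) + (a5 - a3)) by ring.
  rewrite (E _ _ _ _ (growth (iter_prod b (j * N) v) x1')) (le_trans (ler_normD _ _))// lerD2l.
  exact: ler_normD.
rewrite lee_fin.
have E5 (a1 a2 a3 a4 : R) : a2 + (a3 + a4) <= a3 + (a2 + a4) by rewrite addrCA.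
rewrite (le_trans (E5 0 _ _ _))// lerD2l mulrDl lerD//.
  exact: growth_perturb_err.
by rewrite ler_wpM2l// pdist_perturb_err.
Qed.

Lemma opnorm_le_delta (A : 'M[R]_m) : opnorm A <= \sum_i enorm (A *m (delta_mx i ord0 : 'cV_m)).
Proof.
apply: opnorm_le => [|x]; first by apply: sumr_ge0 => i _; exact: enorm_ge0.
rewrite {1}(col_sum_delta x) mulmx_sumr (le_trans (enorm_sum _ _ _))// mulr_suml.
apply: ler_sum => i _; rewrite -scalemxAr enormZ mulrC.
by rewrite ler_wpM2l ?enorm_ge0// ler_enorm_entry.
Qed.

Let e0 : 'cV[R]_m := delta_mx (Ordinal m0) ord0.

Lemma delta_neq0 (i : 'I_m) : (delta_mx i ord0 : 'cV[R]_m) != 0.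
Proof. by rewrite -enorm_gt0 enorm_delta. Qed.

Lemma growth_le_ln_opnorm (A : 'M[R]_m) x : A \in unitmx -> x != 0 ->
  growth A x <= ln (opnorm A).
Proof.
move=> uA x0; rewrite growthE// lerBlDr -lnM ?posrE ?opnorm_gt0 ?enorm_gt0//.
rewrite ler_ln ?posrE ?mulr_gt0 ?opnorm_gt0 ?enorm_mulmx_gt0 ?enorm_gt0//.
exact: ler_opnorm.
Qed.

(** The growth of a vector never exceeds the logarithm of the norm; conversely the norm is at most
    the sum of the images of the basis vectors. As [growth_holder_iter] compares basis vectors
    uniformly in time, a single vector detects the exponent up to a bounded error. *)
Lemma ln_opnorm_growth (A : 'M[R]_m) : A \in unitmx ->
  `|ln (opnorm A) - growth A e0| <=
  ln m%:R + \sum_i `|growth A (delta_mx i ord0) - growth A e0|.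
Proof.
move=> uA; rewrite ger0_norm ?subr_ge0 ?growth_le_ln_opnorm ?delta_neq0//.
set S := \sum_i _.
have HS i : enorm (A *m (delta_mx i ord0 : 'cV_m)) <= expR (growth A e0 + S).
  rewrite -[leLHS]lnK ?posrE ?enorm_mulmx_gt0 ?delta_neq0// ler_expR.
  rewrite -[leLHS]growth_unit ?enorm_delta// -lerBlDl.
  rewrite (le_trans (ler_norm _))// /S (bigD1 i)//= lerDl.
  by apply: sumr_ge0.
have mp : 0 < m%:R :> R by rewrite ltr0n.
have H : opnorm A <= m%:R * expR (growth A e0 + S).
  rewrite (le_trans (opnorm_le_delta A))//.
  apply: (@le_trans _ _ (\sum_(i < m) expR (growth A e0 + S))).
    by apply: ler_sum => i _; exact: HS.
  by rewrite sumr_const card_ord [leRHS]mulr_natl.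
rewrite lerBlDl addrCA -(expRK (growth A e0 + S)) -lnM ?posrE ?expR_gt0//.
by rewrite ler_ln ?posrE ?opnorm_gt0// mulr_gt0// expR_gt0.
Qed.

Definition opnorm_const : R := ln m%:R + m%:R * growth_const.

Lemma EP_sum_le (I : finType) (f : I -> seqspace T -> R) (a : R) :
  (forall i, measurable_fun setT (f i)) -> (forall i w, 0 <= f i w) ->
  (forall i, EPle P (f i) a) -> EPle P (fun w => \sum_i f i w) (#|I|%:R * a).
Proof.
move=> mf f0 fa.
have H (l : seq I) : EPle P (fun w => \sum_(i <- l) f i w) ((size l)%:R * a).
  elim: l => [|i l IHl].
    by rewrite mul0r -(EP_cst P 0); apply: EP_le => w; rewrite big_nil.
  rewrite [X in EP P X](_ : _ = fun w => f i w + \sum_(j <- l) f j w); last first.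
    by apply/funext => w; rewrite big_cons.
  rewrite /= -natr1 mulrDl mul1r addrC.
  by apply: EPD_le => // [|w]; [exact: measurable_sum|exact: sumr_ge0].
rewrite cardE [X in EP P X](_ : _ = fun w => \sum_(i <- enum I) f i w)//.
by apply/funext => w; rewrite big_enum.
Qed.

Lemma ln_opnorm_growth_iter b j : GL_moment b s M -> contracting b theta ->
  EPle P (fun w => `|ln (opnorm (iter_prod b (j * N) w)) - growth (iter_prod b (j * N) w) e0|)
    opnorm_const.
Proof.
move=> hb hc; have [ub mb _] := hb.
have mgr n z : measurable_fun setT (fun w => growth (iter_prod b n w) z).
  by apply: measurable_iter_growth => //; exact: mx_measurable_cst.
have mg (i : 'I_m) : measurable_fun setT (fun w =>
    `|growth (iter_prod b (j * N) w) (delta_mx i ord0) - growth (iter_prod b (j * N) w) e0|).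
  by apply: measurable_normf; apply: measurable_funB; exact: mgr.
have lnm : 0 <= ln m%:R :> R by apply: ln_ge0; rewrite ler1n.
have H (i : 'I_m) : EPle P (fun w =>
    `|growth (iter_prod b (j * N) w) (delta_mx i ord0) - growth (iter_prod b (j * N) w) e0|)
    growth_const.
  apply: le_trans (growth_holder_iter hb hc j (delta_neq0 i) (delta_neq0 _)) _.
  rewrite lee_fin ler_piMr ?growth_const_ge0//.
  have := powR_le (ltW al0) (pdist_ge0 (delta_mx i ord0 : 'cV[R]_m) e0) (pdist_le1 _ _).
  by rewrite powR1.
have H2 := EP_sum_le mg (fun i w => normr_ge0 _) H.
rewrite card_ord in H2.
have hl : EPle P (fun=> ln m%:R) (ln m%:R) by rewrite EP_cst.
have ms : measurable_fun setT (fun w => \sum_(i < m)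
    `|growth (iter_prod b (j * N) w) (delta_mx i ord0) - growth (iter_prod b (j * N) w) e0|).
  by apply: measurable_sum.
apply: le_trans (EPD_le (measurable_cst _) ms (fun=> lnm) (fun w => sumr_ge0 _ (fun i _ => normr_ge0 _)) hl H2).
apply: EP_le => w //; apply: ln_opnorm_growth.
exact: GL_moment_iter_unit hb.
Qed.

Lemma ln_opnorm_diff_iter b b' e j : GL_moment b s M -> GL_moment b' s M -> 0 < e ->
  EPle P (fun w => opnorm (coc b w - coc b' w)) e ->
  contracting b theta -> contracting b' theta ->
  EPle P (fun w => `|ln (opnorm (iter_prod b (j * N) w)) - ln (opnorm (iter_prod b' (j * N) w))|)
    (opnorm_const + opnorm_const + j%:R * growth_diff_const * e `^ alpha).
Proof.
move=> hb hb' ep be hc hc'; have [ub mb _] := hb; have [ub' mb' _] := hb'.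
have mgr (c : T -> 'M[R]_m) n z : mx_measurable c -> measurable_fun setT (fun w => growth (iter_prod c n w) z).
  by move=> mc; apply: measurable_iter_growth => //; exact: mx_measurable_cst.
have mln (c : T -> 'M[R]_m) n : mx_measurable c -> measurable_fun setT (fun w => ln (opnorm (iter_prod c n w))).
  by move=> mc; apply: measurable_lnf; apply: measurable_opnorm; exact: iter_prod_measurable.
have m1 (c : T -> 'M[R]_m) : mx_measurable c -> measurable_fun setT (fun w =>
    `|ln (opnorm (iter_prod c (j * N) w)) - growth (iter_prod c (j * N) w) e0|).
  by move=> mc; apply: measurable_normf; apply: measurable_funB; [exact: mln|exact: mgr].
have m2 : measurable_fun setT (fun w =>
    `|growth (iter_prod b' (j * N) w) e0 - growth (iter_prod b (j * N) w) e0|).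
  by apply: measurable_normf; apply: measurable_funB; exact: mgr.
have z (a c : seqspace T -> R) w : 0 <= `|a w - c w| by exact: normr_ge0.
have H1 := EPD_le (m1 _ mb) (m1 _ mb') (fun w => normr_ge0 _) (fun w => normr_ge0 _)
  (ln_opnorm_growth_iter j hb hc) (ln_opnorm_growth_iter j hb' hc').
have H2 := EPD_le (measurable_funD (m1 _ mb) (m1 _ mb')) m2
  (fun w => addr_ge0 (normr_ge0 _) (normr_ge0 _)) (fun w => normr_ge0 _)
  H1 (growth_diff_iter hb hb' ep be hc j (delta_neq0 _)).
apply: le_trans H2; apply: EP_le => w //=.
set L := ln _; set L' := ln _; set G := growth _ _; set G' := growth _ _.
have -> : L - L' = (L - G) + (G' - L') + (G - G') by ring.
rewrite (le_trans (ler_normD _ _))// lerD//; last by rewrite distrC.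
by rewrite (le_trans (ler_normD _ _))// (distrC G').
Qed.

End contraction.

(** * Subadditivity and existence of the exponents *)

Section fekete.
Context {R : realType}.

(** Fekete's lemma: the limit is the infimum of [u n / n] over [n >= 1], finite by the linear lower
    bound. *)
Lemma fekete (u : nat -> R) (C C0 : R) :
  (forall n k, u (n + k)%N <= u n + u k) -> (forall n, - (C * n%:R + C0) <= u n) ->
  0 <= C0 ->
  exists2 l : R, (fun n => n%:R^-1 * u n) @ \oo --> l & forall n, (0 < n)%N -> l <= n%:R^-1 * u n.
Proof.
move=> usub ulb C00.
pose S := [set n.+1%:R^-1 * u n.+1 | n in [set: nat]].
have S0 : S !=set0 by exists (1%:R^-1 * u 1%N), 0%N.
have Slb : has_lbound S.
  exists (- (C + C0)) => _ [n _ <-].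
  rewrite ler_pdivlMl// (le_trans _ (ulb _))// mulrN lerN2 mulrDr lerD//.
    by rewrite mulrC.
  by rewrite ler_peMl// ler1n.
pose l := inf S.
have lle n : (0 < n)%N -> l <= n%:R^-1 * u n.
  by case: n => // n _; apply: ge_inf => //; exists n.
exists l => //.
apply/cvgrPdist_le => e e0.
have [_ [N _ <-] HN] := @inf_adherent _ S (e / 2) (divr_gt0 e0 (ltr0n _ 2)) (conj S0 Slb).
set N1 := N.+1 in HN.
(* [B] bounds [u] at all remainders of division by [N1]; after division by [n] it disappears in the
   limit. *)
pose B := \sum_(i < N1) `|u i|.
have HB r : (r < N1)%N -> u r <= B.
  move=> rN; rewrite (le_trans (ler_norm _))// /B (bigD1 (Ordinal rN))//= lerDl.
  by apply: sumr_ge0.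
have B0 : 0 <= B by apply: sumr_ge0.
have Hq q r : u (q * N1 + r)%N <= q%:R * u N1 + u r.
  elim: q => [|q IHq]; first by rewrite mul0r add0r add0n.
  rewrite mulSn -addnA (le_trans (usub _ _))// -natr1 mulrDl mul1r (addrC (_ * _)) -addrA.
  by rewrite lerD2l.
near=> n.
have n0 : (0 < n)%N by near: n; exists 1%N.
have npos : 0 < n%:R :> R by rewrite ltr0n.
rewrite distrC ger0_norm ?subr_ge0 ?lle// lerBlDl.
have N1pos : 0 < N1%:R :> R by rewrite ltr0n.
have E := divn_eq n N1.
have rlt : (n %% N1 < N1)%N by rewrite ltn_mod.
have := Hq (n %/ N1)%N (n %% N1)%N; rewrite -E => H1.
have H2 := HB _ rlt.
have Hn : (B + `|u N1|) <= e / 2 * n%:R.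
  rewrite -ler_pdivrMl ?divr_gt0//.
  by near: n; exact: nbhs_infty_ger.
rewrite ler_pdivrMl// mulrC.
have q_eq : (n %/ N1)%:R * N1%:R = n%:R - (n %% N1)%:R :> R.
  by rewrite -natrM {2}E natrD addrK.
have H3 : (n %/ N1)%:R * u N1 <= n%:R * (N1%:R^-1 * u N1) + `|u N1|.
  have -> : (n %/ N1)%:R * u N1 = ((n %/ N1)%:R * N1%:R) * (N1%:R^-1 * u N1).
    by rewrite -mulrA (mulrA N1%:R) mulfV ?gt_eqF// mul1r.
  rewrite q_eq mulrBl lerD2l [X in - X]mulrA.
  have a0 : 0 <= (n %% N1)%:R * N1%:R^-1 :> R by rewrite mulr_ge0// invr_ge0.
  have a1 : (n %% N1)%:R * N1%:R^-1 <= 1 :> R.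
    by rewrite ler_pdivrMr// mul1r ler_nat ltnW.
  rewrite (le_trans (ler_norm _))// normrN normrM (ger0_norm a0).
  by rewrite ler_piMl.
have H4 : n%:R * (N1%:R^-1 * u N1) <= n%:R * (l + e / 2) by rewrite ler_wpM2l// ltW.
rewrite (le_trans H1)//; lra.
Unshelve. all: by end_near.
Qed.

End fekete.

Section exponents.
Context {R : realType} d (T : measurableType d).
Context (p : probability T R) (P : probability (seqspace T) R) (hP : is_bernoulli p P).
Context (m : nat) (m0 : (0 < m)%N).
Implicit Types (b : T -> 'M[R]_m).

Lemma ln_submul (a c e : R) : 0 < a -> 0 < c -> 0 < e -> e <= a * c -> ln e <= ln a + ln c.
Proof.
by move=> a0 c0 e0 H; rewrite -lnM ?posrE// ler_ln ?posrE ?mulr_gt0.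
Qed.

(** Replacing [g] by the maximum of [f] and [g] changes it on a null set only and makes the
    inequality hold everywhere. *)
Lemma le_Rintegral_ae d' (X : measurableType d') (Q : probability X R) (f g : X -> R) :
  Q.-integrable setT (EFin \o f) -> Q.-integrable setT (EFin \o g) ->
  {ae Q, forall w, f w <= g w} -> \int[Q]_w f w <= \int[Q]_w g w.
Proof.
move=> fi gi fg; pose h w := Num.max (f w) (g w).
have mf : measurable_fun setT f by have /measurable_EFinP := measurable_int _ fi.
have mg : measurable_fun setT g by have /measurable_EFinP := measurable_int _ gi.
have mh : measurable_fun setT h by exact: measurable_maxr.
have hg : (\int[Q]_w (h w)%:E = \int[Q]_w (g w)%:E)%E.
  apply: ae_eq_integral => //; [exact/measurable_EFinP|exact/measurable_EFinP|].
  apply: filterS fg => w fgw _ /=; rewrite /h; congr (_%:E).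
  exact: max_r.
have hi : Q.-integrable setT (EFin \o h).
  apply: (le_integrable measurableT _ _ (integrableD measurableT (integrable_abse fi) (integrable_abse gi))).
    exact/measurable_EFinP.
  move=> w _ /=; rewrite lee_fin /h.
  rewrite [leRHS]ger0_norm ?addr_ge0//.
  by case: (leP (f w) (g w)) => _; rewrite ?lerDl ?lerDr.
rewrite /Rintegral -hg.
apply: (@le_Rintegral _ _ _ Q setT f h) => //.
by move=> w _; rewrite /h le_max lexx.
Qed.

Lemma Rintegral_shift k (f : seqspace T -> R) : measurable_fun setT f ->
  \int[P]_w f (seq_shift k w) = \int[P]_w f w.
Proof.
move=> mf; rewrite /Rintegral (integral_shift hP k (F := fun w => (f w)%:E))//.
exact/measurable_EFinP.
Qed.

Context (s M : R) (s0 : 0 < s) (M1 : 1 <= M).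

Lemma measurable_ln_size b n : GL_moment P b s M ->
  measurable_fun setT (fun w => ln (gl_size (iter_prod b n w))).
Proof.
move=> [ub mb _]; apply: measurable_lnf; apply: measurable_gl_size.
  by move=> w; exact: iter_prod_unit.
exact: iter_prod_measurable.
Qed.

Lemma ln_size_ge0 b n w : GL_moment P b s M -> 0 <= ln (gl_size (iter_prod b n w)).
Proof.
by move=> hb; apply: ln_ge0; apply: gl_size_ge1 => //; exact: (GL_moment_iter_unit _ _ hb).
Qed.

Lemma ln_le_powR (x : R) : 1 <= x -> ln x <= s^-1 * x `^ s.
Proof.
move=> x1; have x0 : 0 < x by exact: lt_le_trans x1.
rewrite ler_pdivlMl// -ln_powR; apply: ltW; apply: ln_sublinear.
exact: powR_gt0.
Qed.

Lemma EP_ln_size b n : GL_moment P b s M ->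
  EPle P (fun w => ln (gl_size (iter_prod b n w))) (n%:R * (s^-1 * M)).
Proof.
move=> hb; have [ub mb bM] := hb.
have mz n := measurable_ln_size n hb.
elim: n => [|n IHn].
  rewrite mul0r -(EP_cst P 0); apply: EP_le => w; first exact: (ln_size_ge0 _ _ hb).
  by rewrite /iter_prod /= gl_size1// ln1.
have h1 : EPle P (fun w => ln (gl_size (iter_prod b 1 w))) (s^-1 * M).
  have si0 : 0 <= s^-1 by rewrite invr_ge0 ltW.
  have mK : measurable_fun setT (fun w => gl_size (coc b w) `^ s).
    apply: measurable_powRf; apply: measurable_gl_size; first by move=> w; exact: ub.
    exact: coc_measurable.
  apply: le_trans (EPZ_le si0 mK (fun w => powR_ge0 _ _) bM).
  apply: EP_le => w; first exact: (ln_size_ge0 _ _ hb).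
  rewrite iter_prod1; apply: ln_le_powR.
  by apply: gl_size_ge1 => //; exact: ub.
have h2 : EPle P (fun w => ln (gl_size (iter_prod b n (seq_shift 1 w)))) (n%:R * (s^-1 * M)).
  by rewrite (EP_shift hP 1 (f := fun w : seqspace T => ln (gl_size (iter_prod b n w)))).
have ms : measurable_fun [set: seqspace T]
    (fun w : seqspace T => ln (gl_size (iter_prod b n (seq_shift 1 w)))).
  apply: (@measurableT_comp _ _ _ _ _ _ (fun w : seqspace T => ln (gl_size (iter_prod b n w)))) => //.
  exact: measurable_seq_shift.
rewrite -natr1 mulrDl mul1r.
apply: le_trans (EPD_le ms (mz 1%N) (fun w => ln_size_ge0 _ _ hb) (fun w => ln_size_ge0 _ _ hb) h2 h1).
apply: EP_le => w; first exact: (ln_size_ge0 _ _ hb).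
rewrite -addn1 iter_prodD.
have un := GL_moment_iter_unit n (seq_shift 1 w) hb.
have u1 := GL_moment_iter_unit 1%N w hb.
have un1 : iter_prod b n (seq_shift 1 w) *m iter_prod b 1 w \in unitmx by rewrite unitmx_mul un u1.
have p1 := lt_le_trans ltr01 (gl_size_ge1 m0 un).
have p2 := lt_le_trans ltr01 (gl_size_ge1 m0 u1).
have p3 := lt_le_trans ltr01 (gl_size_ge1 m0 un1).
by apply: (ln_submul p1 p2 p3); exact: gl_sizeM.
Qed.

(** Every logarithmic process below is dominated in this form. The lemma supplies its integrability
    and the linear bound on its mean that Fekete's lemma uses. *)
Lemma ln_size_dominated b n (f : seqspace T -> R) c0 c1 : GL_moment P b s M -> 0 <= c0 -> 0 <= c1 ->
  measurable_fun setT f ->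
  (forall w, `|f w| <= c0 + c1 * ln (gl_size (iter_prod b n w))) ->
  P.-integrable setT (EFin \o f) /\
  `|\int[P]_w f w| <= c0 + c1 * (s^-1 * M) * n%:R.
Proof.
move=> hb c00 c10 mf H.
have mz := measurable_ln_size n hb.
have z w : 0 <= c1 * ln (gl_size (iter_prod b n w)).
  by apply: mulr_ge0 => //; exact: (ln_size_ge0 _ _ hb).
have mcz : measurable_fun setT (fun w => c1 * ln (gl_size (iter_prod b n w))).
  by apply: measurable_funM => //; exact: measurable_cst.
have hc : EPle P (fun=> c0) c0 by rewrite EP_cst.
have HE : EPle P (fun w => `|f w|) (c0 + c1 * (n%:R * (s^-1 * M))).
  apply: le_trans (EPD_le (measurable_cst _) mcz (fun=> c00) z hc
    (EPZ_le c10 mz (fun w => ln_size_ge0 _ _ hb) (EP_ln_size n hb))).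
  by apply: EP_le => w; [exact: normr_ge0|exact: H].
have fi := EP_integrable mf HE; split => //.
rewrite (le_trans (le_normr_Rintegral measurableT fi))//.
have nfi : P.-integrable setT (EFin \o (fun w => `|f w|)).
  by have := integrable_norm fi.
rewrite -lee_fin -(EP_Rintegral nfi) (le_trans HE)//.
by rewrite lee_fin le_eqVlt; apply/orP; left; apply/eqP; ring.
Qed.

(** Subadditivity is asked almost everywhere because restricted norms satisfy it only where the
    subspace is actually preserved. *)
Lemma subadditive_process_cvg b (X : nat -> seqspace T -> R) c0 c1 : GL_moment P b s M ->
  0 <= c0 -> 0 <= c1 -> (forall n, measurable_fun setT (X n)) ->
  (forall n w, `|X n w| <= c0 + c1 * ln (gl_size (iter_prod b n w))) ->
  (forall n k, {ae P, forall w, X (n + k)%N w <= X n (seq_shift k w) + X k w}) ->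
  exists2 l : R, (fun n => n%:R^-1 * \int[P]_w X n w) @ \oo --> l &
     forall n, (0 < n)%N -> l <= n%:R^-1 * \int[P]_w X n w.
Proof.
move=> hb c00 c10 mX HX sub.
have Hd n := ln_size_dominated hb c00 c10 (mX n) (HX n).
have Xi n := (Hd n).1.
apply: (@fekete _ (fun n => \int[P]_w X n w) (c1 * (s^-1 * M)) c0) => //.
  move=> n k.
  have mXs : measurable_fun [set: seqspace T] (fun w : seqspace T => X n (seq_shift k w)).
    apply: (@measurableT_comp _ _ _ _ _ _ (X n)) => //; exact: measurable_seq_shift.
  have Xsi : P.-integrable setT (EFin \o (fun w => X n (seq_shift k w))).
    have [_ Xfin] := integrableP _ _ _ (Xi n).
    apply/integrableP; split; first exact/measurable_EFinP.
    rewrite (integral_shift hP k (F := fun w => `|(X n w)%:E|%E)) //.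
    by apply: measurableT_comp => //; exact/measurable_EFinP.
  rewrite -(Rintegral_shift k (mX n)) -(RintegralD measurableT)//.
  apply: le_Rintegral_ae => //.
  exact: (integrableD measurableT Xsi (Xi k)).
move=> n; have [_] := Hd n; rewrite ler_norml => /andP[+ _].
by rewrite addrC.
Qed.

Lemma ln_opnorm_le_size (A : 'M[R]_m) : A \in unitmx -> `|ln (opnorm A)| <= ln (gl_size A).
Proof.
move=> uA; have A0 := opnorm_gt0 m0 uA.
have K0 := lt_le_trans ltr01 (gl_size_ge1 m0 uA).
rewrite ler_norml; apply/andP; split; last by rewrite ler_ln ?posrE// opnorm_le_size.
rewrite -lnV ?posrE// ler_ln ?posrE ?invr_gt0// -div1r ler_pdivrMr//.
have := opnormM A (invmx A); rewrite mulmxV// opnorm1// => /le_trans; apply.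
by rewrite ler_wpM2l ?opnormV_le_size// ltW.
Qed.

Lemma lyapunov_cvg b : GL_moment P b s M ->
  (fun n => n%:R^-1 * \int[P]_w ln (opnorm (iter_prod b n w))) @ \oo --> lyapunov P (coc b) 1 /\
  forall n, (0 < n)%N -> lyapunov P (coc b) 1 <= n%:R^-1 * \int[P]_w ln (opnorm (iter_prod b n w)).
Proof.
move=> hb; have [ub mb _] := hb.
have [|||l lcvg lle] := @subadditive_process_cvg b (fun n w => ln (opnorm (iter_prod b n w))) 0 1 hb
    (lexx _) ler01.
- move=> n; apply: measurable_lnf; apply: measurable_opnorm.
  exact: iter_prod_measurable.
- move=> n w; rewrite add0r mul1r; apply: ln_opnorm_le_size.
  exact: (GL_moment_iter_unit _ _ hb).
- move=> n k; apply/aeW => w; rewrite iter_prodD.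
  have un := GL_moment_iter_unit n (seq_shift k w) hb.
  have uk := GL_moment_iter_unit k w hb.
  have p1 := opnorm_gt0 m0 un; have p2 := opnorm_gt0 m0 uk.
  apply: (ln_submul p1 p2); last exact: opnormM.
  by apply: opnorm_gt0 => //; rewrite unitmx_mul un uk.
have -> : lyapunov P (coc b) 1 = l; last by split.
rewrite /lyapunov lyapunov_sum0 subr0 /lyapunov_sum.
rewrite (_ : (fun n => _) = fun n => n%:R^-1 * \int[P]_w ln (opnorm (iter_prod b n w))).
  exact: cvg_lim lcvg.
apply/funext => n; congr (_ * _); apply: eq_Rintegral => w _.
by rewrite opnorm_exterior_power1.
Qed.

Lemma lyapunov_sum2_cvg b : (2 <= m)%N -> GL_moment P b s M ->
  (fun n => n%:R^-1 * \int[P]_w ln (opnorm (exterior_power 2 (iter_prod b n w)))) @ \oo -->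
    lyapunov_sum P (coc b) 2.
Proof.
move=> m2 hb; have [ub mb _] := hb.
have lnc : 0 <= ln (ext2_const R m).
  by apply: ln_ge0; rewrite ler1n !muln_gt0 card_incr_tuple2_gt0.
have [|||l lcvg lle] := @subadditive_process_cvg b
    (fun n w => ln (opnorm (exterior_power 2 (iter_prod b n w)))) (ln (ext2_const R m)) 2 hb
    lnc (ler0n _ 2).
- move=> n; apply: measurable_lnf; apply: measurable_opnorm.
  by apply: mx_measurable_exterior_power; exact: iter_prod_measurable.
- move=> n w; apply: ln_opnorm_exterior_power2_le => //.
  exact: (GL_moment_iter_unit _ _ hb).
- move=> n k; apply/aeW => w; rewrite iter_prodD.
  have un := GL_moment_iter_unit n (seq_shift k w) hb.
  have uk := GL_moment_iter_unit k w hb.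
  have unk : iter_prod b n (seq_shift k w) *m iter_prod b k w \in unitmx by rewrite unitmx_mul un uk.
  have p1 := opnorm_exterior_power2_gt0 m2 un; have p2 := opnorm_exterior_power2_gt0 m2 uk.
  have p3 := opnorm_exterior_power2_gt0 m2 unk.
  apply: (ln_submul p1 p2 p3); rewrite exterior_power2M.
  exact: opnormM.
suff -> : lyapunov_sum P (coc b) 2 = l by [].
exact: cvg_lim lcvg.
Qed.

End exponents.

(** * Slow vectors and invariant subspaces *)

Section zero_one.
Context {R : realType} d (T : measurableType d).
Context (p : probability T R) (P : probability (seqspace T) R) (hP : is_bernoulli p P).
Context (m : nat) (m0 : (0 < m)%N).
Context (b : T -> 'M[R]_m) (ub : forall t, b t \in unitmx) (mb : mx_measurable b) (c : R).
Implicit Types (x y : 'cV[R]_m) (W : {vspace 'cV[R]_m}) (w : seqspace T).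

(** Taking the constant among the natural numbers makes slowness a countable union of countable
    intersections, hence measurable. *)
Definition slow x w : Prop :=
  exists K : nat, forall n, enorm (iter_prod b n w *m x) <= K%:R * expR (n%:R * c).

Lemma slow0 w : slow 0 w.
Proof. by exists 0%N => n; rewrite mulmx0 enorm0 mul0r. Qed.

Lemma slowD x y w : slow x w -> slow y w -> slow (x + y) w.
Proof.
move=> [K HK] [L HL]; exists (K + L)%N => n.
by rewrite mulmxDr natrD mulrDl (le_trans (enormD _ _))// lerD.
Qed.

Lemma slowZ (a : R) x w : slow x w -> slow (a *: x) w.
Proof.
move=> [K HK].
exists (Num.truncn (`|a| * K%:R)).+1 => n.
rewrite -scalemxAr enormZ (le_trans (ler_wpM2l (normr_ge0 a) (HK n)))// mulrA.
by rewrite ler_wpM2r ?expR_ge0// ltW// truncnS_gt.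
Qed.

Lemma slow_sum (I : Type) (r : seq I) (F : I -> 'cV[R]_m) w :
  (forall i, slow (F i) w) -> slow (\sum_(i <- r) F i) w.
Proof.
move=> H; elim: r => [|i r IHr]; first by rewrite big_nil; exact: slow0.
by rewrite big_cons; exact: slowD.
Qed.

Lemma slow_shift k x w : slow x w <-> slow (iter_prod b k w *m x) (seq_shift k w).
Proof.
split=> -[K HK].
  exists (Num.truncn (K%:R * expR (k%:R * c))).+1 => n.
  rewrite mulmxA -iter_prodD (le_trans (HK _))//.
  rewrite natrD mulrDl expRD (mulrC (expR _)) mulrA ler_wpM2r ?expR_ge0//.
  by rewrite ltW// truncnS_gt.
(* Slowness is insensitive to finitely many steps: [B] absorbs the ratios at the first [k] times
   together with the constant valid from time [k] on. *)
pose B := \sum_(i < k) enorm (iter_prod b i w *m x) * expR (- (i%:R * c)) + K%:R * expR (- (k%:R * c)).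
have B0 (i : 'I_k) : 0 <= enorm (iter_prod b i w *m x) * expR (- (i%:R * c)).
  by rewrite mulr_ge0 ?enorm_ge0 ?expR_ge0.
exists (Num.truncn B).+1 => n.
apply: (@le_trans _ _ (B * expR (n%:R * c))); last first.
  by rewrite ler_wpM2r ?expR_ge0// ltW// truncnS_gt.
rewrite -ler_pdivrMr ?expR_gt0// -expRN.
have [nk|kn] := ltnP n k.
  rewrite /B (bigD1 (Ordinal nk))//= -addrA lerDl; apply: addr_ge0.
    by apply: sumr_ge0 => i _; exact: B0.
  by rewrite mulr_ge0 ?expR_ge0.
have := HK (n - k)%N; rewrite mulmxA -iter_prodD subnK// => H.
rewrite (le_trans (ler_wpM2r (expR_ge0 _) H))// -mulrA -expRD /B.
rewrite (_ : (n - k)%:R * c + - (n%:R * c) = - (k%:R * c)); last first.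
  by rewrite natrB//; ring.
by rewrite lerDr; apply: sumr_ge0 => i _; exact: B0.
Qed.

Definition slowset W : set (seqspace T) := [set w | forall x, x \in W -> slow x w].

Definition img (A : 'M[R]_m) W : {vspace 'cV[R]_m} := (linfun (mulmx A) @: W)%VS.

Lemma mem_img A W x : x \in W -> A *m x \in img A W.
Proof. by move=> xW; rewrite -[A *m x](lfunE (mulmx A)); exact: memv_img. Qed.

Lemma imgP A W y : y \in img A W -> exists2 x, x \in W & y = A *m x.
Proof. by move=> /memv_imgP[x xW ->]; exists x => //; rewrite lfunE. Qed.

Lemma dim_img A W : A \in unitmx -> \dim (img A W) = \dim W.
Proof.
move=> uA; apply: limg_dim_eq; apply/eqP; rewrite -subv0; apply/subvP => x.
rewrite memv_cap memv_ker => /andP[_]; rewrite lfunE /= mulmx_unit_eq0// memv0//.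
Qed.

Lemma slowset_vbasis W w : slowset W w <-> forall i : 'I_(\dim W), slow ((vbasis W)`_i) w.
Proof.
split=> H.
  by move=> i; apply: H; apply: vbasis_mem; apply: mem_nth; rewrite size_tuple.
move=> x xW; rewrite (coord_vbasis xW); apply: slow_sum => i; exact: slowZ.
Qed.

Lemma measurable_slow x : measurable [set w | slow x w].
Proof.
rewrite (_ : [set w | _] = \bigcup_(K : nat) \bigcap_(n : nat)
  [set w | enorm (iter_prod b n w *m x) <= K%:R * expR (n%:R * c)]); last first.
  apply/seteqP; split => w /=.
    by move=> [K HK]; exists K => // n _; exact: HK.
  by move=> [K _ HK]; exists K => n; exact: HK.
apply: bigcupT_measurable => K; apply: bigcapT_measurable => n.
have mE : measurable_fun setT (fun w => enorm (iter_prod b n w *m x)).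
  by apply: enorm_mulmx_cst_measurable; exact: iter_prod_measurable.
have := measurable_fun_ler mE (measurable_cst (K%:R * expR (n%:R * c))).
by move=> /(_ measurableT [set true]); rewrite setTI; apply.
Qed.

Lemma measurable_slowset W : measurable (slowset W).
Proof.
rewrite (_ : slowset W = \bigcap_(i in [set k | (k < \dim W)%N]) [set w | slow ((vbasis W)`_i) w]).
  by apply: bigcap_measurableType => i _; exact: measurable_slow.
apply/seteqP; split => w.
  by move=> /slowset_vbasis H i /= ilt; exact: (H (Ordinal ilt)).
by move=> H; apply/slowset_vbasis => i; apply: H => /=.
Qed.

Lemma slowset_splice W k u v :
  slowset W (splice k (u, v)) <-> slowset (img (iter_prod b k u) W) v.
Proof.
split=> H.
  move=> y /imgP[x xW ->].
  by have /(slow_shift k) := H x xW; rewrite iter_prod_splice seq_shift_splice.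
move=> x xW; apply/(slow_shift k); rewrite iter_prod_splice seq_shift_splice.
by apply: H; exact: mem_img.
Qed.

Lemma slowsetD W1 W2 w : slowset W1 w -> slowset W2 w -> slowset (W1 + W2)%VS w.
Proof.
move=> H1 H2 x /memv_addP[y yW [z zW ->]].
by apply: slowD; [exact: H1|exact: H2].
Qed.

Definition pslow W : R := fine (P (slowset W)).

Lemma pslowE W : P (slowset W) = (pslow W)%:E.
Proof. by rewrite /pslow fineK// fin_num_measure//; exact: measurable_slowset. Qed.

Lemma pslow_ge0 W : 0 <= pslow W.
Proof. by rewrite -lee_fin -pslowE. Qed.

Lemma pslow_le1 W : pslow W <= 1.
Proof. by rewrite -lee_fin -pslowE; apply: probability_le1; exact: measurable_slowset. Qed.

Lemma indicE1 (X : Type) (S : set X) (w : X) : S w -> \1_S w = 1 :> R.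
Proof. by move=> Sw; rewrite indicE mem_set. Qed.

Lemma indicE0 (X : Type) (S : set X) (w : X) : ~ S w -> \1_S w = 0 :> R.
Proof. by move=> Sw; rewrite indicE memNset. Qed.

Lemma indic_ge0 (X : Type) (S : set X) (w : X) : 0 <= \1_S w :> R.
Proof. by rewrite indicE. Qed.

Lemma indic_iff (X Y : Type) (S : set X) (S' : set Y) (w : X) (w' : Y) : (S w <-> S' w') ->
  \1_S w = \1_S' w' :> R.
Proof.
move=> [H1 H2]; have [Sw|Sw] := pselect (S w).
  by rewrite !indicE1//; exact: H1.
by rewrite !indicE0// => /H2.
Qed.

(** Events decided by the first [k] coordinates. *)
Definition prefix_set k (S : set (seqspace T)) : Prop :=
  measurable S /\ forall u v, S (splice k (u, v)) <-> S u.

Lemma prefix_setC k S : prefix_set k S -> prefix_set k (~` S).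
Proof.
move=> [mS H]; split; first exact: measurableC.
by move=> u v; split => nS HS; apply: nS; [exact: (H u v).2|exact: (H u v).1].
Qed.

Lemma prefix_box n (E : nat -> set T) : (forall i, measurable (E i)) -> prefix_set n (box n E).
Proof.
move=> mE; split; first exact: measurable_box.
move=> u v; split => H i ilt; have := H i ilt; rewrite /splice /= ilt//.
Qed.

(** Given the first [k] coordinates, [W] is slow exactly when its image under the first [k] steps is
    slow for the independent future. The conditional probability is therefore [pslow] of that
    image. *)
Lemma slow_prefix_joint k W S : prefix_set k S ->
  P (slowset W `&` S) = EP P (fun u => \1_S u * pslow (img (iter_prod b k u) W)).
Proof.
move=> [mS HS]; rewrite -EP_indic; last exact: measurableI (measurable_slowset W) mS.
have mI : measurable_fun setT (\1_(slowset W `&` S) : seqspace T -> R).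
  by apply: measurable_indic; exact: measurableI (measurable_slowset W) mS.
rewrite (EP_splice hP k mI (fun w => indic_ge0 _ w)).
rewrite [RHS]EPE; apply: eq_integral => u _.
have mi : measurable_fun setT (\1_(slowset (img (iter_prod b k u) W)) : seqspace T -> R).
  by apply: measurable_indic; exact: measurable_slowset.
rewrite EFinM -pslowE -(EP_indic P (measurable_slowset _)) -(EPZl P (indic_ge0 S u) mi (fun w => indic_ge0 _ w)).
apply: EP_eq => v; have [Su|Su] := pselect (S u).
  rewrite (indicE1 Su) mul1r; apply: indic_iff; split.
    by move=> [/slowset_splice].
  by move=> H; split; [apply/slowset_splice|apply/HS].
by rewrite (indicE0 Su) mul0r indicE0// => -[_ /HS].
Qed.

Lemma measurable_pslow_img k W :
  measurable_fun setT (fun u => pslow (img (iter_prod b k u) W)).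
Proof.
apply/measurable_EFinP.
have mI : measurable_fun setT (\1_(slowset W) : seqspace T -> R).
  by apply: measurable_indic; exact: measurable_slowset.
have := @measurable_integral_splice _ _ _ P k (fun w => (\1_(slowset W) w)%:E)
  ((measurable_EFinP _ _).2 mI) (fun w => _).
have F0 (w : seqspace T) : (0 <= (\1_(slowset W) w)%:E :> \bar R)%E by rewrite lee_fin indic_ge0.
move=> /(_ F0); apply: eq_measurable_fun => u _ /=.
rewrite -pslowE -(EP_indic P (measurable_slowset _)) EPE.
apply: eq_integral => v _; congr (_%:E); apply: indic_iff.
exact: slowset_splice.
Qed.

Lemma slow_prefix_le k W S : prefix_set k S ->
  (forall W', \dim W' = \dim W -> pslow W' <= pslow W) ->
  (P (slowset W `&` S) <= (pslow W)%:E * P S)%E.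
Proof.
move=> hS Wmax; have [mS _] := hS; rewrite (slow_prefix_joint W hS).
have mS1 : measurable_fun setT (\1_S : seqspace T -> R) by exact: measurable_indic.
rewrite -(EP_indic P mS) -(EPZl P (pslow_ge0 W) mS1 (fun w => indic_ge0 _ w)).
apply: EP_le => u; first by rewrite mulr_ge0 ?pslow_ge0 ?indic_ge0.
rewrite mulrC ler_wpM2r ?indic_ge0//; apply: Wmax.
by rewrite dim_img// iter_prod_unit.
Qed.

(** Images of [W] have the dimension of [W], so maximality bounds the probability on [S] and on its
    complement by the product value. The two bounds add up to [pslow W], so both are equalities. *)
Lemma slow_prefix_eq k W S : prefix_set k S ->
  (forall W', \dim W' = \dim W -> pslow W' <= pslow W) ->
  P (slowset W `&` S) = ((pslow W)%:E * P S)%E.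
Proof.
move=> hS Wmax; have [mS _] := hS; have [mC _] := prefix_setC hS.
have h1 := slow_prefix_le hS Wmax; have h2 := slow_prefix_le (prefix_setC hS) Wmax.
have mW := measurable_slowset W.
have m1 : measurable (slowset W `&` S) by exact: measurableI.
have m2 : measurable (slowset W `&` ~` S) by exact: measurableI.
have e1 : P (slowset W) = (P (slowset W `&` S) + P (slowset W `&` ~` S))%E.
  rewrite -measureU//.
    by rewrite -setIUr setUv setIT.
  by rewrite setIACA setICr setI0.
have e2 : P (~` S) = (1 - P S)%E by rewrite probability_setC.
rewrite pslowE e2 in e1 h2; move: e1 h1 h2.
have f1 : P (slowset W `&` S) \is a fin_num by exact: fin_num_measure.
have f2 : P (slowset W `&` ~` S) \is a fin_num by exact: fin_num_measure.
have f3 : P S \is a fin_num by exact: fin_num_measure.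
rewrite -(fineK f1) -(fineK f2) -(fineK f3) -EFinB -!EFinM -EFinD !lee_fin.
move=> [e1] h1 h2; congr (_%:E); apply/eqP; rewrite eq_le h1 /=.
by move: h2; rewrite mulrBr mulr1; move: e1; lra.
Qed.

(** By the previous lemma [slowset W] is independent of every box, hence of every measurable set and
    in particular of itself. So [pslow W] equals its own square. *)
Lemma slow_zero_one W : (forall W', \dim W' = \dim W -> pslow W' <= pslow W) ->
  0 < pslow W -> pslow W = 1.
Proof.
move=> Wmax p0; have mW := measurable_slowset W.
pose q : {nonneg R} := NngNum (pslow_ge0 W).
pose Q1 : {measure set (seqspace T) -> \bar R} := mrestr P mW.
pose Q2 : {measure set (seqspace T) -> \bar R} := mscale q P.
have Q12 : Q1 (slowset W) = Q2 (slowset W).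
  apply: measure_eq_on_boxes => //.
    apply: le_lt_trans (ltry 1); rewrite /Q1 /= /mrestr.
    by apply: probability_le1; rewrite setTI.
  move=> n E mE; rewrite /Q1 /Q2 /= /mrestr /mscale /= setIC.
  exact: (slow_prefix_eq (prefix_box n mE) Wmax).
move: Q12; rewrite /Q1 /Q2 /= /mrestr /mscale /= setIid pslowE -EFinM => -[].
by move=> H; apply: (mulfI (lt0r_neq0 p0)); rewrite mulr1 -H.
Qed.

End zero_one.

Section invariant_slow_subspace.
Context {R : realType} d (T : measurableType d).
Context (p : probability T R) (P : probability (seqspace T) R) (hP : is_bernoulli p P).

(** The union of [n] of these events has probability at least [n * e], which eventually exceeds
    1. *)
Lemma almost_disjoint_bounded (F : nat -> set (seqspace T)) (e : R) : 0 < e ->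
  (forall i, measurable (F i)) -> (forall i, (e%:E <= P (F i))%E) ->
  (forall i j, (i < j)%N -> P (F i `&` F j) = 0%E) -> False.
Proof.
move=> e0 mF Fe Fij.
have mU n : measurable (\big[setU/set0]_(i < n) F i) by apply: bigsetU_measurable.
have H n : ((n%:R * e)%:E <= P (\big[setU/set0]_(i < n) F i))%E.
  elim: n => [|n IHn]; first by rewrite mul0r.
  rewrite big_ord_recr /=; set B := \big[setU/set0]_(i < n) F i in IHn *.
  have mB : measurable B by exact: mU.
  have PB0 : P (F n `&` B) = 0%E.
    apply/eqP; rewrite eq_le measure_ge0 andbT.
    rewrite /B -bigcup_mkord setI_bigcupr bigcup_mkord.
    apply: (@le_trans _ _ (\sum_(i < n) P (F n `&` F i))%E).
      by apply: (@Boole_inequality _ _ _ P (fun i => F n `&` F i)) => i _; exact: measurableI.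
    by rewrite big1// => i _; rewrite setIC; exact: Fij.
  have -> : B `|` F n = B `|` (F n `\` B) by rewrite setUDr setDv setD0.
  rewrite measureU//; last 2 first.
    exact: measurableD.
    by apply/seteqP; split => // w [Bw []].
  have : P (F n) = (P (F n `\` B) + P (F n `&` B))%E by exact: measureDI.
  rewrite PB0 adde0 => PF.
  rewrite -natr1 mulrDl mul1r EFinD; apply: leeD; first exact: IHn.
  by have := Fe n; rewrite PF.
have := H (Num.truncn e^-1).+1; apply/negP; rewrite -ltNge.
apply: (@le_lt_trans _ _ 1%E); first by apply: probability_le1; exact: mU.
rewrite lte_fin -ltr_pdivrMr// div1r; exact: truncnS_gt.
Qed.

Lemma EP_eq1_ae (f : seqspace T -> R) : measurable_fun setT f -> (forall w, 0 <= f w) ->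
  (forall w, f w <= 1) -> EP P f = 1%E -> {ae P, forall w, f w = 1}.
Proof.
move=> mf f0 f1 Ef.
have mg : measurable_fun setT (fun w => 1 - f w) by apply: measurable_funB.
have g0 w : 0 <= 1 - f w by rewrite subr_ge0.
have Eg : EP P (fun w => 1 - f w) = 0%E.
  have := EPD P mf mg f0 g0.
  rewrite (EP_eq P (f := fun w => f w + (1 - f w)) (g := fun=> 1)); last by move=> w; rewrite addrC subrK.
  rewrite EP_cst Ef; case: (EP P _) (EP_ge0 P g0) => [r| |]//= r0 [] /eqP.
  by rewrite -subr_eq0 opprD addrA subrr add0r oppr_eq0 => /eqP ->.
have mE : measurable_fun setT (fun w => (1 - f w)%:E) by exact/measurable_EFinP.
have : (\int[P]_w `|(1 - f w)%:E| = 0)%E.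
  rewrite -[RHS]Eg EPE; apply: eq_integral => w _.
  by rewrite gee0_abs// lee_fin.
move=> /(ae_eq_integral_abs P measurableT mE); apply: filterS => w /(_ I) [].
by move=> /eqP; rewrite subr_eq0 => /eqP.
Qed.

Context (m : nat) (m0 : (0 < m)%N).
Context (b : T -> 'M[R]_m) (ub : forall t, b t \in unitmx) (mb : mx_measurable b) (c : R).
Implicit Types (W : {vspace 'cV[R]_m}).

Local Notation pslow := (pslow P b c).

(** Without a maximum there would be infinitely many subspaces of dimension [k] with strictly
    increasing probabilities, hence distinct. When two of them are slow so is their sum, whose
    dimension exceeds [k], an event of probability 0; this contradicts [almost_disjoint_bounded]. *)
Lemma max_pslow k :
  (forall W, (k < \dim W)%N -> pslow W = 0) ->
  (exists2 W, \dim W = k & 0 < pslow W) ->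
  exists2 W, \dim W = k /\ 0 < pslow W & forall W', \dim W' = k -> pslow W' <= pslow W.
Proof.
move=> hk [W0 W0k W0p]; apply: contrapT => nomax.
have next (W : {W : {vspace 'cV[R]_m} | \dim W = k /\ 0 < pslow W}) :
    {W' : {W : {vspace 'cV[R]_m} | \dim W = k /\ 0 < pslow W} | pslow (sval W) < pslow (sval W')}.
  case: W => W [Wk Wp] /=; apply: cid; apply: contrapT => no; apply: nomax.
  exists W => // W' W'k; rewrite leNgt; apply/negP => lt; apply: no.
  by exists (exist _ W' (conj W'k (lt_trans Wp lt))).
pose W_ n := sval (iter n (fun Z => sval (next Z)) (exist _ W0 (conj W0k W0p))).
have Winc n : pslow (W_ n) < pslow (W_ n.+1).
  by rewrite /W_ /=; case: (next _).
have Wmono : {homo (fun n => pslow (W_ n)) : i j / (i < j)%N >-> i < j}.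
  by apply: homo_ltn => // y x z; exact: lt_trans.
have Wdim n : \dim (W_ n) = k by rewrite /W_; case: (iter _ _ _) => W [].
have mW W : measurable (slowset b c W) by exact: measurable_slowset.
apply: (@almost_disjoint_bounded (fun n => slowset b c (W_ n)) (pslow W0) W0p).
- by move=> n; exact: mW.
- move=> n; rewrite (pslowE _ mb) lee_fin.
  case: n => [|n]; first by [].
  by apply: ltW; exact: (Wmono 0%N n.+1).
move=> i j ij; apply/eqP; rewrite eq_le measure_ge0 andbT.
have Wij : W_ i != W_ j.
  by apply/eqP => E; have := Wmono i j ij; rewrite E ltxx.
have dlt : (k < \dim (W_ i + W_ j)%VS)%N.
  rewrite ltn_neqAle -{2}(Wdim i) dimvS ?addvSl// andbT; apply: contra Wij => /eqP dk.
  have Hi : W_ i == (W_ i + W_ j)%VS by rewrite eqEdim addvSl -dk Wdim/=.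
  have Hj : W_ j == (W_ i + W_ j)%VS by rewrite eqEdim addvSr -dk Wdim/=.
  by rewrite (eqP Hi) -(eqP Hj).
have h := hk _ dlt.
rewrite -[leRHS](_ : P (slowset b c (W_ i + W_ j)%VS) = 0%E); last by rewrite (pslowE _ mb) h.
apply: le_measure; rewrite ?inE; [exact: measurableI|exact: mW|].
by move=> w [h1 h2]; exact: slowsetD.
Qed.

(** Let [k] be the largest dimension of a subspace slow with positive probability, and [W] a
    maximizer in that dimension; then [pslow W = 1]. Conditioning on one step, almost every image of
    [W] is also slow with probability 1. So is its sum with [W], whose dimension cannot exceed [k],
    and the image must be [W]. *)
Lemma exists_invariant_slow x : x != 0 -> 0 < pslow <[x]>%VS ->
  exists W, [/\ W != 0%VS, pslow W = 1 & {ae P, forall w, img (coc b w) W = W}].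
Proof.
move=> x0 px.
pose good k := `[< exists2 W, \dim W = k & 0 < pslow W >].
have g1 : exists k, good k by exists 1%N; apply/asboolP; exists <[x]>%VS; rewrite ?dim_vline ?x0.
have gle k : good k -> (k <= m)%N.
  move=> /asboolP[W <- _]; apply: (@leq_trans (\dim (fullv : {vspace 'cV[R]_m}))).
    exact: dimvS (subvf _).
  by rewrite dimvf /dim /= muln1.
have [k /asboolP gk kmax] := ex_maxnP g1 gle.
have big W : (k < \dim W)%N -> pslow W = 0.
  move=> kW; apply/eqP; rewrite eq_le (pslow_ge0 _ mb _ W) andbT leNgt; apply/negP => pW.
  have : good (\dim W) by apply/asboolP; exists W.
  by move=> /kmax; rewrite leqNgt kW.
have [W [Wk Wp] Wmax] := max_pslow big gk.
have Wmax' W' : \dim W' = \dim W -> pslow W' <= pslow W by rewrite Wk; exact: Wmax.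
have W1 : pslow W = 1 by exact: (slow_zero_one hP ub mb).
exists W; split => //.
  rewrite -dimv_eq0 Wk -lt0n; apply: kmax.
  by apply/asboolP; exists <[x]>%VS; rewrite ?dim_vline ?x0.
have mi := measurable_pslow_img P mb c 1 W.
have E1 : EP P (fun u => pslow (img (iter_prod b 1 u) W)) = 1%E.
  have hT : prefix_set 0 [set: seqspace T] by split.
  have hT1 : prefix_set 1 [set: seqspace T] by split.
  have := slow_prefix_joint hP mb c W hT1; rewrite setIT (pslowE _ mb) W1 => ->.
  by apply: EP_eq => u; rewrite indicE1// mul1r.
have := EP_eq1_ae mi (fun u => pslow_ge0 _ mb _ _) (fun u => pslow_le1 _ mb _ _) E1.
apply: filterS => w; rewrite iter_prod1 -[b _]/(coc b w) => H.
set W' := img (coc b w) W in H *.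
have dW' : \dim W' = \dim W by rewrite dim_img// /coc ub.
have mS V : measurable (slowset b c V) by exact: measurable_slowset.
have H2 : (0 < P (slowset b c (W + W')%VS))%E.
  apply: (@lt_le_trans _ _ (P (slowset b c W `&` slowset b c W'))); last first.
    apply: le_measure; rewrite ?inE; [exact: measurableI|exact: mS|].
    by move=> v [h1 h2]; exact: slowsetD.
  have c1 : P (~` slowset b c W) = 0%E by rewrite probability_setC// (pslowE _ mb) W1 subee.
  have : P (slowset b c W') = (P (slowset b c W' `\` slowset b c W) + P (slowset b c W' `&` slowset b c W))%E.
    exact: measureDI.
  rewrite (pslowE _ mb _ W') H.
  have -> : P (slowset b c W' `\` slowset b c W) = 0%E.
    apply/eqP; rewrite eq_le measure_ge0 andbT -[leRHS]c1.
    apply: le_measure; rewrite ?inE; [exact: measurableD|exact: measurableC|].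
    by move=> v [].
  by rewrite add0e setIC => <-.
have H3 : (\dim (W + W')%VS <= k)%N.
  rewrite leqNgt; apply/negP => /big h; move: H2.
  by rewrite (pslowE _ mb) h ltxx.
have E2 : W == (W + W')%VS by rewrite eqEdim addvSl Wk H3.
have E3 : W' == (W + W')%VS by rewrite eqEdim addvSr dW' Wk H3.
by rewrite (eqP E3) -(eqP E2).
Qed.

End invariant_slow_subspace.

(** * The exponent on a slow invariant subspace *)

Section slow_exponent.
Context {R : realType} d (T : measurableType d).
Context (p : probability T R) (P : probability (seqspace T) R) (hP : is_bernoulli p P).
Context (m : nat) (m0 : (0 < m)%N).
Context (b : T -> 'M[R]_m) (s M : R) (s0 : 0 < s) (M1 : 1 <= M) (hb : GL_moment P b s M).
Context (c : R).
Implicit Types (W : {vspace 'cV[R]_m}).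

Lemma decreasing_null_small (F : nat -> set (seqspace T)) : (forall i, measurable (F i)) ->
  (forall i j, (i <= j)%N -> F j `<=` F i) -> P (\bigcap_i F i) = 0%E ->
  forall e : R, 0 < e -> exists n, (P (F n) < e%:E)%E.
Proof.
move=> mF Fdec F0 e e0.
have mI : measurable (\bigcap_i F i) by exact: bigcapT_measurable.
have cv : P \o F @ \oo --> 0%E.
  rewrite -F0; apply: nonincreasing_cvg_mu => //.
    by apply: (@le_lt_trans _ _ 1%E); [exact: probability_le1|exact: ltry].
  by move=> i j ij; apply/subsetPset; exact: Fdec.
have /cv[n _ H] : nbhs (0%E : \bar R) [set x | (x < e%:E)%E].
  by apply: open_nbhs_nbhs; split; [exact: open_ereal_lt_ereal|rewrite /= lte_fin].
by exists n; apply: (H n) => /=.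
Qed.

(** Dominates [|growth (coc b w) x - c|] for every direction [x], the deviation of one step from the
    rate [c]. *)
Definition step_size w : R := ln (gl_size (coc b w)) + `|c|.

Lemma step_size_ge0 w : 0 <= step_size w.
Proof.
rewrite addr_ge0//; apply: ln_ge0; apply: gl_size_ge1 => //.
by have [ub _ _] := hb; exact: ub.
Qed.

Lemma measurable_step_size : measurable_fun setT step_size.
Proof.
have [ub mb _] := hb; apply: measurable_funD; last exact: measurable_cst.
apply: measurable_lnf; apply: measurable_gl_size; first by move=> w; exact: ub.
exact: coc_measurable.
Qed.

Definition step_variance : R := 2 * (4 * s^-1 ^+ 2 * M + c ^+ 2).

Lemma step_variance_ge0 : 0 <= step_variance.
Proof.
apply: mulr_ge0 => //; apply: addr_ge0; last exact: sqr_ge0.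
apply: mulr_ge0; first exact: mulr_ge0 (ler0n _ 4) (sqr_ge0 _).
exact: le_trans ler01 M1.
Qed.

Lemma EP_step_size_sqr : EPle P (fun w => step_size w ^+ 2) step_variance.
Proof.
have [ub mb bM] := hb.
have k0 : 0 <= 2 * (4 * s^-1 ^+ 2).
  exact: mulr_ge0 (ler0n _ 2) (mulr_ge0 (ler0n _ 4) (sqr_ge0 _)).
have c20 : 0 <= 2 * c ^+ 2 := mulr_ge0 (ler0n _ 2) (sqr_ge0 _).
have mK : measurable_fun setT (fun w => gl_size (coc b w) `^ s).
  apply: measurable_powRf; apply: measurable_gl_size; first by move=> w; exact: ub.
  exact: coc_measurable.
have mkK : measurable_fun setT (fun w => 2 * (4 * s^-1 ^+ 2) * gl_size (coc b w) `^ s).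
  by apply: measurable_funM => //; exact: measurable_cst.
have hc : EPle P (fun=> 2 * c ^+ 2) (2 * c ^+ 2) by rewrite EP_cst.
have z w : 0 <= 2 * (4 * s^-1 ^+ 2) * gl_size (coc b w) `^ s.
  by apply: mulr_ge0 => //; exact: powR_ge0.
have H := EPD_le mkK (measurable_cst _) z (fun=> c20) (EPZ_le k0 mK (fun w => powR_ge0 _ _) bM) hc.
apply: le_trans (le_trans H _); last first.
  by rewrite lee_fin /step_variance le_eqVlt; apply/orP; left; apply/eqP; ring.
apply: EP_le => w; first exact: sqr_ge0.
have K1 : 1 <= gl_size (coc b w) by apply: gl_size_ge1 => //; exact: ub.
have s20 : 0 < s / 2 by rewrite divr_gt0.
rewrite /step_size; set k := gl_size (coc b w) in K1 *.
have y0 := ln_ge0 K1.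
(* The exponent [s / 2] is used because the bound is squared next; this produces the factor
   [4 * s^-1 ^+ 2]. *)
have yle := ln_le_powR s20 K1.
have y2 : ln k ^+ 2 <= 4 * s^-1 ^+ 2 * k `^ s.
  have -> : 4 * s^-1 ^+ 2 * k `^ s = ((s / 2)^-1 * k `^ (s / 2)) ^+ 2.
    have -> : k `^ s = (k `^ (s / 2)) ^+ 2 by rewrite -powR_mulrn ?powR_ge0// -powRrM divfK.
    by rewrite invfM invrK !exprMn; ring.
  by rewrite ler_pXn2r ?nnegrE// (le_trans y0).
have c2 : `|c| ^+ 2 = c ^+ 2 by rewrite real_normK ?num_real.
have q0 : 0 <= (ln k - `|c|) ^+ 2 by exact: sqr_ge0.
move: y2 c2 q0; rewrite /cst !expr2; lra.
Qed.

Lemma measurable_step_size_shift i : measurable_fun [set: seqspace T] (fun w : seqspace T => step_size (seq_shift i w)).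
Proof.
apply: (@measurableT_comp _ _ _ _ _ _ step_size); first exact: measurable_step_size.
exact: measurable_seq_shift.
Qed.

(** Uniform integrability of the steps in quantitative form: with [eta] small, and then [dl] small
    compared with [eta], an event of probability at most [dl] contributes little to the mean of any
    step. *)
Lemma step_size_indic i (S : set (seqspace T)) eta dl : measurable S -> 0 < eta ->
  (P S <= dl%:E)%E ->
  EPle P (fun w => step_size (seq_shift i w) * \1_S w) ((eta * step_variance + dl / eta) / 2).
Proof.
move=> mS eta0 PS.
have EPs : EPle P (fun w => step_size (seq_shift i w) ^+ 2) step_variance.
  rewrite (EP_shift hP i (f := fun w => step_size w ^+ 2)); first exact: EP_step_size_sqr.
  by apply: measurable_exprf; exact: measurable_step_size.
have mS1 : measurable_fun setT (\1_S : seqspace T -> R) by exact: measurable_indic.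
have m2 : measurable_fun [set: seqspace T] (fun w : seqspace T => step_size (seq_shift i w) ^+ 2).
  by apply: measurable_exprf; exact: measurable_step_size_shift.
have e1 : 0 <= eta / 2 by rewrite divr_ge0// ltW.
have e2 : 0 <= (2 * eta)^-1 by rewrite invr_ge0 mulr_ge0// ltW.
have H1 := EPZ_le e1 m2 (fun w => sqr_ge0 _) EPs.
have PS' : EPle P (\1_S : seqspace T -> R) dl by rewrite EP_indic.
have H2 := EPZ_le e2 mS1 (fun w => indic_ge0 _ w) PS'.
have z1 w : 0 <= eta / 2 * step_size (seq_shift i w) ^+ 2 := mulr_ge0 e1 (sqr_ge0 _).
have z2 w : 0 <= (2 * eta)^-1 * \1_S w :> R by apply: mulr_ge0 => //; exact: indic_ge0.
have q1 : measurable_fun [set: seqspace T] (fun w : seqspace T => eta / 2 * step_size (seq_shift i w) ^+ 2).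
  by apply: measurable_funM => //; exact: measurable_cst.
have q2 : measurable_fun setT (fun w : seqspace T => (2 * eta)^-1 * \1_S w).
  by apply: measurable_funM => //; exact: measurable_cst.
apply: le_trans (le_trans (EPD_le q1 q2 z1 z2 H1 H2) _); last first.
  rewrite lee_fin le_eqVlt; apply/orP; left; apply/eqP; field.
  by rewrite gt_eqF.
apply: EP_le => w; first by apply: mulr_ge0; [exact: step_size_ge0|exact: indic_ge0].
apply: le_trans (AMGM_weighted _ _ eta0) _.
have -> : (\1_S w) ^+ 2 = \1_S w :> R.
  by have [Sw|Sw] := pselect (S w); [rewrite indicE1// expr1n|rewrite indicE0// expr0n].
by rewrite le_eqVlt; apply/orP; left; apply/eqP; field; rewrite gt_eqF.
Qed.

Lemma ln_size_le_sum n w :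
  ln (gl_size (iter_prod b n w)) <= \sum_(i < n) ln (gl_size (coc b (seq_shift i w))).
Proof.
have [ub mb bM] := hb.
elim: n => [|n IHn]; first by rewrite big_ord0 /iter_prod /= gl_size1// ln1.
rewrite big_ord_recr /= addrC -addn1 addnC iter_prodD iter_prod1.
have u1 : coc b (seq_shift n w) \in unitmx by exact: ub.
have un := GL_moment_iter_unit n w hb.
have u1n : coc b (seq_shift n w) *m iter_prod b n w \in unitmx by rewrite unitmx_mul u1 un.
have p1 := lt_le_trans ltr01 (gl_size_ge1 m0 u1).
have p2 := lt_le_trans ltr01 (gl_size_ge1 m0 un).
have p3 := lt_le_trans ltr01 (gl_size_ge1 m0 u1n).
rewrite -[b _]/(coc b (seq_shift n w)).
by apply: le_trans (ln_submul p1 p2 p3 (gl_sizeM u1 un)) _; rewrite lerD2l.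
Qed.

Lemma Rintegral_le_EP (X Z : seqspace T -> R) a z : P.-integrable setT (EFin \o X) ->
  measurable_fun setT Z -> (forall w, 0 <= Z w) -> EPle P Z z ->
  (forall w, X w <= a + Z w) -> \int[P]_w X w <= a + z.
Proof.
move=> Xi mZ Z0 Zz H.
have Zi : P.-integrable setT (EFin \o Z).
  apply: (@EP_integrable _ _ _ _ _ z) => //.
  by rewrite (EP_eq P (g := Z))// => w; rewrite ger0_norm.
have ai : P.-integrable setT (EFin \o (fun=> a) : seqspace T -> \bar R).
  apply: (@EP_integrable _ _ _ _ _ `|a|); first exact: measurable_cst.
  by rewrite EP_cst.
have aZi : P.-integrable setT (EFin \o (fun w => a + Z w)).
  exact: (integrableD measurableT ai Zi).
apply: (@le_trans _ _ (\int[P]_w (a + Z w))).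
  by apply: le_Rintegral => // w _; exact: H.
rewrite (RintegralD measurableT ai Zi).
have -> : \int[P]_w a = a.
  by apply/eqP; rewrite -eqe -(EP_Rintegral ai) EP_cst.
by rewrite lerD2l -lee_fin -(EP_Rintegral Zi).
Qed.

Lemma opnorm_on_slow W w : slowset b c W w ->
  exists K : nat, forall n, opnorm_on W (iter_prod b n w) <= K%:R * expR (n%:R * c).
Proof.
move=> /slowset_vbasis H.
pose K (i : 'I_(\dim W)) := sval (cid (H i)).
have HK (i : 'I_(\dim W)) n : enorm (iter_prod b n w *m (vbasis W)`_i) <= (K i)%:R * expR (n%:R * c).
  by rewrite /K; case: cid.
pose C i := \sum_j `|coord (vbasis W) i (delta_mx j ord0)|.
have HC i (x : 'cV[R]_m) : `|coord (vbasis W) i x| <= C i * enorm x.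
  rewrite {1}(col_sum_delta x) linear_sum (le_trans (ler_norm_sum _ _ _))//.
  rewrite /C mulr_suml; apply: ler_sum => j _.
  by rewrite linearZ normrM mulrC ler_wpM2l// ler_enorm_entry.
have C0 i : 0 <= C i by apply: sumr_ge0.
pose B := \sum_i C i * (K i)%:R.
have B0 : 0 <= B by apply: sumr_ge0 => i _; rewrite mulr_ge0.
exists (Num.truncn B).+1 => n.
apply: opnorm_on_le => [|x xW]; first by rewrite mulr_ge0 ?expR_ge0.
rewrite {1}(coord_vbasis xW) mulmx_sumr (le_trans (enorm_sum _ _ _))//.
apply: (@le_trans _ _ (B * expR (n%:R * c) * enorm x)); last first.
  by rewrite ler_wpM2r ?enorm_ge0// ler_wpM2r ?expR_ge0// ltW// truncnS_gt.
rewrite /B !mulr_suml; apply: ler_sum => i _.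
rewrite -scalemxAr enormZ.
apply: le_trans (ler_pM (normr_ge0 _) (enorm_ge0 _) (HC i x) (HK i n)) _.
by rewrite le_eqVlt; apply/orP; left; apply/eqP; ring.
Qed.

(** The bound [K e^(nc)] holds with a random [K]. A deterministic [K] works outside an event [F K]
    of small probability; there the logarithm is at most a sum of [n] step sizes, whose mean on
    [F K] is a small multiple of [n] by [step_size_indic]. *)
Lemma lyapunov_on_slow_le W : W != 0%VS -> pslow P b c W = 1 ->
  invariant_subspace P (coc b) W -> lyapunov_on P (coc b) W <= c.
Proof.
move=> W0 W1 Winv; have [ub mb _] := hb.
have [x xW x0] : exists2 x, x \in W & x != 0.
  by exists (vpick W); [exact: memv_pick|rewrite vpick0].
have on_gt0 n w : 0 < opnorm_on W (iter_prod b n w).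
  have := ler_opnorm_on (iter_prod b n w) xW; apply: contraTT.
  rewrite -!leNgt => on0.
  rewrite -ltNge (le_lt_trans (ler_wpM2r (enorm_ge0 x) on0))// mul0r.
  by rewrite enorm_mulmx_gt0// iter_prod_unit.
have on_le n w : opnorm_on W (iter_prod b n w) <= gl_size (iter_prod b n w).
  exact: le_trans (opnorm_on_le_opnorm _ _) (opnorm_le_size _).
have on_ge n w : 1 <= opnorm_on W (iter_prod b n w) * gl_size (iter_prod b n w).
  have nx : 0 < enorm x by rewrite enorm_gt0.
  rewrite -(ler_pM2r nx) mul1r.
  apply: le_trans (opnorm_inv_ler x (GL_moment_iter_unit n w hb)) _.
  rewrite [leRHS](_ : _ = gl_size (iter_prod b n w) * (opnorm_on W (iter_prod b n w) * enorm x)); last by ring.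
  exact: ler_pM (opnorm_ge0 _) (enorm_ge0 _) (opnormV_le_size _) (ler_opnorm_on _ xW).
have K1 n w : 1 <= gl_size (iter_prod b n w).
  exact: gl_size_ge1 (GL_moment_iter_unit n w hb).
have K0 n w : 0 < gl_size (iter_prod b n w) by exact: lt_le_trans (K1 n w).
pose X n w := ln (opnorm_on W (iter_prod b n w)).
have Xle n w : X n w <= ln (gl_size (iter_prod b n w)).
  by rewrite /X ler_ln ?posrE// on_le.
have HX n w : `|X n w| <= 0 + 1 * ln (gl_size (iter_prod b n w)).
  rewrite add0r mul1r ler_norml Xle andbT -lnV ?posrE// ler_ln ?posrE ?invr_gt0//.
  by rewrite -div1r ler_pdivrMr.
have mX n : measurable_fun setT (X n).
  by apply: measurable_lnf; apply: measurable_opnorm_on; exact: iter_prod_measurable.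
have pres : {ae P, forall w, forall k y, y \in W -> iter_prod b k w *m y \in W}.
  have H : {ae P, forall w, forall k, img (coc b (seq_shift k w)) W = W}.
    by apply/ae_foralln => k; exact: (ae_shift k hP Winv).
  have FP := ae_filter_ringOfSetsType P.
  move: H; apply: (@filterS _ (almost_everywhere P) FP) => w H; elim=> [|k IHk] y yW; first by rewrite /iter_prod /= mul1mx.
  by have := mem_img (coc b (seq_shift k w)) (IHk y yW); rewrite (H k) mulmxA.
have Xsub n k : {ae P, forall w, X (n + k)%N w <= X n (seq_shift k w) + X k w}.
  have FP := ae_filter_ringOfSetsType P.
  move: pres; apply: (@filterS _ (almost_everywhere P) FP) => w H; rewrite /X.
  apply: ln_submul => //; rewrite iter_prodD.
  apply: opnorm_on_le => [|y yW]; first by apply: mulr_ge0; exact: opnorm_on_ge0.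
  rewrite -mulmxA -mulrA; apply: le_trans (ler_opnorm_on _ (H k y yW)) _.
  by apply: ler_wpM2l; [exact: opnorm_on_ge0|exact: ler_opnorm_on].
have [l lcvg lle] := subadditive_process_cvg hP m0 s0 hb (lexx _) ler01 mX HX Xsub.
have -> : lyapunov_on P (coc b) W = l by exact: cvg_lim lcvg.
apply/ler_addgt0Pr => e e0.
set V := step_variance; have V0 : 0 <= V by exact: step_variance_ge0.
have V1 : 0 < V + 1 by rewrite ltr_wpDl.
(* These choices give [eta * V <= e / 2] and [dl / eta = e / 2], so each step contributes at most
   [e / 2]; [V + 1] avoids a division by zero. *)
pose eta := e / (2 * (V + 1)); have eta0 : 0 < eta by rewrite divr_gt0// mulr_gt0.
pose dl := eta * e / 2; have dl0 : 0 < dl by rewrite divr_gt0// mulr_gt0.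
pose G (K : nat) := \bigcap_(n : nat) [set w | opnorm_on W (iter_prod b n w) <= K%:R * expR (n%:R * c)].
have mG K : measurable (G K).
  apply: bigcapT_measurable => n.
  have mE : measurable_fun setT (fun w => opnorm_on W (iter_prod b n w)).
    by apply: measurable_opnorm_on; exact: iter_prod_measurable.
  have := measurable_fun_ler mE (measurable_cst (K%:R * expR (n%:R * c))).
  by move=> /(_ measurableT [set true]); rewrite setTI; apply.
pose F K := ~` G K.
have mF K : measurable (F K) by exact: measurableC.
have Fdec i j : (i <= j)%N -> F j `<=` F i.
  move=> ij w nG GK; apply: nG => n _; have := GK n I => /= /le_trans; apply.
  by rewrite ler_wpM2r ?expR_ge0// ler_nat.
have F0 : P (\bigcap_K F K) = 0%E.
  have mW := measurable_slowset mb c W.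
  have c1 : P (~` slowset b c W) = 0%E.
    by rewrite probability_setC// (pslowE P mb) W1 subee.
  apply/eqP; rewrite eq_le measure_ge0 andbT -[leRHS]c1.
  apply: le_measure; rewrite ?inE; [exact: bigcapT_measurable|exact: measurableC|].
  by move=> w Fw /opnorm_on_slow[K HK]; apply: (Fw K I) => n _; exact: HK.
have [K PFK] := decreasing_null_small mF Fdec F0 dl0.
(* [K] may be 0; with [K.+1] the logarithm is that of a number at least 1. *)
have lnK : 0 <= ln K.+1%:R :> R by apply: ln_ge0; rewrite ler1n.
have e2 : (eta * V + dl / eta) / 2 <= e / 2.
  rewrite ler_pM2r// /dl; have -> : eta * e / 2 / eta = e / 2 by field; rewrite gt_eqF.
  have : eta * V <= e / 2.
    have -> : eta * V = (e / 2) * (V / (V + 1)).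
      by rewrite /eta; field; rewrite gt_eqF.
    by apply: ler_piMr; [exact: divr_ge0 (ltW e0) _|rewrite ler_pdivrMr// mul1r lerDl].
  lra.
pose Z n w := \sum_(i < n) step_size (seq_shift i w) * \1_(F K) w.
have mz i : measurable_fun [set: seqspace T] (fun w : seqspace T => step_size (seq_shift i w) * \1_(F K) w).
  by apply: measurable_funM; [exact: measurable_step_size_shift|exact: measurable_indic].
have z0 i w : 0 <= step_size (seq_shift i w) * \1_(F K) w.
  by apply: mulr_ge0; [exact: step_size_ge0|exact: indic_ge0].
have EZ n : EPle P (Z n) (n%:R * (e / 2)).
  have H (i : 'I_n) : EPle P (fun w => step_size (seq_shift i w) * \1_(F K) w) (e / 2).
    by apply: le_trans (step_size_indic i (mF K) eta0 (ltW PFK)) _; rewrite lee_fin.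
  by have := EP_sum_le (fun i : 'I_n => mz i) (fun (i : 'I_n) => z0 i) H; rewrite card_ord.
have Hint n : \int[P]_w X n w <= (ln K.+1%:R + n%:R * c) + n%:R * (e / 2).
  have [Xi _] := ln_size_dominated hP m0 s0 hb (lexx _) ler01 (mX n) (HX n).
  apply: (Rintegral_le_EP Xi _ _ (EZ n)).
  - by apply: measurable_sum => i; exact: mz.
  - by move=> w; apply: sumr_ge0 => i _.
  move=> w; have Z0 : 0 <= Z n w by apply: sumr_ge0 => i _.
  have [Gw|Fw] := pselect (G K w).
    rewrite (le_trans _ (_ : ln K.+1%:R + n%:R * c <= _)) ?lerDl//.
    rewrite -[n%:R * c]expRK -lnM ?posrE ?expR_gt0// /X ler_ln ?posrE ?mulr_gt0 ?expR_gt0//.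
    apply: le_trans (Gw n I) _.
    by rewrite ler_wpM2r ?expR_ge0// ler_nat.
  apply: le_trans (Xle n w) _; apply: le_trans (ln_size_le_sum n w) _.
  have -> : Z n w = \sum_(i < n) ln (gl_size (coc b (seq_shift i w))) + n%:R * `|c|.
    rewrite /Z; under eq_bigr do rewrite indicE1// mulr1 /step_size.
    by rewrite big_split /= sumr_const card_ord mulr_natl.
  have : - (n%:R * `|c|) <= n%:R * c by rewrite -mulrN ler_wpM2l// lerNl -normrN ler_norm.
  lra.
have [n n0 nbig] : exists2 n : nat, (0 < n)%N & ln K.+1%:R <= n%:R * (e / 2).
  exists (Num.truncn (ln K.+1%:R / (e / 2))).+1 => //.
  by rewrite -ler_pdivrMr ?divr_gt0// ltW// truncnS_gt.
apply: le_trans (lle n n0) _.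
rewrite ler_pdivrMl ?ltr0n// (le_trans (Hint n))//; lra.
Qed.

Lemma quasi_irreducible_not_slow : quasi_irreducible P (coc b) -> c < lyapunov P (coc b) 1 ->
  forall x : 'cV[R]_m, x != 0 -> pslow P b c <[x]>%VS = 0.
Proof.
move=> qi cl x x0; have [ub mb _] := hb.
apply/eqP; rewrite eq_le (pslow_ge0 P mb) andbT leNgt; apply/negP => px.
have [W [W0 W1 Winv]] := exists_invariant_slow hP ub mb x0 px.
have Wle := lyapunov_on_slow_le W0 W1 Winv.
have lt : lyapunov_on P (coc b) W < lyapunov P (coc b) 1 by exact: le_lt_trans cl.
(* Quasi-irreducibility concerns proper subspaces. If [W] is the whole space, its exponent is
   [lambda_1(A)] itself, which exceeds [c]. *)
have [WT|WT] := eqVneq W fullv; last by apply: qi; exists W.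
move: lt; rewrite WT.
have [cv _] := lyapunov_cvg hP m0 s0 hb.
have -> : lyapunov_on P (coc b) fullv = lyapunov P (coc b) 1 by exact: cvg_lim cv.
by rewrite ltxx.
Qed.

End slow_exponent.

(** * Uniform lower bounds for the growth of vectors *)

Section uniformity_in_direction.
Context {R : realType}.

(* By compactness of the projective space. *)
Lemma eventually_uniform_direction m (Q : nat -> 'cV[R]_m -> Prop) :
  (forall N N' (y : 'cV[R]_m), (N <= N')%N -> Q N y -> Q N' y) ->
  (forall N (a : R) (y : 'cV[R]_m), a != 0 -> Q N (a *: y) -> Q N y) ->
  (forall x : 'cV[R]_m, x != 0 -> exists N, exists2 e : R, 0 < e &
    forall y : 'cV[R]_m, enorm (x - y) < e -> Q N y) ->
  exists N, forall y : 'cV[R]_m, y != 0 -> Q N y.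
Proof.
move=> Qmono QZ Qloc.
(* Dividing a nonzero vector by its entry of largest modulus puts it on a face of the unit cube with
   [i]-th coordinate 1. These [m] compact faces represent all directions; for [j = i] the interval
   is the point 1. *)
pose J (i j : 'I_m) : set R := `[(if j == i then 1 else -1), 1]%classic.
pose K i := [set v : 'rV[R]_m | forall j, J i j (v ord0 j)].
have cK i : compact (K i).
  by apply: (@rV_compact R m (J i)) => j; exact: segment_compact.
have HK i : exists N, forall v, K i v -> Q N v^T.
  have /compact_near_coveringP cov := cK i.
  have : \forall N \near \oo, K i `<=` (fun v => Q N v^T).
    apply: (cov _ _ (fun N v => Q N v^T)) => v Kv.
    have v0 : v^T != 0.
      apply/eqP => /matrixP/(_ i ord0); rewrite !mxE => v0.
      by have := Kv i; rewrite v0 /J eqxx /= in_itv /= ler10.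
    have [N [e e0 HN]] := Qloc _ v0.
    have e1 : 0 < e / m.+1%:R by rewrite divr_gt0.
    exists (ball v (e / m.+1%:R), [set n | (N <= n)%N]).
      by split; [exact: nbhsx_ballx|exists N].
    move=> [y n] [/= vy Nn]; apply: (Qmono _ _ _ Nn); apply: HN.
    apply: le_lt_trans (enorm_le_sum _) _.
    apply: (@le_lt_trans _ _ (\sum_(j < m) e / m.+1%:R)).
      by apply: ler_sum => j _; rewrite !mxE; apply: ltW; exact: (vy.2 ord0 j).
    rewrite sumr_const card_ord -[_ *+ _]mulr_natl mulrCA gtr_pMr//.
    by rewrite ltr_pdivrMr// mul1r ltr_nat.
  by move=> [N0 _ H]; exists N0 => v; apply: H => /=.
pose NN i := sval (cid (HK i)).
have HN i v : K i v -> Q (NN i) v^T by rewrite /NN; case: cid => n; apply.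
exists (\max_i NN i)%N => y y0.
have [i0 yi0] : exists i, y i ord0 != 0.
  apply/existsP; rewrite -[[exists _, _]]negbK negb_exists; apply/negP => /forallP H.
  move/negP: y0; apply; apply/eqP/matrixP => i j; rewrite ord1 mxE.
  by have := H i; rewrite negbK => /eqP.
pose i := [arg max_(i > i0) `|y i ord0|]%O.
have yi j : `|y j ord0| <= `|y i ord0|.
  by rewrite /i; case: arg_maxP => // k _; apply.
have yi_gt0 : 0 < `|y i ord0| by apply: lt_le_trans (yi i0); rewrite normr_gt0.
have yi1 : y i ord0 != 0 by rewrite -normr_gt0.
apply: (@Qmono (NN i)); first exact: (leq_bigmax i).
apply: (@QZ _ (y i ord0)^-1); first by rewrite invr_eq0.
rewrite -[_ *: _]trmxK; apply: HN => j.
rewrite /J /= in_itv /= !mxE mulrC.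
have h : `|y j ord0 / y i ord0| <= 1 by rewrite normrM normfV ler_pdivrMr ?mul1r.
move: h; rewrite ler_norml => /andP[h1 ->]; rewrite andbT.
by case: eqP => [->|//]; rewrite divff.
Qed.

End uniformity_in_direction.

Section growth_lower_bound.
Context {R : realType} d (T : measurableType d).
Context (p : probability T R) (P : probability (seqspace T) R) (hP : is_bernoulli p P).
Context (m : nat) (m0 : (0 < m)%N).
Context (b : T -> 'M[R]_m) (s M : R) (s0 : 0 < s) (M1 : 1 <= M) (hb : GL_moment P b s M).
Context (c : R).
Implicit Types (x y : 'cV[R]_m).

(** The event that up to time [N] the orbit of [x] never outgrows the rate [c]. *)
Definition stalled N x : set (seqspace T) :=
  [set w | forall n, (n <= N)%N -> enorm (iter_prod b n w *m x) <= expR (n%:R * c) * enorm x].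

Lemma measurable_stalled N (G : seqspace T -> 'cV[R]_m) (h : seqspace T -> seqspace T) :
  mx_measurable G -> measurable_fun setT h -> measurable [set w | stalled N (G w) (h w)].
Proof.
move=> mG mh; have [_ mb _] := hb.
rewrite (_ : [set w | _] = \bigcap_(n in [set n | (n <= N)%N])
  [set w | enorm (iter_prod b n (h w) *m G w) <= expR (n%:R * c) * enorm (G w)]); last first.
  by apply/seteqP; split => w /= H n; exact: H.
apply: bigcap_measurableType => n _.
have mE : measurable_fun setT (fun w => enorm (iter_prod b n (h w) *m G w)).
  apply: measurable_enorm; apply: mx_measurableM => //.
  by apply: (mx_measurable_comp mh); exact: iter_prod_measurable.
have mF : measurable_fun setT (fun w => expR (n%:R * c) * enorm (G w)).
  by apply: measurable_funM; [exact: measurable_cst|exact: measurable_enorm].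
have := measurable_fun_ler mE mF.
by move=> /(_ measurableT [set true]); rewrite setTI; apply.
Qed.

Lemma measurable_stalled_cst N x : measurable (stalled N x).
Proof.
apply: (@measurable_stalled N (fun=> x) id); last exact: measurable_id.
exact: mx_measurable_cst.
Qed.

Hypothesis fast : forall x, x != 0 -> pslow P b c <[x]>%VS = 0.

(** For a fixed [x] these events decrease to one on which [x] is slow, hence to a null event.
    Compactness then makes [N] uniform in the direction. *)
Lemma stalled_small e : 0 < e -> exists N, forall x, x != 0 -> (P (stalled N x) < e%:E)%E.
Proof.
move=> e0; have [ub mb _] := hb.
apply: eventually_uniform_direction.
- move=> N N' y NN'; apply: le_lt_trans; apply: le_measure; rewrite ?inE; try exact: measurable_stalled_cst.
  by move=> w H n nN; apply: H; exact: leq_trans NN'.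
- move=> N a y a0; rewrite (_ : stalled N (a *: y) = stalled N y)//.
  have ap : 0 < `|a| by rewrite normr_gt0.
  apply/seteqP; split => w H n nN; have := H n nN.
    by rewrite -scalemxAr !enormZ mulrCA ler_pM2l.
  by rewrite -scalemxAr !enormZ mulrCA ler_pM2l.
move=> x x0.
(* A relaxed form of [stalled j x]: the tolerance is such that [F j] contains [stalled j y] for all
   [y] within [1/(j+1)] of [x], and it vanishes as [j] grows, so the intersection still forces [x]
   to be slow. *)
pose F (j : nat) := [set w | forall n, (n <= j)%N ->
  enorm (iter_prod b n w *m x) <=
    expR (n%:R * c) * enorm x + (opnorm (iter_prod b n w) + expR (n%:R * c)) / j.+1%:R].
have mF j : measurable (F j).
  rewrite (_ : F j = \bigcap_(n in [set n | (n <= j)%N]) [set w | enorm (iter_prod b n w *m x) <=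
    expR (n%:R * c) * enorm x + (opnorm (iter_prod b n w) + expR (n%:R * c)) / j.+1%:R]); last first.
    by apply/seteqP; split => w /= H n; exact: H.
  apply: bigcap_measurableType => n _.
  have mE : measurable_fun setT (fun w => enorm (iter_prod b n w *m x)).
    by apply: enorm_mulmx_cst_measurable; exact: iter_prod_measurable.
  have mG : measurable_fun setT (fun w => expR (n%:R * c) * enorm x + (opnorm (iter_prod b n w) + expR (n%:R * c)) / j.+1%:R).
    apply: measurable_funD; first exact: measurable_cst.
    apply: measurable_funM; last exact: measurable_cst.
    apply: measurable_funD; last exact: measurable_cst.
    by apply: measurable_opnorm; exact: iter_prod_measurable.
  have := measurable_fun_ler mE mG.
  by move=> /(_ measurableT [set true]); rewrite setTI; apply.
have Fdec i j : (i <= j)%N -> F j `<=` F i.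
  move=> ij w H n ni; apply: le_trans (H n (leq_trans ni ij)) _.
  rewrite lerD2l ler_wpM2l//; first by apply: addr_ge0; [exact: opnorm_ge0|exact: expR_ge0].
  by rewrite lef_pV2 ?posrE// ler_nat.
have F0 : P (\bigcap_j F j) = 0%E.
  have mW := measurable_slowset mb c <[x]>%VS.
  apply/eqP; rewrite eq_le measure_ge0 andbT.
  have P0 : P (slowset b c <[x]>%VS) = 0%E by rewrite (pslowE P mb) fast.
  rewrite -[leRHS]P0; apply: le_measure; rewrite ?inE//; first exact: bigcapT_measurable.
  move=> w Fw y /vlineP[k ->]; apply: slowZ.
  exists (Num.truncn (enorm x)).+1 => n.
  apply: (@le_trans _ _ (enorm x * expR (n%:R * c))); last first.
    by rewrite ler_wpM2r ?expR_ge0// ltW// truncnS_gt.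
  apply/ler_addgt0Pr => z z0.
  set q := opnorm (iter_prod b n w) + expR (n%:R * c).
  have q0 : 0 <= q by apply: addr_ge0; [exact: opnorm_ge0|exact: expR_ge0].
  pose j := maxn n (Num.truncn (q / z)).+1.
  apply: le_trans (Fw j I n (leq_maxl _ _)) _; rewrite mulrC lerD2l.
  rewrite ler_pdivrMr// -ler_pdivrMl// mulrC; apply: ltW.
  apply: lt_le_trans (truncnS_gt (q / z)) _; rewrite ler_nat.
  by apply: leq_trans (leqnSn _); exact: leq_maxr.
have [N PN] := decreasing_null_small mF Fdec F0 e0.
exists N, N.+1%:R^-1; first by rewrite invr_gt0.
move=> y xy; apply: le_lt_trans PN; apply: le_measure; rewrite ?inE//; first exact: measurable_stalled_cst.
move=> w H n nN.
have k0 : 0 <= N.+1%:R^-1 :> R by rewrite invr_ge0.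
have h1 := H n nN; have o0 := opnorm_ge0 (iter_prod b n w); have e1 := expR_ge0 (n%:R * c).
have h2 : enorm (iter_prod b n w *m x) <= enorm (iter_prod b n w *m y) + opnorm (iter_prod b n w) * enorm (x - y).
  rewrite -lerBlDl; apply: le_trans (enormB _ _) _.
  by rewrite -mulmxBr; exact: ler_opnorm.
have h3 : enorm y <= enorm x + enorm (x - y).
  by rewrite -lerBlDl enorm_distC; exact: enormB.
have h4 := ler_wpM2l o0 (ltW xy).
have h5 := ler_wpM2l e1 (le_trans h3 (lerD (lexx _) (ltW xy))).
rewrite mulrDr in h5; rewrite mulrDl.
move: h1 h2 h4 h5; set k := N.+1%:R^-1; move: (k) (enorm _) (enorm _) => *; lra.
Qed.

(** The maximum of [growth (iter_prod b n w) x - n c] over [0 <= n <= N]. The recursive form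
    isolates the first step, as in the proof of the maximal ergodic theorem. *)
Fixpoint growth_max N x (w : seqspace T) : R :=
  if N is N'.+1 then
    Num.max 0 (growth (coc b w) x - c + growth_max N' (coc b w *m x) (seq_shift 1 w))
  else 0.

Lemma growth_max_ge0 N x w : 0 <= growth_max N x w.
Proof. by case: N => //= N; rewrite le_max lexx. Qed.

Lemma growth_max_mono N x w : growth_max N x w <= growth_max N.+1 x w.
Proof.
elim: N x w => [|N IHN] x w; first exact: growth_max_ge0.
rewrite [growth_max N.+2 x w]/= [growth_max N.+1 x w]/= ge_max le_max lexx /=.
by rewrite le_max lerD2l IHN orbT.
Qed.

Lemma coc_unit w : coc b w \in unitmx.
Proof. by have [ub _ _] := hb; exact: ub. Qed.

Lemma step_growth_le x w : x != 0 -> `|growth (coc b w) x - c| <= step_size b c w.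
Proof.
move=> x0; apply: le_trans (ler_normB _ _) _.
by rewrite lerD2r; apply: growth_le => //; exact: coc_unit.
Qed.

Lemma coc_mulmx_neq0 x w : x != 0 -> coc b w *m x != 0.
Proof. by move=> x0; rewrite mulmx_unit_eq0//; exact: coc_unit. Qed.

Lemma growth_iterS n x w : x != 0 ->
  growth (iter_prod b n.+1 w) x =
  growth (iter_prod b n (seq_shift 1 w)) (coc b w *m x) + growth (coc b w) x.
Proof.
move=> x0; rewrite -addn1 iter_prodD iter_prod1 growthM ?coc_unit//.
exact: GL_moment_iter_unit hb.
Qed.

Lemma growth_max_ge n N x w : x != 0 -> (n <= N)%N ->
  growth (iter_prod b n w) x - n%:R * c <= growth_max N x w.
Proof.
elim: N n x w => [|N IHN] [|n] x w x0 //= nN.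
- by rewrite growth1 mul0r subr0.
- by rewrite growth1 mul0r subr0 le_max lexx.
rewrite le_max; apply/orP; right.
have := IHN n _ (seq_shift 1 w) (coc_mulmx_neq0 w x0) nN.
by rewrite growth_iterS// -natr1; lra.
Qed.

Lemma growth_max_le N x w : x != 0 ->
  growth_max N x w <= \sum_(i < N) step_size b c (seq_shift i w).
Proof.
elim: N x w => [|N IHN] x w x0; first by rewrite big_ord0.
have S0 k : 0 <= step_size b c (seq_shift k w) := step_size_ge0 m0 hb c _.
rewrite [growth_max _ _ _]/= ge_max; apply/andP; split; first by apply: sumr_ge0 => i _.
rewrite big_ord_recl; apply: lerD.
  apply: le_trans (ler_norm _) _; rewrite (_ : seq_shift ord0 w = w); first exact: step_growth_le.
  by apply/funext => j; rewrite /seq_shift addn0.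
apply: le_trans (IHN _ _ (coc_mulmx_neq0 w x0)) _; apply: ler_sum => i _.
rewrite (_ : seq_shift i (seq_shift 1 w) = seq_shift (lift ord0 i) w)//.
by apply/funext => j; rewrite /seq_shift /= /bump /= -addnA addn1 add1n.
Qed.

(** If the maximum is positive it is attained after the first step, whose gain is then at least the
    drop of the maximal function, by monotonicity in [N]. If it is 0, the orbit is stalled and the
    crude bound by [step_size] is charged to that event. *)
Lemma growth_step_ge N x w : x != 0 ->
  growth_max N x w - growth_max N (coc b w *m x) (seq_shift 1 w)
    - step_size b c w * \1_(stalled N x) w <= growth (coc b w) x - c.
Proof.
move=> x0; have g0 := growth_max_ge0 N (coc b w *m x) (seq_shift 1 w).
have S0 : 0 <= step_size b c w := step_size_ge0 m0 hb c w.
have [gp|g00] := ltP 0 (growth_max N x w).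
  have I0 : 0 <= step_size b c w * \1_(stalled N x) w by apply: mulr_ge0 => //; exact: indic_ge0.
  case: N g0 gp I0 => [|N] g0 gp I0; first by rewrite ltxx in gp.
  have mon := growth_max_mono N (coc b w *m x) (seq_shift 1 w).
  move: gp I0 mon; rewrite (_ : growth_max N.+1 x w = Num.max 0
    (growth (coc b w) x - c + growth_max N (coc b w *m x) (seq_shift 1 w)))//.
  rewrite lt_max ltxx orFb => gp; rewrite (max_r (ltW gp)); lra.
have -> : \1_(stalled N x) w = 1 :> R.
  apply: indicE1 => n nN; have := le_trans (growth_max_ge w x0 nN) g00.
  have xp : 0 < enorm x by rewrite enorm_gt0.
  have yp := enorm_mulmx_gt0 (GL_moment_iter_unit n w hb) x0.
  rewrite growthE ?(GL_moment_iter_unit n w hb)// => h.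
  by rewrite -[leLHS]lnK ?posrE// -[X in _ * X]lnK ?posrE// -expRD ler_expR; move: h; lra.
have := step_growth_le w x0; rewrite ler_norml => /andP[h _].
rewrite mulr1; lra.
Qed.

Lemma growth_orbit_ge N n x w : x != 0 ->
  growth_max N x w - growth_max N (iter_prod b n w *m x) (seq_shift n w)
    - \sum_(i < n) step_size b c (seq_shift i w)
        * \1_[set u | stalled N (iter_prod b i u *m x) (seq_shift i u)] w
  <= growth (iter_prod b n w) x - n%:R * c.
Proof.
move=> x0; elim: n => [|n IHn].
  have -> : seq_shift 0 w = w by apply/funext => j; rewrite /seq_shift addn0.
  by rewrite big_ord0 /iter_prod /= mul1mx growth1 mul0r !subrr.
have un := GL_moment_iter_unit n w hb.
have y0 : iter_prod b n w *m x != 0 by rewrite mulmx_unit_eq0.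
have E : iter_prod b n.+1 w = coc b (seq_shift n w) *m iter_prod b n w by [].
rewrite big_ord_recr /= E growthM ?coc_unit// -mulmxA.
have := growth_step_ge N (seq_shift n w) y0.
have -> : seq_shift 1 (seq_shift n w) = seq_shift n.+1 w.
  by apply/funext => j; rewrite /seq_shift -addnA add1n.
have -> : \1_(stalled N (iter_prod b n w *m x)) (seq_shift n w) =
    \1_[set u | stalled N (iter_prod b n u *m x) (seq_shift n u)] w :> R.
  exact: indic_iff.
move: IHn; rewrite -[n.+1%:R]natr1 [(_ + 1) * c]mulrDl mul1r; lra.
Qed.

(** The direction at time [i] is fixed by the past, and the stalled event after time [i] depends on
    the independent future. The bound uniform in [y] therefore applies to the random direction. *)
Lemma stalled_step_le i N x eta dl : x != 0 -> 0 < eta -> 0 <= dl ->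
  (forall y, y != 0 -> (P (stalled N y) <= dl%:E)%E) ->
  EPle P (fun w => step_size b c (seq_shift i w)
      * \1_[set u | stalled N (iter_prod b i u *m x) (seq_shift i u)] w)
    ((eta * step_variance s M c + dl / eta) / 2).
Proof.
move=> x0 eta0 dl0 PN; have [ub mb _] := hb.
have V0 := step_variance_ge0 s M1 c.
have k0 : 0 <= (eta * step_variance s M c + dl / eta) / 2.
  by apply: divr_ge0 => //; apply: addr_ge0; [exact: mulr_ge0 (ltW eta0) V0|exact: divr_ge0 dl0 (ltW eta0)].
rewrite -[X in (_ <= X%:E)%E]mulr1.
have mS : measurable [set u | stalled N (iter_prod b i u *m x) (seq_shift i u)].
  apply: measurable_stalled; last exact: measurable_seq_shift.
  by apply: mx_measurableM; [exact: iter_prod_measurable|exact: mx_measurable_cst].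
apply: (EP_splice_le hP (k := i) (g := fun=> 1)) => //.
- by apply: measurable_funM; [exact: (measurable_step_size_shift hb)|exact: measurable_indic].
- by move=> w; apply: mulr_ge0; [exact: (step_size_ge0 m0 hb)|exact: indic_ge0].
- move=> u; rewrite mulr1.
  have y0 : iter_prod b i u *m x != 0 by rewrite mulmx_unit_eq0//; exact: GL_moment_iter_unit hb.
  have H := step_size_indic hP m0 s0 hb c 0 (measurable_stalled_cst N _) eta0 (PN _ y0).
  apply: le_trans _ H; rewrite le_eqVlt; apply/orP; left; apply/eqP.
  apply: EP_eq => v; rewrite seq_shift_splice.
  have -> : seq_shift 0 v = v by apply/funext => j; rewrite /seq_shift addn0.
  congr (_ * _); apply: indic_iff.
  by rewrite /= iter_prod_splice seq_shift_splice.
by rewrite EP_cst.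
Qed.

(** Summing [growth_step_ge] telescopes the maximal functions. Stalled steps cost at most [e] each
    on average; the maximal function at the end of the orbit is bounded by [N] further steps of mean
    at most [(V + 1) / 2], which gives [C]. The pointwise form with an error [Z] can be inserted
    directly into [ln_pcontr]. *)
Lemma growth_iter_ge e : 0 < e -> exists2 C, 0 <= C & forall n x, x != 0 ->
  exists Z : seqspace T -> R, [/\ measurable_fun setT Z, forall w, 0 <= Z w,
    EPle P Z (n%:R * e + C) & forall w, n%:R * c - Z w <= growth (iter_prod b n w) x].
Proof.
move=> e0; set V := step_variance s M c.
have V0 : 0 <= V := step_variance_ge0 s M1 c.
have V1 : 0 < V + 1 by rewrite ltr_wpDl.
pose eta := e / (V + 1); have eta0 : 0 < eta by rewrite divr_gt0.
pose dl := eta * e; have dl0 : 0 < dl by rewrite mulr_gt0.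
have [N PN] := stalled_small dl0.
have PN' y : y != 0 -> (P (stalled N y) <= dl%:E)%E by move=> y0; apply: ltW; exact: PN.
have e1 : (eta * V + dl / eta) / 2 <= e.
  have -> : dl / eta = e by rewrite /dl; field; rewrite gt_eqF.
  have : eta * V <= e.
    have -> : eta * V = e * (V / (V + 1)) by rewrite /eta; field; rewrite gt_eqF.
    by apply: ler_piMr; [exact: ltW|rewrite ler_pdivrMr// mul1r lerDl].
  lra.
exists (N%:R * ((V + 1) / 2)); first by apply: mulr_ge0 => //; apply: divr_ge0 => //; exact: ltW.
move=> n x x0.
pose X (i : 'I_n) (w : seqspace T) := step_size b c (seq_shift i w)
  * \1_[set u | stalled N (iter_prod b i u *m x) (seq_shift i u)] w.
pose Y (i : 'I_N) (w : seqspace T) := step_size b c (seq_shift (i + n) w).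
have [ub mb _] := hb.
have mX i : measurable_fun [set: seqspace T] (X i).
  apply: measurable_funM; first exact: (measurable_step_size_shift hb).
  apply: measurable_indic; apply: measurable_stalled; last exact: measurable_seq_shift.
  by apply: mx_measurableM; [exact: iter_prod_measurable|exact: mx_measurable_cst].
have X0 i w : 0 <= X i w by apply: mulr_ge0; [exact: (step_size_ge0 m0 hb)|exact: indic_ge0].
have mY i : measurable_fun [set: seqspace T] (Y i) by exact: (measurable_step_size_shift hb).
have Y0 i w : 0 <= Y i w by exact: (step_size_ge0 m0 hb).
have EX i : EPle P (X i) e.
  by apply: le_trans (stalled_step_le i x0 eta0 (ltW dl0) PN') _; rewrite lee_fin.
have EY i : EPle P (Y i) ((V + 1) / 2).
  have PT : (P [set: seqspace T] <= 1%:E)%E by rewrite probability_setT.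
  have H := step_size_indic hP m0 s0 hb c (i + n) measurableT ltr01 PT.
  rewrite !mul1r invr1 in H; apply: le_trans _ H; rewrite le_eqVlt; apply/orP; left; apply/eqP.
  by apply: EP_eq => w; rewrite /Y indicE1// mulr1.
have H1 := EP_sum_le mX X0 EX; have H2 := EP_sum_le mY Y0 EY.
rewrite !card_ord in H1 H2.
exists (fun w => \sum_i X i w + \sum_i Y i w); split.
- by apply: measurable_funD; apply: measurable_sum.
- by move=> w; apply: addr_ge0; apply: sumr_ge0 => i _.
- by apply: EPD_le => //; [exact: measurable_sum|exact: measurable_sum|move=> w; exact: sumr_ge0|move=> w; exact: sumr_ge0].
move=> w; have := growth_orbit_ge N n w x0.
have g0 := growth_max_ge0 N x w.
have y0 : iter_prod b n w *m x != 0 by rewrite mulmx_unit_eq0//; exact: GL_moment_iter_unit hb.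
have g1 : growth_max N (iter_prod b n w *m x) (seq_shift n w) <= \sum_i Y i w.
  apply: le_trans (growth_max_le N _ y0) _; apply: ler_sum => i _.
  by rewrite /Y (_ : seq_shift i (seq_shift n w) = seq_shift (i + n) w)//; apply/funext => j; rewrite /seq_shift addnA.
move: g0 g1; rewrite -/(X _ _); lra.
Qed.

End growth_lower_bound.

(** * Contraction on average from the spectral gap *)

Section contraction_from_gap.
Context {R : realType} d (T : measurableType d).
Context (p : probability T R) (P : probability (seqspace T) R) (hP : is_bernoulli p P).
Context (m : nat) (m2 : (2 <= m)%N).
Context (b : T -> 'M[R]_m) (s M : R) (s0 : 0 < s) (M1 : 1 <= M) (hb : GL_moment P b s M).
Implicit Types (x : 'cV[R]_m).

Let m0 : (0 < m)%N := ltnW m2.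

Let lc : R := `|ln (ext2_const R m)|.

Lemma ln_pcontr_le n x w : x != 0 ->
  `|ln (pcontr (iter_prod b n w) x)| <= lc + 4 * ln (gl_size (iter_prod b n w)).
Proof.
move=> x0; have u := GL_moment_iter_unit n w hb.
rewrite ln_pcontr//; apply: le_trans (ler_normB _ _) _.
rewrite normrM (ger0_norm (ler0n _ 2)).
have h1 := ln_opnorm_exterior_power2_le m2 u; have h2 := growth_le u x0.
have h3 := ler_norm (ln (ext2_const R m)).
move: h1 h2 h3; rewrite /lc; lra.
Qed.

Lemma measurable_ln_pcontr n x :
  measurable_fun [set: seqspace T] (fun w => ln (pcontr (iter_prod b n w) x)).
Proof.
have [_ mb _] := hb; apply: measurable_lnf; apply: measurable_pcontr.
exact: iter_prod_measurable.
Qed.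

Lemma integrable_ln_pcontr n x : x != 0 ->
  P.-integrable setT (EFin \o (fun w => ln (pcontr (iter_prod b n w) x))).
Proof.
move=> x0.
have lc0 : 0 <= lc by exact: normr_ge0.
by have [] := ln_size_dominated hP m0 s0 hb lc0 (ler0n _ 4) (measurable_ln_pcontr n x)
  (fun w => ln_pcontr_le n w x0).
Qed.

(* Second order Taylor expansion of [alpha |-> E (pcontr ^ alpha)] at [0]. *)
Lemma contracting_of_ln N :
  (forall x, x != 0 -> \int[P]_w ln (pcontr (iter_prod b N w) x) <= -1) ->
  exists alpha theta, [/\ 0 < alpha, 14 * alpha <= s, theta < 1 & contracting P alpha N b theta].
Proof.
move=> H; have [ub mb bM] := hb.
(* In the Taylor remainder [X^2] costs [expR (2 * q * |X|)] and [expR (alpha * |X|)] costs another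
   [q]. As [|X| <= lc + 4 * ln (gl_size _)], the total exponent of the size is [12 * q = s]. *)
pose q := s / 12; have q0 : 0 < q by rewrite divr_gt0.
pose D := q^-1 ^+ 2 * (expR (3 * q * lc) * M ^+ N).
have M0 : 0 < M := lt_le_trans ltr01 M1.
have D0 : 0 < D.
  by apply: mulr_gt0; [rewrite exprn_gt0// invr_gt0|apply: mulr_gt0; [exact: expR_gt0|exact: exprn_gt0]].
(* The bound [s / 14] is the one the perturbation estimates ask for; the other gives
   [alpha^2 * D <= alpha / 2], hence a rate at most [1 - alpha / 2]. *)
pose alpha := Num.min (s / 14) (2 * D)^-1.
have al0 : 0 < alpha by rewrite lt_min divr_gt0// invr_gt0 mulr_gt0.
have als : 14 * alpha <= s by rewrite mulrC -ler_pdivlMr// ge_min lexx.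
have alq : alpha <= q by rewrite ge_min; apply/orP; left; rewrite /q; lra.
have alD : alpha * D <= 2^-1.
  rewrite -ler_pdivlMr// ge_min; apply/orP; right.
  by rewrite invfM.
exists alpha, (1 - alpha + alpha ^+ 2 * D); split=> //.
  have -> : alpha ^+ 2 * D = alpha * (alpha * D) by ring.
  have := ler_wpM2l (ltW al0) alD; lra.
move=> x x0.
pose X w := ln (pcontr (iter_prod b N w) x).
pose W w := expR (3 * q * lc) * gl_size (iter_prod b N w) `^ s.
have K1 w : 1 <= gl_size (iter_prod b N w) := gl_size_ge1 m0 (GL_moment_iter_unit N w hb).
have K0 w : 0 < gl_size (iter_prod b N w) := lt_le_trans ltr01 (K1 w).
have W0 w : 0 <= W w by apply: mulr_ge0; [exact: expR_ge0|exact: powR_ge0].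
have mKs : measurable_fun [set: seqspace T] (fun w : seqspace T => gl_size (iter_prod b N w) `^ s).
  apply: measurable_powRf; apply: measurable_gl_size; first by move=> w; exact: iter_prod_unit.
  exact: iter_prod_measurable.
have mW : measurable_fun [set: seqspace T] W.
  by apply: measurable_funM => //; exact: measurable_cst.
have EW : EPle P W (expR (3 * q * lc) * M ^+ N).
  apply: (EPZ_le (expR_ge0 _) mKs); first by move=> w; exact: powR_ge0.
  exact: (moment_iter_prod hP N ub mb s0 M1 bM m0).
have XW w : pcontr (iter_prod b N w) x `^ alpha <= 1 + alpha * X w + alpha ^+ 2 * (q^-1 ^+ 2 * W w).
  have pc0 : 0 < pcontr (iter_prod b N w) x := pcontr_gt0 m2 (GL_moment_iter_unit N w hb) x0.
  have -> : pcontr (iter_prod b N w) x `^ alpha = expR (alpha * X w).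
    by rewrite -ln_powR lnK// posrE powR_gt0.
  apply: le_trans (expR_le_quadratic _) _; rewrite lerD2l exprMn -mulrA.
  apply: ler_wpM2l; first exact: sqr_ge0.
  set z := `|X w|.
  have z0 : 0 <= z by exact: normr_ge0.
  have -> : X w ^+ 2 = z ^+ 2 by rewrite real_normK ?num_real.
  have zle := ler_expR_div z q0.
  have z2 : z ^+ 2 <= q^-1 ^+ 2 * expR (2 * (q * z)).
    have -> : expR (2 * (q * z)) = expR (q * z) ^+ 2 by rewrite expRM_natl.
    by rewrite -exprMn ler_pXn2r ?nnegrE// (le_trans z0).
  rewrite normrM (gtr0_norm al0) -/z.
  apply: le_trans (ler_wpM2r (expR_ge0 _) z2) _.
  rewrite -mulrA -expRD; apply: ler_wpM2l; first exact: sqr_ge0.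
  have -> : W w = expR (3 * q * lc + s * ln (gl_size (iter_prod b N w))).
    by rewrite expRD -ln_powR lnK// posrE powR_gt0.
  rewrite ler_expR.
  have zb : z <= lc + 4 * ln (gl_size (iter_prod b N w)) := ln_pcontr_le N w x0.
  have aq := ler_wpM2r z0 alq.
  have qz : 3 * q * z <= 3 * q * (lc + 4 * ln (gl_size (iter_prod b N w))).
    by apply: ler_wpM2l => //; apply: mulr_ge0 => //; exact: ltW.
  have -> : s = 12 * q by rewrite /q; field.
  move: aq qz; move: (ln (gl_size _)) => L; lra.
have Xi : P.-integrable setT (EFin \o X) := integrable_ln_pcontr N x0.
have Wi : P.-integrable setT (EFin \o W).
  apply: (EP_integrable mW); apply: le_trans EW; rewrite le_eqVlt; apply/orP; left; apply/eqP.
  by apply: EP_eq => w; rewrite ger0_norm.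
pose k := alpha ^+ 2 * q^-1 ^+ 2.
pose f w := 1 + alpha * X w + k * W w.
have i1 : P.-integrable setT (EFin \o (fun=> 1 : R) : seqspace T -> \bar R).
  by apply: (@EP_integrable _ _ _ _ _ 1); [exact: measurable_cst|rewrite EP_cst normr1].
have iX : P.-integrable setT (EFin \o (fun w => alpha * X w)).
  exact: (integrableZl measurableT alpha Xi).
have iW : P.-integrable setT (EFin \o (fun w => k * W w)).
  exact: (integrableZl measurableT k Wi).
have iX1 : P.-integrable setT (EFin \o (fun w => 1 + alpha * X w)).
  exact: (integrableD measurableT i1 iX).
have fi : P.-integrable setT (EFin \o f).
  exact: (integrableD measurableT iX1 iW).
apply: (@le_trans _ _ (EP P f)).
  apply: EP_le => w; first exact: powR_ge0.
  by apply: le_trans (XW w) _; rewrite /f /k mulrA.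
have I1 : \int[P]_w (1 : R) = 1.
  by apply/eqP; rewrite -eqe -(EP_Rintegral i1) EP_cst.
have eX : \int[P]_w (alpha * X w) = alpha * \int[P]_w X w := RintegralZl alpha measurableT Xi.
have eW : \int[P]_w (k * W w) = k * \int[P]_w W w := RintegralZl k measurableT Wi.
have ef : \int[P]_w f w = 1 + alpha * \int[P]_w X w + k * \int[P]_w W w.
  have ef1 : \int[P]_w (1 + alpha * X w) = 1 + alpha * \int[P]_w X w.
    by have := RintegralD measurableT i1 iX; rewrite eX I1.
  by have := RintegralD measurableT iX1 iW; rewrite ef1 eW.
rewrite (EP_Rintegral fi) lee_fin ef.
have IW : \int[P]_w W w <= expR (3 * q * lc) * M ^+ N.
  by rewrite -lee_fin -(EP_Rintegral Wi).
have k0 : 0 <= k by apply: mulr_ge0; exact: sqr_ge0.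
have h1 := ler_wpM2l k0 IW; have h2 : alpha * \int[P]_w X w <= alpha * -1 := ler_wpM2l (ltW al0) (H x x0).
have -> : alpha ^+ 2 * D = k * (expR (3 * q * lc) * M ^+ N) by rewrite /k /D; ring.
move: h1 h2; rewrite mulrN1; move: (\int[P]_w X w) (\int[P]_w W w) => I J; lra.
Qed.

Lemma contracting_of_gap : lyapunov P (coc b) 2 < lyapunov P (coc b) 1 ->
  quasi_irreducible P (coc b) ->
  exists N alpha theta, [/\ (0 < N)%N, 0 < alpha, 14 * alpha <= s, theta < 1 &
    contracting P alpha N b theta].
Proof.
have ineq (u g z v : R) : v - z <= g -> u - 2 * g - u <= - (2 * v) + 2 * z by lra.
have ineq_end (i e C n l k : R) : i - e <= - (2 * (n * (l - k))) + 2 * (n * k + C) ->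
    e <= n * (2 * l - 7 * k) -> 2 * C + 1 <= n * (3 * k) -> i <= -1 by lra.
move=> gap qi; have [ub mb bM] := hb.
have l1 : lyapunov P (coc b) 1 = lyapunov_sum P (coc b) 1.
  by rewrite /lyapunov lyapunov_sum0 subr0.
have l2 : lyapunov P (coc b) 2 = lyapunov_sum P (coc b) 2 - lyapunov_sum P (coc b) 1 by [].
move: gap; rewrite l2 -l1 => gap.
(* The gap is split into eight parts [kap]. One covers the convergence of the exterior square, two
   the choice of [c = lambda_1 - kap], two the error [n * kap] in the growth; the remaining
   [3 * n * kap] beats the constant [2 * C + 1]. *)
have aux (u v : R) : v - u < u -> exists2 k, 0 < k & v = 2 * u - 8 * k.
  move=> uv; exists ((2 * u - v) / 8); last by field.
  by apply: divr_gt0; [lra|exact: ltr0n].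
have [kap kap0 Sl] := aux _ _ gap.
have cl : lyapunov P (coc b) 1 - kap < lyapunov P (coc b) 1 by rewrite ltrBlDr ltrDl.
have fast := quasi_irreducible_not_slow hP m0 s0 M1 hb qi cl.
have [C C0 HC] := growth_iter_ge hP m0 s0 M1 hb fast kap0.
have cv := lyapunov_sum2_cvg hP m0 s0 m2 hb.
rewrite {}Sl in cv.
set l := lyapunov P (coc b) 1 in cv fast HC; move: l cv fast HC => l cv fast HC.
have Sk : 2 * l - 8 * kap < 2 * l - 7 * kap by rewrite ltrD2l ltrN2 ltr_pM2r// ltr_nat.
have [n0 _ Hn0] := cvgr_lt _ cv _ Sk.
have [n [n_gt0 nn0 nbig]] : exists n, [/\ (0 < n)%N, (n0 <= n)%N & 2 * C + 1 <= n%:R * (3 * kap)].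
  exists (maxn n0 (Num.truncn ((2 * C + 1) / (3 * kap)))).+1; split=> //.
    by apply: leq_trans (leqnSn _); exact: leq_maxl.
  have k3 : 0 < 3 * kap by rewrite mulr_gt0.
  rewrite -ler_pdivrMr//; apply: ltW; apply: lt_le_trans (truncnS_gt _) _.
  by rewrite ler_nat ltnS leq_maxr.
have n1 : 0 < n%:R :> R by rewrite ltr0n.
have Eint : \int[P]_w ln (opnorm (exterior_power 2 (iter_prod b n w))) <= n%:R * (2 * l - 7 * kap).
  by have := Hn0 n nn0; rewrite /= ltr_pdivrMl// => /ltW.
have [|alpha [theta [h1 h2 h3 h4]]] := @contracting_of_ln n; last by exists n, alpha, theta.
move=> x x0.
have [Z [mZ Z0 EZ HZ]] := HC n x x0.
pose E w := ln (opnorm (exterior_power 2 (iter_prod b n w))).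
have mE : measurable_fun [set: seqspace T] E.
  apply: measurable_lnf; apply: measurable_opnorm; apply: mx_measurable_exterior_power.
  exact: iter_prod_measurable.
have Ei : P.-integrable setT (EFin \o E).
  have lc0 : 0 <= lc by exact: normr_ge0.
  have HE w : `|E w| <= lc + 2 * ln (gl_size (iter_prod b n w)).
    apply: le_trans (ln_opnorm_exterior_power2_le m2 (GL_moment_iter_unit n w hb)) _.
    by rewrite lerD2r ler_norm.
  by have [] := ln_size_dominated hP m0 s0 hb lc0 (ler0n _ 2) mE HE.
have Xi := integrable_ln_pcontr n x0.
have XEi : P.-integrable setT (EFin \o (fun w => ln (pcontr (iter_prod b n w) x) - E w)).
  exact: (integrableB measurableT Xi Ei).
have EZ2 : EPle P (fun w => 2 * Z w) (2 * (n%:R * kap + C)) by exact: EPZ_le.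
have Hle : \int[P]_w (ln (pcontr (iter_prod b n w) x) - E w) <=
    - (2 * (n%:R * (l - kap))) + 2 * (n%:R * kap + C).
  apply: (Rintegral_le_EP XEi _ _ EZ2).
  - by apply: measurable_funM => //; exact: measurable_cst.
  - by move=> w; apply: mulr_ge0.
  move=> w; rewrite ln_pcontr//; last exact: (GL_moment_iter_unit n w hb).
  exact: ineq (HZ w).
rewrite (RintegralB measurableT Xi Ei) in Hle.
exact: ineq_end Hle Eint nbig.
Qed.

End contraction_from_gap.

(** * Hoelder continuity *)

Section holder_locally_constant.
Context {R : realType} d (T : measurableType d).
Context (p : probability T R) (P : probability (seqspace T) R) (hP : is_bernoulli p P).
Context (m : nat) (m2 : (2 <= m)%N) (s M : R) (s0 : 0 < s) (s1 : s <= 1) (M1 : 1 <= M).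
Implicit Types (b : T -> 'M[R]_m).

Let m0 : (0 < m)%N := ltnW m2.

Lemma contracting_le alpha N b theta theta' : theta <= theta' ->
  contracting P alpha N b theta -> contracting P alpha N b theta'.
Proof. by move=> h H x x0; apply: le_trans (H x x0) _; rewrite lee_fin. Qed.

(** Compare the two exponents along times [j * N]. Replacing norms by the growth of one vector costs
    [K] for all [j], which division by [j * N] removes; the telescoped error is proportional to [j]
    and survives. *)
Lemma lyapunov_diff_contracting alpha N theta b b' e : (0 < N)%N -> 0 < alpha -> 14 * alpha <= s ->
  theta < 1 -> GL_moment P b s M -> GL_moment P b' s M ->
  contracting P alpha N b theta -> contracting P alpha N b' theta ->
  0 < e -> EPle P (fun w => opnorm (coc b w - coc b' w)) e ->
  `|lyapunov P (coc b) 1 - lyapunov P (coc b') 1| <=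
    growth_diff_const M alpha N theta / N%:R * e `^ alpha.
Proof.
have triangle (l l' u u' z e' : R) : `|l - u| < z / 4 -> `|l' - u'| < z / 4 ->
    `|u - u'| <= z / 2 + e' -> `|l - l'| <= e' + z.
  by rewrite !ltr_norml !ler_norml => /andP[? ?] /andP[? ?] /andP[? ?]; apply/andP; split; lra.
move=> N0 al0 als th1 hb hb' cb cb' e0 be.
have [cv _] := lyapunov_cvg hP m0 s0 hb; have [cv' _] := lyapunov_cvg hP m0 s0 hb'.
have [_ mb _] := hb; have [_ mb' _] := hb'.
apply/ler_addgt0Pr => z z0; have z4 : 0 < z / 4 by rewrite divr_gt0.
have /cvgrPdist_lt/(_ _ z4)[n1 _ H1] := cv; have /cvgrPdist_lt/(_ _ z4)[n2 _ H2] := cv'.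
pose K := opnorm_const m M alpha N theta + opnorm_const m M alpha N theta.
pose G := growth_diff_const M alpha N theta.
have [j [j0 jn1 jn2 jK]] : exists j, [/\ (0 < j)%N, (n1 <= j * N)%N, (n2 <= j * N)%N &
    K <= j%:R * (N%:R * (z / 2))].
  have Nz : 0 < N%:R * (z / 2) by rewrite mulr_gt0 ?ltr0n// divr_gt0.
  exists (maxn (maxn n1 n2) (Num.truncn (K / (N%:R * (z / 2))))).+1; split=> //.
  - apply: leq_trans (leq_pmulr _ N0); apply: leq_trans (leqnSn _).
    by rewrite !leq_max leqnn.
  - apply: leq_trans (leq_pmulr _ N0); apply: leq_trans (leqnSn _).
    by rewrite !leq_max leqnn orbT.
  rewrite -ler_pdivrMr//; apply: ltW; apply: lt_le_trans (truncnS_gt _) _.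
  by rewrite ler_nat ltnS leq_maxr.
set n := (j * N)%N in jn1 jn2.
have n0 : 0 < n%:R :> R by rewrite ltr0n muln_gt0 j0.
apply: triangle (H1 n jn1) (H2 n jn2) _.
have H := ln_opnorm_diff_iter hP m0 al0 als s1 M1 th1 j hb hb' e0 be cb cb'.
have Xi (c : T -> 'M[R]_m) : GL_moment P c s M ->
    P.-integrable setT (EFin \o (fun w => ln (opnorm (iter_prod c n w)))).
  move=> hc; have [_ mc _] := hc.
  have mX : measurable_fun [set: seqspace T] (fun w => ln (opnorm (iter_prod c n w))).
    by apply: measurable_lnf; apply: measurable_opnorm; exact: iter_prod_measurable.
  have XH w : `|ln (opnorm (iter_prod c n w))| <= 0 + 1 * ln (gl_size (iter_prod c n w)).
    by rewrite add0r mul1r; exact: (ln_opnorm_le_size m0 (GL_moment_iter_unit n w hc)).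
  by have [] := ln_size_dominated hP m0 s0 hc (lexx _) ler01 mX XH.
have XBi := integrableB measurableT (Xi b hb) (Xi b' hb').
rewrite -mulrBr -(RintegralB measurableT (Xi b hb) (Xi b' hb')) normrM.
rewrite (gtr0_norm (_ : 0 < n%:R^-1)) ?invr_gt0//.
set I := `|_|; have HI : I <= K + j%:R * G * e `^ alpha.
  apply: le_trans (le_normr_Rintegral measurableT XBi) _.
  rewrite -lee_fin; apply: le_trans (H); rewrite -EP_Rintegral//.
  apply: (EP_integrable (a := K + j%:R * G * e `^ alpha)).
    by have /measurable_int/measurable_EFinP mX := XBi; exact: measurableT_comp.
  by apply: le_trans H; apply: EP_le => w; rewrite ?normr_ge0// normr_id.
rewrite ler_pdivrMl//; apply: le_trans HI _.
have -> : n%:R = j%:R * N%:R :> R by rewrite natrM.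
rewrite mulrDr; apply: lerD; first by rewrite -mulrA.
have N1 : N%:R != 0 :> R by rewrite pnatr_eq0 -lt0n.
by rewrite le_eqVlt; apply/orP; left; apply/eqP; rewrite -/G; field.
Qed.

Lemma lyapunov_holder_near b0 : GL_moment P b0 s M ->
  lyapunov P (coc b0) 2 < lyapunov P (coc b0) 1 -> quasi_irreducible P (coc b0) ->
  exists r C gamma, [/\ 0 < r, 0 < C, 0 < gamma, gamma <= 1 &
    forall b b', GL_moment P b s M -> GL_moment P b' s M ->
      EPle P (fun w => opnorm (coc b0 w - coc b w)) r ->
      EPle P (fun w => opnorm (coc b0 w - coc b' w)) r ->
      forall e, 0 < e -> EPle P (fun w => opnorm (coc b w - coc b' w)) e ->
      `|lyapunov P (coc b) 1 - lyapunov P (coc b') 1| <= C * e `^ gamma].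
Proof.
have half (t : R) : t < 1 -> t + (1 - t) / 2 < 1 by lra.
move=> h0 gap qi.
have [N [alpha [theta [N0 al0 als th1 cb0]]]] := contracting_of_gap hP m2 s0 M1 h0 gap qi.
have M0 : 0 < M := lt_le_trans ltr01 M1.
pose q := pcontr_const (R := R) m `^ alpha * perturb_const M N.
have q0 : 0 <= q.
  apply: mulr_ge0; first exact: powR_ge0.
  by apply: mulr_ge0; [exact: addr_ge0|apply: exprn_ge0; exact: ltW].
have q1 : 0 < q + 1 by rewrite ltr_wpDl.
(* Chosen so that [q * dl <= (1 - theta) / 2], and [r] so that [r^alpha = dl]: every cocycle in the
   ball contracts at the midpoint of [theta] and 1. Using [q + 1] covers the case [q = 0]. *)
pose dl := (1 - theta) / 2 / (q + 1).
have dl0 : 0 < dl by apply: divr_gt0 => //; apply: divr_gt0; rewrite ?subr_gt0.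
pose r := dl `^ alpha^-1.
have r0 : 0 < r by exact: powR_gt0.
have ra : r `^ alpha = dl by rewrite /r -powRrM mulVf ?gt_eqF// powRr1// ltW.
pose th := theta + (1 - theta) / 2.
have th_lt1 : th < 1 := half _ th1.
have near b : GL_moment P b s M -> EPle P (fun w => opnorm (coc b0 w - coc b w)) r ->
    contracting P alpha N b th.
  move=> hb br.
  apply: contracting_le (contracting_perturb hP m0 al0 als s1 M1 h0 hb r0 br cb0).
  rewrite ra mulrA -/q lerD2l /dl.
  rewrite mulrCA ler_piMr//; first by apply: divr_ge0 => //; rewrite subr_ge0 ltW.
  by rewrite ler_pdivrMr// mul1r lerDl.
pose C := `|growth_diff_const M alpha N th / N%:R| + 1.
have C0 : 0 < C by apply: ltr_wpDl ltr01; exact: normr_ge0.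
have al1 : alpha <= 1.
  by apply: le_trans s1; apply: le_trans als; apply: ler_peMl; [exact: ltW|rewrite ler1n].
exists r, C, alpha; split; [exact: r0|exact: C0|exact: al0|exact: al1|].
move=> b b' hb hb' br br' e e0 be.
apply: le_trans (lyapunov_diff_contracting N0 al0 als th_lt1 hb hb' (near b hb br) (near b' hb' br') e0 be) _.
apply: ler_wpM2r; first exact: powR_ge0.
by apply: le_trans (ler_norm _) _; rewrite /C lerDl.
Qed.

End holder_locally_constant.

(** * Transposed cocycles *)

Section transposition.
Context {R : realType} d (T : measurableType d).
Context (p : probability T R) (P : probability (seqspace T) R) (hP : is_bernoulli p P).
Context (m : nat).
Implicit Types (b : T -> 'M[R]_m).

Definition tr_step b : T -> 'M[R]_m := fun t => (b t)^T.

(** Transposition reverses the order of the factors, and [flip n] restores it. Since [flip n]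
    preserves [P], the expectations at each time [n] agree, although the two processes differ
    pathwise. *)
Lemma iter_prod_tr b n w : iter_prod (tr_step b) n w = (iter_prod b n (flip n w))^T.
Proof.
elim: n => [|n IHn]; first by rewrite /iter_prod /= trmx1.
have E v : iter_prod b n.+1 v = iter_prod b n (seq_shift 1 v) *m b (v 0%N).
  by rewrite -addn1 iter_prodD iter_prod1.
rewrite -[LHS]/(coc (tr_step b) (seq_shift n w) *m iter_prod (tr_step b) n w) IHn E trmx_mul.
congr (_ *m _^T); first by rewrite /coc /tr_step /seq_shift /flip /= subn1 add0n.
apply: iter_prod_ext => i ilt; rewrite /flip /seq_shift ilt addn1 ltnS ilt.
by rewrite subSS.
Qed.

Lemma lyapunov_sum_tr b k : mx_measurable b ->
  lyapunov_sum P (coc (tr_step b)) k = lyapunov_sum P (coc b) k.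
Proof.
move=> mb; rewrite /lyapunov_sum; apply: (congr1 (fun u : nat -> R => limn u)); apply/funext => n.
apply: (congr1 (fun x : R => n%:R^-1 * x)); apply: (congr1 fine).
have mE : measurable_fun [set: seqspace T]
    (fun w : seqspace T => (ln (opnorm (exterior_power k (iter_prod b n w))))%:E).
  apply/measurable_EFinP; apply: measurable_lnf; apply: measurable_opnorm.
  by apply: mx_measurable_exterior_power; exact: iter_prod_measurable.
apply: (etrans _ (integral_flip hP n mE)); apply: eq_integral => w _.
by rewrite -[cocycle_iter _ _ _]/(iter_prod _ _ _) iter_prod_tr exterior_power_tr opnorm_tr.
Qed.

Lemma lyapunov_tr b i : mx_measurable b ->
  lyapunov P (coc (tr_step b)) i = lyapunov P (coc b) i.
Proof. by move=> mb; rewrite /lyapunov !lyapunov_sum_tr. Qed.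

Lemma GL_moment_tr b s M : GL_moment P b s M -> GL_moment P (tr_step b) s M.
Proof.
move=> [ub mb bM]; split.
- by move=> t; rewrite unitmx_tr ub.
- exact: mx_measurable_tr.
apply: le_trans bM; rewrite le_eqVlt; apply/orP; left; apply/eqP.
by apply: EP_eq => w; rewrite -[coc (tr_step b) w]/((coc b w)^T) gl_size_tr.
Qed.

Lemma EP_dist_tr b b' :
  EP P (fun w => opnorm (coc (tr_step b) w - coc (tr_step b') w)) =
  EP P (fun w => opnorm (coc b w - coc b' w)).
Proof.
apply: EP_eq => w; rewrite -[RHS]opnorm_tr; congr opnorm.
by apply/matrixP => i j; rewrite !mxE.
Qed.

End transposition.

(** * Invariance under almost everywhere equality *)

Section almost_everywhere.
Context {R : realType} d (T : measurableType d).
Context (p : probability T R) (P : probability (seqspace T) R) (hP : is_bernoulli p P).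
Context (m : nat).
Implicit Types (b : T -> 'M[R]_m) (A B : seqspace T -> 'M[R]_m).

Lemma cocycle_iter_measurable A n : mx_measurable A -> mx_measurable (cocycle_iter A n).
Proof.
move=> mA; elim: n => [|n IHn]; first exact: mx_measurable_cst.
apply: mx_measurableM => //.
exact: (mx_measurable_comp (@measurable_seq_shift _ T n)).
Qed.

Lemma EP_ae (f g : seqspace T -> R) : measurable_fun setT f -> measurable_fun setT g ->
  {ae P, forall w, f w = g w} -> EP P f = EP P g.
Proof.
move=> mf mg fg; rewrite !EPE; apply: ae_eq_integral => //; try exact/measurable_EFinP.
have FP := ae_filter_ringOfSetsType P.
by move: fg; apply: (@filterS _ (almost_everywhere P) FP) => w -> _.
Qed.

Context (B : seqspace T -> 'M[R]_m) (b : T -> 'M[R]_m).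
Hypothesis (mB : mx_measurable B) (mb : mx_measurable b).
Hypothesis Bb : {ae P, forall w, B w = b (w 0%N)}.

Lemma cocycle_iter_coc : {ae P, forall w, forall n, cocycle_iter B n w = iter_prod b n w}.
Proof.
have H1 := cocycle_iter_ae hP Bb.
have H2 : {ae P, forall w, forall n,
    cocycle_iter (coc b) n w = \big[mulmx/1%:M]_(i <- rev (iota 0 n)) b (w i)}.
  by apply: (cocycle_iter_ae hP); exact: aeW.
have FP := ae_filter_ringOfSetsType P.
move: H1 H2; apply: (@filterS2 _ (almost_everywhere P) FP) => w H1 H2 n.
by rewrite H1 /iter_prod H2.
Qed.

Lemma Rintegral_iter_ae (f : 'M[R]_m -> R) n :
  (forall F : seqspace T -> 'M[R]_m, mx_measurable F -> measurable_fun setT (f \o F)) ->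
  \int[P]_w f (cocycle_iter B n w) = \int[P]_w f (iter_prod b n w).
Proof.
move=> mf; apply: (congr1 fine); apply: ae_eq_integral => //.
- by apply/measurable_EFinP; apply: mf; exact: cocycle_iter_measurable.
- by apply/measurable_EFinP; apply: mf; exact: iter_prod_measurable.
have FP := ae_filter_ringOfSetsType P.
by move: cocycle_iter_coc; apply: (@filterS _ (almost_everywhere P) FP) => w -> _.
Qed.

Lemma lyapunov_sum_ae k : lyapunov_sum P B k = lyapunov_sum P (coc b) k.
Proof.
rewrite /lyapunov_sum; apply: (congr1 (fun u : nat -> R => limn u)); apply/funext => n.
apply: (congr1 (fun x : R => n%:R^-1 * x)).
apply: (Rintegral_iter_ae (f := fun N => ln (opnorm (exterior_power k N)))) => F mF.
by apply: measurable_lnf; apply: measurable_opnorm; exact: mx_measurable_exterior_power.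
Qed.

Lemma lyapunov_ae i : lyapunov P B i = lyapunov P (coc b) i.
Proof. by rewrite /lyapunov !lyapunov_sum_ae. Qed.

Lemma lyapunov_on_ae L : lyapunov_on P B L = lyapunov_on P (coc b) L.
Proof.
rewrite /lyapunov_on; apply: (congr1 (fun u : nat -> R => limn u)); apply/funext => n.
apply: (congr1 (fun x : R => n%:R^-1 * x)).
apply: (Rintegral_iter_ae (f := fun N => ln (opnorm_on L N))) => F mF.
by apply: measurable_lnf; exact: measurable_opnorm_on.
Qed.

Lemma quasi_irreducible_ae : quasi_irreducible P B -> quasi_irreducible P (coc b).
Proof.
move=> qi [L [L0 LT Linv Llt]]; apply: qi; exists L.
split; [exact: L0|exact: LT| |by rewrite lyapunov_on_ae lyapunov_ae].
have FP := ae_filter_ringOfSetsType P.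
by move: Bb Linv; apply: (@filterS2 _ (almost_everywhere P) FP) => w ->.
Qed.

End almost_everywhere.

(** * Reduction of the general case to locally constant representatives *)

Section conclusion.
Context {R : realType} d (T : measurableType d).
Context (p : probability T R) (P : probability (seqspace T) R) (hP : is_bernoulli p P).
Context (m : nat) (m2 : (2 <= m)%N).
Implicit Types (b : T -> 'M[R]_m) (A B : seqspace T -> 'M[R]_m).

Let m0 : (0 < m)%N := ltnW m2.

Lemma lyapunov_holder_near_tr s M b0 : 0 < s -> s <= 1 -> 1 <= M -> GL_moment P b0 s M ->
  lyapunov P (coc b0) 2 < lyapunov P (coc b0) 1 ->
  quasi_irreducible P (coc b0) \/ quasi_irreducible P (coc (tr_step b0)) ->
  exists r C gamma, [/\ 0 < r, 0 < C, 0 < gamma, gamma <= 1 &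
    forall b b', GL_moment P b s M -> GL_moment P b' s M ->
      EPle P (fun w => opnorm (coc b0 w - coc b w)) r ->
      EPle P (fun w => opnorm (coc b0 w - coc b' w)) r ->
      forall e, 0 < e -> EPle P (fun w => opnorm (coc b w - coc b' w)) e ->
      `|lyapunov P (coc b) 1 - lyapunov P (coc b') 1| <= C * e `^ gamma].
Proof.
move=> s0 s1 M1 h0 gap [qi|qi]; first exact: (lyapunov_holder_near hP m2 s0 s1 M1 h0 gap qi).
have [_ mb0 _] := h0.
have gap' : lyapunov P (coc (tr_step b0)) 2 < lyapunov P (coc (tr_step b0)) 1.
  by rewrite !(lyapunov_tr hP _ mb0).
have [r [C [gam [r0 C0 g0 g1 H]]]] :=
  lyapunov_holder_near hP m2 s0 s1 M1 (GL_moment_tr h0) gap' qi.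
exists r, C, gam; split; [exact: r0|exact: C0|exact: g0|exact: g1|].
move=> b b' hb hb' br br' e e0 be.
have [_ mb _] := hb; have [_ mb' _] := hb'.
rewrite -(lyapunov_tr hP 1 mb) -(lyapunov_tr hP 1 mb').
apply: (H _ _ (GL_moment_tr hb) (GL_moment_tr hb') _ _ e e0); rewrite EP_dist_tr.
- exact: br.
- exact: br'.
- exact: be.
Qed.

Definition has_step B b : Prop :=
  [/\ forall t, b t \in unitmx, mx_measurable b & {ae P, forall w, B w = b (w 0%N)}].

Lemma LP_step B : LP P B -> exists b, has_step B b.
Proof. by move=> [_ [b [ub mb] Bb] _ _]; exists b. Qed.

Lemma LP_measurable B : LP P B -> (forall w, B w \in unitmx) /\ mx_measurable B.
Proof. by move=> [[uB mB] _ _ _]. Qed.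

Lemma cocycle_dist_plus_coc A B a b : LP P A -> LP P B -> has_step A a -> has_step B b ->
  cocycle_dist_plus P A B = EP P (fun w => opnorm (coc a w - coc b w)).
Proof.
move=> /LP_measurable[uA mA] /LP_measurable[uB mB] [ua ma Aa] [ub mb Bb].
apply: (EP_ae (f := fun w => opnorm (A w - B w))).
- by apply: measurable_opnorm; exact: mx_measurableB.
- by apply: measurable_opnorm; apply: mx_measurableB; exact: coc_measurable.
have FP := ae_filter_ringOfSetsType P.
by move: Aa Bb; apply: (@filterS2 _ (almost_everywhere P) FP) => w -> ->.
Qed.

Lemma cocycle_dist_coc A B a b : LP P A -> LP P B -> has_step A a -> has_step B b ->
  cocycle_dist P A B = EP P (fun w => opnorm (coc a w - coc b w)
    + opnorm (invmx (coc a w) - invmx (coc b w))).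
Proof.
move=> /LP_measurable[uA mA] /LP_measurable[uB mB] [ua ma Aa] [ub mb Bb].
apply: (EP_ae (f := fun w => opnorm (A w - B w) + opnorm (invmx (A w) - invmx (B w)))).
- apply: measurable_funD; apply: measurable_opnorm; apply: mx_measurableB => //;
    exact: mx_measurableV.
- have mca := coc_measurable ma; have mcb := coc_measurable mb.
  apply: measurable_funD; apply: measurable_opnorm; apply: mx_measurableB => //;
    by apply: mx_measurableV => // w; rewrite /coc.
have FP := ae_filter_ringOfSetsType P.
by move: Aa Bb; apply: (@filterS2 _ (almost_everywhere P) FP) => w -> ->.
Qed.

Lemma dist_plus_le_dist a b :
  (EP P (fun w => opnorm (coc a w - coc b w)%R) <=
   EP P (fun w => (opnorm (coc a w - coc b w) + opnorm (invmx (coc a w) - invmx (coc b w)))%R))%E.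
Proof. by apply: EP_le => w; [exact: opnorm_ge0|rewrite lerDl opnorm_ge0]. Qed.

(** If [D] is the integrand of the distance, subadditivity gives [gl_size b^s <= gl_size a^s + D^s],
    and [D^s <= 1 + D] has mean at most 2. *)
Lemma GL_moment_near s a b E : 0 < s -> s <= 1 ->
  (forall t, a t \in unitmx) -> mx_measurable a -> (forall t, b t \in unitmx) -> mx_measurable b ->
  EPle P (fun w => gl_size (coc a w) `^ s) E ->
  EPle P (fun w => opnorm (coc a w - coc b w) + opnorm (invmx (coc a w) - invmx (coc b w))) 1 ->
  GL_moment P b s (E + 2).
Proof.
move=> s0 s1 ua ma ub mb aE ab; split; [exact: ub|exact: mb|].
have mca := coc_measurable ma; have mcb := coc_measurable mb.
have uca w : coc a w \in unitmx by exact: ua.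
have ucb w : coc b w \in unitmx by exact: ub.
pose D w := opnorm (coc a w - coc b w) + opnorm (invmx (coc a w) - invmx (coc b w)).
have D0 w : 0 <= D w by apply: addr_ge0; exact: opnorm_ge0.
have mD : measurable_fun [set: seqspace T] D.
  by apply: measurable_funD; apply: measurable_opnorm; apply: mx_measurableB => //; exact: mx_measurableV.
have mK : measurable_fun [set: seqspace T] (fun w : seqspace T => gl_size (coc a w) `^ s).
  by apply: measurable_powRf; exact: measurable_gl_size.
have m1D : measurable_fun [set: seqspace T] (fun w => 1 + D w).
  by apply: measurable_funD => //; exact: measurable_cst.
have E1 : EPle P (fun w => 1 + D w) (1 + 1).
  apply: (EPD_le (measurable_cst _) mD _ D0 _ ab) => //.
  by rewrite EP_cst.
have K0 w : 0 <= gl_size (coc a w) `^ s by exact: powR_ge0.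
have D1 w : 0 <= 1 + D w by apply: addr_ge0.
apply: le_trans (EPD_le mK m1D K0 D1 aE E1).
apply: EP_le => w; first exact: powR_ge0.
apply: le_trans (powR_le (ltW s0) (gl_size_ge0 _) (gl_size_le_dist (coc a w) (coc b w))) _.
apply: le_trans (powR_subadd s0 s1 (gl_size_ge0 _) (D0 w)) _.
rewrite lerD2l; have [Dw|Dw] := leP (D w) 1.
  by apply: le_trans (powR_le (ltW s0) (D0 w) Dw) _; rewrite powR1 lerDl.
apply: le_trans (ler_powR (ltW Dw) s1) _.
by rewrite powRr1// lerDr.
Qed.

End conclusion.

(** The estimates above take any positive bound [e] for the distance. This lemma returns to the
    distance itself: if it is 0 then [e] tends to 0, and if it is infinite the right-hand side is
    infinite. *)
Lemma le_poweR_of_forall {R : realType} (l C g : R) (D : \bar R) : 0 < C -> 0 < g -> (0 <= D)%E ->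
  (forall e, 0 < e -> (D <= e%:E)%E -> l <= C * e `^ g) -> (l%:E <= C%:E * D `^ g)%E.
Proof.
move=> C0 g0; case: D => [x| |]//; last first.
  by move=> _ _; rewrite poweRyr ?gt_eqF// gt0_muley ?lte_fin// leey.
rewrite lee_fin => x0 H; rewrite poweR_EFin -EFinM lee_fin.
have [xp|x0'] := ltP 0 x; first exact: H.
have -> : x = 0 by apply/eqP; rewrite eq_le x0 x0'.
rewrite powR0 ?gt_eqF// mulr0; apply/ler_addgt0Pr => z z0; rewrite add0r.
pose e := (z / C) `^ g^-1.
have e0 : 0 < e by apply: powR_gt0; exact: divr_gt0.
have eg : e `^ g = z / C by rewrite /e -powRrM mulVf ?gt_eqF// powRr1// ltW// divr_gt0.
apply: le_trans (H e e0 _) _; first by rewrite lee_fin (le_trans x0')// ltW.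
by rewrite eg mulrCA divff ?mulr1// gt_eqF.
Qed.

Theorem proposition12 (R : realType) (d : measure_display)
    (T : measurableType d) (p : probability T R)
    (P : probability (seqspace T) R) (hP : is_bernoulli p P)
    (m : nat) (hm : (2 <= m)%N)
    (A : seqspace T -> 'M[R]_m) (hA : LP P A)
    (hmoment : exists2 beta : R, 0 < beta &
      (\int[P]_w ((Num.max (opnorm (A w)) (opnorm (invmx (A w)))) `^ beta)%:E
        < +oo)%E)
    (hgap : lyapunov P A 2 < lyapunov P A 1)
    (hirr : quasi_irreducible P A \/ quasi_irreducible P (transpose_cocycle A)) :
  exists2 N : set (seqspace T -> 'M[R]_m), LP_nbhs P A N &
    exists C gamma : R, [/\ 0 < C, 0 < gamma, gamma <= 1 &
      forall B B', N B -> N B' ->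
        (`|lyapunov P B 1 - lyapunov P B' 1|%:E
          <= C%:E * cocycle_dist_plus P B B' `^ gamma)%E].
Proof.
have m0 : (0 < m)%N := ltnW hm.
have [uA mA] := LP_measurable hA.
have [a ha] := LP_step hA; have [ua ma Aa] := ha.
have [beta beta0 Abeta] := hmoment.
(* Subadditivity of powers asks for an exponent at most 1, and lowering the exponent preserves the
   moment bound since sizes are at least 1. *)
pose s := Num.min beta 1.
have s0 : 0 < s by rewrite lt_min beta0 ltr01.
have s1 : s <= 1 by rewrite ge_min lexx orbT.
have [E E0 aE] : exists2 E, 0 <= E & EPle P (fun w => gl_size (coc a w) `^ s) E.
  have mKa : measurable_fun [set: seqspace T] (fun w : seqspace T => gl_size (coc a w) `^ beta).
    apply: measurable_powRf; apply: measurable_gl_size; first by move=> w; exact: ua.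
    exact: coc_measurable.
  have mKA : measurable_fun [set: seqspace T] (fun w : seqspace T => gl_size (A w) `^ beta).
    by apply: measurable_powRf; exact: measurable_gl_size.
  have Eab : EP P (fun w => gl_size (A w) `^ beta) = EP P (fun w => gl_size (coc a w) `^ beta).
    apply: (EP_ae mKA mKa); have FP := ae_filter_ringOfSetsType P.
    by move: Aa; apply: (@filterS _ (almost_everywhere P) FP) => w ->.
  have fin : EP P (fun w => gl_size (coc a w) `^ beta) \is a fin_num.
    rewrite ge0_fin_numE; last by apply: EP_ge0 => w; exact: powR_ge0.
    rewrite -Eab; apply: le_lt_trans Abeta; rewrite -EPE; apply: EP_le => w.
      exact: powR_ge0.
    by rewrite gl_sizeE.
  exists (fine (EP P (fun w => gl_size (coc a w) `^ beta))).
    by apply: fine_ge0; apply: EP_ge0 => w; exact: powR_ge0.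
  rewrite (fineK fin); apply: EP_le => w; first exact: powR_ge0.
  apply: ler_powR; last by rewrite ge_min lexx.
  exact: (gl_size_ge1 m0 (ua (w 0%N))).
have M1 : 1 <= E + 2 by apply: le_trans (_ : 2 <= _); rewrite ?ler1n// lerDr.
have h0 : GL_moment P a s (E + 2).
  split; [exact: ua|exact: ma|]; apply: le_trans aE _.
  by rewrite lee_fin lerDl.
have gap : lyapunov P (coc a) 2 < lyapunov P (coc a) 1.
  by rewrite -!(lyapunov_ae hP mA ma Aa).
have irr : quasi_irreducible P (coc a) \/ quasi_irreducible P (coc (tr_step a)).
  case: hirr => qi; [left|right].
    exact: (quasi_irreducible_ae hP mA ma Aa).
  apply: (quasi_irreducible_ae hP (B := transpose_cocycle A)) qi.
  - exact: mx_measurable_tr.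
  - exact: mx_measurable_tr.
  have FP := ae_filter_ringOfSetsType P.
  by move: Aa; apply: (@filterS _ (almost_everywhere P) FP) => w; rewrite /transpose_cocycle => ->.
have [r [C [gam [r0 C0 g0 g1 H]]]] := lyapunov_holder_near_tr hP hm s0 s1 M1 h0 gap irr.
(* Radius 1 gives the common moment through [GL_moment_near]; radius [r] gives the closeness in
   [d^+] asked for by the local estimate. *)
pose r1 := Num.min r 1.
exists [set B | LP P B /\ (cocycle_dist P A B < r1%:E)%E].
  split; first by move=> B [].
  by exists r1 => //; rewrite lt_min r0 ltr01.
exists C, gam; split; [exact: C0|exact: g0|exact: g1|].
have ball B : LP P B -> (cocycle_dist P A B < r1%:E)%E -> exists b,
    [/\ has_step P B b, GL_moment P b s (E + 2) & EPle P (fun w => opnorm (coc a w - coc b w)) r].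
  move=> hB; have [b hb] := LP_step hB; have [ub mb Bb] := hb.
  rewrite (cocycle_dist_coc hA hB ha hb) => /ltW dB; exists b; split; first exact: hb.
    apply: (GL_moment_near s0 s1 ua ma ub mb aE); apply: le_trans dB _.
    by rewrite lee_fin ge_min lexx orbT.
  apply: le_trans (dist_plus_le_dist _ _ _) _; apply: le_trans dB _.
  by rewrite lee_fin ge_min lexx.
move=> B B' [hB dB] [hB' dB'].
have [b [sb gb rb]] := ball B hB dB; have [b' [sb' gb' rb']] := ball B' hB' dB'.
have [_ mB] := LP_measurable hB; have [_ mB'] := LP_measurable hB'.
have [_ mb Bb] := sb; have [_ mb' Bb'] := sb'.
rewrite (lyapunov_ae hP mB mb Bb) (lyapunov_ae hP mB' mb' Bb').
rewrite (cocycle_dist_plus_coc hB hB' sb sb').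
apply: le_poweR_of_forall => //; first by apply: EP_ge0 => w; exact: opnorm_ge0.
by move=> e e0 be; exact: (H b b' gb gb' rb rb' e e0 be).
Qed.
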